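(* Let $k\ge 3$ and $1\le p_1\le p_2\le\dots\le p_k\le\infty$, and for $n\in\mathbb{N}$ let $X_{\mathbf{p}}^n=\ell_{p_1}^n\otimes_\pi\dots\otimes_\pi\ell_{p_k}^n$. Then the following estimates hold for all $n\in\mathbb{N}$: (1) If $p_k\le 2$, then $$1\lesssim_{\mathbf{p}}\mathrm{vr}(X_{\mathbf{p}}^n)\lesssim_{\mathbf{p}} k.$$ (2) If $\sum_{j=1}^k\frac1{p_j}\ge 1$ and $p_{k-1}\le 2<p_k$, then $$1\lesssim_{\mathbf{p}}\mathrm{vr}(X_{\mathbf{p}}^n)\lesssim_{\mathbf{p}} k\,n^{\min\left(\frac1{p_{k-1}}+\frac1{p_k},\,1\right)-\frac1{p_k}-\frac12}.$$ (3) If $\sum_{j=1}^k\frac1{p_j}\ge 1$ and $p_{k-1}>2$, then $$1\lesssim_{\mathbf{p}}\mathrm{vr}(X_{\mathbf{p}}^n)\lesssim_{\mathbf{p}} k\,n^{\max\left(\frac1{p_{k-1}}+\frac1{p_k},\,\frac12\right)-\frac1{p_{k-1}}-\frac1{p_k}}.$$ (4) If $\sum_{j=1}^k\frac1{p_j}\ge 1$ and $\sum_{j=2}^k\frac1{p_j}\le\frac12$, then $$2^{-\frac k2}\,n^{\frac12-\sum_{j=2}^k\frac1{p_j}}\lesssim_{\mathbf{p}}\mathrm{vr}(X_{\mathbf{p}}^n)\lesssim_{\mathbf{p}} k\,n^{\frac12-\sum_{j=2}^k\frac1{p_j}}.$$ (5) If $\frac12\le\sum_{j=1}^k\frac1{p_j}\le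 1$, then $$2^{-\frac k2}\,n^{\max\left(\frac1{p_1}-\frac12,\,0\right)}\lesssim_{\mathbf{p}}\mathrm{vr}(X_{\mathbf{p}}^n)\lesssim_{\mathbf{p}} k\,n^{\max\left(\frac1{p_1}-\frac12,\,0\right)}.$$ (6) If $\sum_{j=1}^k\frac1{p_j}\le\frac12$, then $$2^{-\frac k2}\,n^{\frac12-\sum_{j=1}^k\frac1{p_j}}\lesssim_{\mathbf{p}}\mathrm{vr}(X_{\mathbf{p}}^n)\lesssim_{\mathbf{p}} k\,n^{\frac12-\sum_{j=1}^k\frac1{p_j}}.$$
   Context: All spaces are real and $1/\infty=0$. $\ell_p^n$ is $\mathbb{R}^n$ with the $\ell_p$-norm. The space $\ell_{p_1}^n\otimes_\pi\dots\otimes_\pi\ell_{p_k}^n$ is the $k$-fold algebraic tensor product $\mathbb{R}^n\otimes\dots\otimes\mathbb{R}^n\cong\mathbb{R}^{n^k}$ with the projective norm $\|A\|=\inf\{\sum_{l=1}^m\prod_{j=1}^k\|x_l^{(j)}\|_{p_j}: m\in\mathbb{N},\ A=\sum_{l=1}^m x_l^{(1)}\otimes\dots\otimes x_l^{(k)}\}$. For an $N$-dimensional normed space $X$ with unit ball $B_X$, $\mathrm{vr}(X)=\left(\mathrm{vol}_N(B_X)/\mathrm{vol}_N(\mathcal{E}_X)\right)^{1/N}$, where $\mathcal{E}_X$ is the ellipsoid of maximal volume contained in $B_X$. The notation $\lesssim_{\mathbf{p}}$ means inequality up to a positive multiplicative constant depending only on $p_1,\dots,p_k$ (not on $n$). 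*)

(* Defs.v *)
From HB Require Import structures.
From mathcomp Require Import all_boot all_order all_algebra.
From mathcomp Require Import all_classical all_reals all_analysis.

Set Implicit Arguments.
Unset Strict Implicit.
Unset Printing Implicit Defensive.

Import Order.TTheory GRing.Theory Num.Theory.
Import numFieldNormedType.Exports.

Local Open Scope classical_set_scope.
Local Open Scope ring_scope.

(* N-dimensional Lebesgue measure as the N-fold product of [lebesgue_measure]:
   the measure of a Borel set is the integral of the measures of its sections,
   as in the definition of [\x]. *)
Fixpoint tuple_volume (R : realType) (N : nat) : set (N.-tuple R) -> \bar R :=
  if N isn't N'.+1 then fun A => \d_([tuple] : 0.-tuple R) A
  else fun A => (\int[@lebesgue_measure R]_x
                   tuple_volume [set t : N'.-tuple R | A [tuple of x :: t]])%E.

Definition volume (R : realType) (I : finType) (A : set {ffun I -> R}) :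
    \bar R :=
  tuple_volume
    [set t : #|I|.-tuple R | A [ffun i => tnth t (enum_rank i)]].

Definition euclidean_ball (R : realType) (I : finType) : set {ffun I -> R} :=
  [set x | \sum_i x i ^+ 2 <= 1].

Definition is_ellipsoid (R : realType) (I : finType) (E : set {ffun I -> R}) :
    Prop :=
  exists (L : {linear {ffun I -> R} -> {ffun I -> R}}) (c : {ffun I -> R}),
    bijective L /\ E = [set c + L x | x in @euclidean_ball R I].

Definition is_max_volume_ellipsoid (R : realType) (I : finType)
    (B E : set {ffun I -> R}) : Prop :=
  [/\ is_ellipsoid E, E `<=` B &
      forall E' : set {ffun I -> R}, is_ellipsoid E' -> E' `<=` B ->
        (volume E' <= volume E)%E].

(* [xget] selects the ellipsoid; its default [set0] would only be used if no
   ellipsoid of maximal volume existed. *)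
Definition max_volume_ellipsoid (R : realType) (I : finType)
    (B : set {ffun I -> R}) : set {ffun I -> R} :=
  xget set0 [set E | is_max_volume_ellipsoid B E].

Definition unit_ball (R : realType) (I : finType) (nrm : {ffun I -> R} -> R) :
    set {ffun I -> R} :=
  [set x | nrm x <= 1].

Definition vr (R : realType) (I : finType) (nrm : {ffun I -> R} -> R) : R :=
  (fine (volume (unit_ball nrm))
     / fine (volume (max_volume_ellipsoid (unit_ball nrm)))) `^ (#|I|%:R^-1).

(* The value at p = -oo is irrelevant: only exponents p >= 1 are used. *)
Definition lp_norm (R : realType) (p : \bar R) (n : nat)
    (x : {ffun 'I_n -> R}) : R :=
  match p with
  | r%:E => (\sum_i `|x i| `^ r) `^ r^-1
  | +oo%E => \big[Num.max/0]_i `|x i|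
  | -oo%E => 0
  end.

(* Elements of the k-fold tensor product of R^n are represented by their
   coordinate arrays, indexed by the multi-indices in {0, ..., n-1}^k. *)
Definition elementary_tensor (R : realType) (k n : nat)
    (x : 'I_k -> {ffun 'I_n -> R}) : {ffun {ffun 'I_k -> 'I_n} -> R} :=
  [ffun i : {ffun 'I_k -> 'I_n} => \prod_(j < k) x j (i j)].

(* The norm of the projective tensor product of the spaces l_(p j)^n, with
   exponents p 1, ..., p k numbered from 1. *)
Definition projective_norm (R : realType) (k : nat) (p : nat -> \bar R)
    (n : nat) (A : {ffun {ffun 'I_k -> 'I_n} -> R}) : R :=
  inf [set s : R | exists (m : nat) (x : 'I_m -> 'I_k -> {ffun 'I_n -> R}),
         A = \sum_(l < m) elementary_tensor (x l) /\
         s = \sum_(l < m) \prod_(j < k) lp_norm (p j.+1) (x l j)].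

(* 1 / p, with 1 / +oo = 0. *)
Definition recip (R : realType) (p : \bar R) : R := fine (p^-1)%E.

Definition lesssim (R : realType) (f g : nat -> R) : Prop :=
  exists2 C : R, 0 < C & forall n : nat, (1 <= n)%N -> f n <= C * g n.

(* Main.v *)
(** Write [B] for the unit ball, [N = n ^ k] and [r_j = 1 / p_j]; constants may
    depend on [k] and on the [r_j].

    Sign changes and cyclic shifts of the indices in each factor are isometries.
    An ellipsoid in [B] is [c + T B_2] with [T] lower triangular and positive on
    the diagonal, and averaging over these isometries shows that [B] contains the
    Euclidean ball of radius [tr T / N]; by the arithmetic-geometric mean
    inequality the largest Euclidean ball [rho B_2] in [B] is therefore an
    ellipsoid of maximal volume. It remains to estimate [rho] and the volume of
    [B].

    [rho] from below: for [p = (oo, ..., oo)], an array whose slices in one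
    direction have Euclidean norm at most 1 has bounded projective norm
    (Rademacher averages, truncation and iteration). A weighted
    arithmetic-geometric mean inequality over the marginals turns this into the
    Hardy-Littlewood inequality: the projective norm is at most a constant times
    the Euclidean norm when [\sum r_j = 1 / 2]. The other exponents follow by
    comparing the norms of the factors and by cutting arrays into slices, each
    factor that is sliced costing [sqrt n].

    [rho] from above: coordinate functionals and, by Hoelder's inequality, the
    diagonal functional.

    Volume from below: by the mixed-norm estimate [B] contains a large cube.
    Volume from above: for [1 <= q <= 2], Maurey's method in [l_q] approximates
    each point of [B] by an average of [n ^ (k - 1)] elementary tensors of rounded
    vectors, so that [B] is covered by [C ^ N] small cubes. *)

Require Import Defs.
From mathcomp Require Import all_boot all_order all_algebra.
From mathcomp Require Import all_classical all_reals all_analysis.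
From mathcomp Require Import measurable_realfun.
From mathcomp Require Import ring lra.

Set Implicit Arguments.
Unset Strict Implicit.
Unset Printing Implicit Defensive.

Import Order.TTheory GRing.Theory Num.Theory.
Import numFieldNormedType.Exports.

Local Open Scope ring_scope.

(** * Rademacher functions and the norms of the factors *)

(** Only the root of order N of a ratio of volumes enters [vr], so a factor [C ^+ N] in a volume is
    harmless: a covering may use exponentially many cubes. What remains is an account of powers of
    [n]. Each pair ([a], [q]), with [a] the number of sliced factors and [q] the exponent of the
    covering, gives one upper bound, and the cases of the theorem are choices of the pair. If p_k <=
    2, take q = p_k and slice all factors but the last; otherwise take q = 2 and, as a rule, slice
    the factors with p_j <= 2.

    [volume] is an iterated integral over sections, taken in a fixed order of the coordinates and
    defined for every set. It is monotone without any measurability, so unit balls are compared with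
    boxes only. An exact formula is needed just for ellipsoids. The sections of a triangular
    ellipsoid are again triangular, which is why the linear part is first reduced to triangular form
    by an orthogonal matrix. *)

Section Signs.
Variables (R : realFieldType) (B : finType).
Implicit Types (S T : {set B}) (x : {ffun B -> bool}) (b : B).

Definition walsh S x : R := \prod_(b in S) (-1) ^+ x b.

Definition flip b x : {ffun B -> bool} := [ffun c => x c (+) (c == b)].

Lemma flipK b : involutive (flip b).
Proof. by move=> x; apply/ffunP=> c; rewrite !ffunE -addbA addbb addbF. Qed.

Lemma sum_flip b (F : {ffun B -> bool} -> R) :
  \sum_x F (flip b x) = \sum_x F x.
Proof.
rewrite [RHS](reindex_inj (inv_inj (@flipK b))); exact: eq_bigr.
Qed.

Lemma walsh_flip b S x :
  walsh S (flip b x) = (-1) ^+ (b \in S) * walsh S x.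
Proof.
rewrite /walsh; case: (boolP (b \in S)) => bS.
  rewrite (bigD1 b bS) [in RHS](bigD1 b bS) /= ffunE eqxx addbT.
  rewrite mulrA; congr (_ * _).
    by case: (x b); rewrite /= ?mulN1r ?opprK ?expr0 ?expr1 ?mulr1.
  by apply: eq_bigr => c /andP[_ /negPf cb]; rewrite ffunE cb addbF.
rewrite expr0 mul1r; apply: eq_bigr => c cS; rewrite ffunE.
by case: eqP => [cb|_]; rewrite ?addbF //; rewrite -cb cS in bS.
Qed.

Lemma walsh_sqr S x : walsh S x ^+ 2 = 1.
Proof.
by rewrite /walsh -prodrXl big1 // => b _; rewrite -exprM mulnC exprM sqrrN !expr1n.
Qed.

Lemma walsh_D1 b S x : b \in S -> walsh S x = (-1) ^+ x b * walsh (S :\ b) x.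
Proof.
move=> bS; rewrite /walsh (big_setD1 b) //.
Qed.

(** Flipping a bit on which [S] and [T] differ changes the sign of the product, so the sum is its
    own opposite. *)
Lemma walsh_orthogonal S T :
  \sum_x walsh S x * walsh T x = (S == T)%:R * #|{: {ffun B -> bool}}|%:R.
Proof.
case: (altP (S =P T)) => [->|neST].
  rewrite mul1r -sumr_const; apply: eq_bigr => x _.
  by rewrite -expr2 walsh_sqr.
rewrite mul0r.
have [b bST] : exists b, (b \in S) != (b \in T).
  apply/existsP; apply: contra_neqT neST; rewrite negb_exists => /forallP h.
  by apply/setP => b; have := h b; rewrite negbK => /eqP.
set s := \sum_x _; have : s = - s.
  rewrite {1}/s -(sum_flip b) -sumrN; apply: eq_bigr => x _.
  rewrite !walsh_flip mulrACA -signr_addb.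
  have -> : (b \in S) (+) (b \in T) = true by move: bST; case: (_ \in _); case: (_ \in _).
  by rewrite expr1 mulN1r.
lra.
Qed.

End Signs.

(** Lagrange's identity: twice the difference of the two sides is a sum of squares. *)
Lemma sum_CauchySchwarz (R : realFieldType) (I : finType) (a b : I -> R) :
  (\sum_i a i * b i) ^+ 2 <= (\sum_i a i ^+ 2) * (\sum_i b i ^+ 2).
Proof.
have h : 0 <= \sum_i \sum_j (a i * b j - a j * b i) ^+ 2.
  by apply: sumr_ge0 => i _; apply: sumr_ge0 => j _; apply: sqr_ge0.
have e : \sum_i \sum_j (a i * b j - a j * b i) ^+ 2 =
  2 * ((\sum_i a i ^+ 2) * (\sum_i b i ^+ 2)) - 2 * (\sum_i a i * b i) ^+ 2.
  transitivity (\sum_i \sum_j (a i ^+ 2 * b j ^+ 2)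
     + \sum_i \sum_j (b i ^+ 2 * a j ^+ 2)
     - 2 * \sum_i \sum_j ((a i * b i) * (a j * b j))).
    rewrite mulr_sumr -!big_split -sumrB /=; apply: eq_bigr => i _.
    rewrite mulr_sumr -!big_split -sumrB /=; apply: eq_bigr => j _; ring.
  by rewrite -!big_distrlr /=; ring.
lra.
Qed.

Section Bonami.
Variables (R : realFieldType) (B : finType).
Local Notation X := {ffun B -> bool}.
Local Notation chi := (@walsh R B).

(** By injectivity at most one index carries the empty set, so the function is constant. This ends
    the induction of [bonami] both when no bit is left and when the degree is 0. *)
Lemma bonami0 (J : finType) (P : pred J) (a : J -> R) (S : J -> {set B}) :
  {in P &, injective S} -> {in P, forall j, S j = finset.set0} ->
  \sum_(x : X) (\sum_(j | P j) a j * chi (S j) x) ^+ 4 <=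
  #|{: X}|%:R * (\sum_(j | P j) a j ^+ 2) ^+ 2.
Proof.
move=> injS S0; rewrite mulr_natl -sumr_const; apply: ler_sum => x _.
have [j0 Pj0|P0] := pickP P; last by rewrite !big_pred0 //= !expr0n.
have PE : P =1 pred1 j0.
  move=> j; apply/idP/eqP => [Pj|-> //].
  by apply: injS => //; rewrite !S0.
rewrite !(big_pred1 j0) // S0 // /walsh big_set0 mulr1.
by rewrite -exprM.
Qed.

(* Bonami's hypercontractive inequality, by induction on the bits: with
   [f = g + x_b h], [E f^4 = E g^4 + 6 E g^2 h^2 + E h^4]. *)
Lemma bonami (D : seq B) (d : nat) (J : finType) (P : pred J) (a : J -> R)
    (S : J -> {set B}) :
  {in P &, injective S} -> {in P, forall j, {subset S j <= D}} ->
  {in P, forall j, (#|S j| <= d)%N} ->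
  \sum_(x : X) (\sum_(j | P j) a j * chi (S j) x) ^+ 4 <=
  #|{: X}|%:R * 9 ^+ d * (\sum_(j | P j) a j ^+ 2) ^+ 2.
Proof.
elim: D d P S => [|b D IH] d P S injS subS cardS.
  apply: le_trans (bonami0 a injS _) _.
    move=> j Pj; apply/setP => c; rewrite inE; apply/negP => /(subS j Pj).
    by rewrite in_nil.
  rewrite ler_wpM2r ?sqr_ge0// ler_peMr// -[leLHS](expr1n _ d) lerXn2r ?nnegrE//; lra.
case: d cardS => [|d] cardS.
  apply: le_trans (bonami0 a injS _) _; last by rewrite expr0 mulr1.
  by move=> j Pj; apply/eqP; rewrite -cards_eq0 -leqn0 cardS.
pose P1 := [pred j | P j && (b \notin S j)].
pose P2 := [pred j | P j && (b \in S j)].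
pose S2 := fun j => S j :\ b.
pose g x := \sum_(j | P1 j) a j * chi (S j) x.
pose h x := \sum_(j | P2 j) a j * chi (S2 j) x.
pose G := \sum_(j | P1 j) a j ^+ 2; pose H := \sum_(j | P2 j) a j ^+ 2.
have splitP F : \sum_(j | P j) F j = \sum_(j | P1 j) F j + \sum_(j | P2 j) F j :> R.
  rewrite (bigID (fun j => b \notin S j)) /=; congr (_ + _).
  by apply: eq_bigl => j; rewrite /P2 /= negbK.
have fE x : \sum_(j | P j) a j * chi (S j) x = g x + (-1) ^+ x b * h x.
  rewrite splitP; congr (_ + _); rewrite mulr_sumr; apply: eq_bigr => j /andP[_ bj].
  by rewrite (walsh_D1 _ _ bj) mulrCA.
have gflip x : g (flip b x) = g x.
  by apply: eq_bigr => j /andP[_ /negPf bj]; rewrite walsh_flip bj expr0 mul1r.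
have hflip x : h (flip b x) = h x.
  by apply: eq_bigr => j _; rewrite walsh_flip /S2 setD11 expr0 mul1r.
have sumE : \sum_(x : X) (g x + (-1) ^+ x b * h x) ^+ 4 =
   \sum_x g x ^+ 4 + 6 * \sum_x g x ^+ 2 * h x ^+ 2 + \sum_x h x ^+ 4.
  have dbl (F : X -> R) : \sum_x F x = 2^-1 * \sum_x (F x + F (flip b x)).
    rewrite big_split /= (sum_flip b F); lra.
  rewrite dbl mulr_sumr mulr_sumr -!big_split /=; apply: eq_bigr => x _.
  rewrite gflip hflip ffunE eqxx addbT.
  by case: (x b); rewrite /= ?expr0 ?expr1; field.
under eq_bigr do rewrite fE.
rewrite sumE splitP -/G -/H.
have hg : \sum_x g x ^+ 4 <= #|{: X}|%:R * 9 ^+ d.+1 * G ^+ 2.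
  apply: IH.
  - by move=> i j /andP[Pi _] /andP[Pj _]; apply: injS.
  - move=> j /andP[Pj bj] c cj; have := subS j Pj c cj.
    by rewrite inE => /orP[/eqP cb|//]; rewrite cb (negPf bj) in cj.
  - by move=> j /andP[Pj _]; apply: cardS.
have hh : \sum_x h x ^+ 4 <= #|{: X}|%:R * 9 ^+ d * H ^+ 2.
  apply: IH.
  - move=> i j /andP[Pi bi] /andP[Pj bj] eij; apply: injS; [exact: Pi|exact: Pj|].
    by rewrite -(finset.setD1K bi) -(finset.setD1K bj) -/(S2 i) eij.
  - move=> j /andP[Pj bj] c; rewrite in_setD1 => /andP[cb cj].
    by have := subS j Pj c cj; rewrite inE (negPf cb).
  - by move=> j /andP[Pj bj]; have := cardS j Pj; rewrite (cardsD1 b) bj.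
set c := #|{: X}|%:R; rewrite -/c in hg hh.
have c0 : 0 <= c by rewrite ler0n.
have G0 : 0 <= G by apply: sumr_ge0 => j _; apply: sqr_ge0.
have H0 : 0 <= H by apply: sumr_ge0 => j _; apply: sqr_ge0.
have e0 : 0 <= 9 ^+ d :> R by apply: exprn_ge0.
(* Cauchy-Schwarz on the bounds for the degrees [d.+1] and [d] produces the factor 3, the root of 9.
   With the coefficient 6 it makes 18, exactly the cross term of [9 * (G + H) ^+ 2]. *)
have cross : \sum_x g x ^+ 2 * h x ^+ 2 <= c * 9 ^+ d * 3 * (G * H).
  rewrite -(@ler_pXn2r _ 2)// ?nnegrE; first last.
  - by rewrite !mulr_ge0.
  - by apply: sumr_ge0 => x _; rewrite mulr_ge0// sqr_ge0.
  apply: le_trans (sum_CauchySchwarz _ _) _.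
  under eq_bigr do rewrite -exprM.
  under [X in _ * X]eq_bigr do rewrite -exprM.
  apply: le_trans (ler_pM _ _ hg hh) _.
  - by apply: sumr_ge0 => x _; rewrite exprn_even_ge0.
  - by apply: sumr_ge0 => x _; rewrite exprn_even_ge0.
  by rewrite exprS le_eqVlt; apply/orP; left; apply/eqP; ring.
apply: le_trans (lerD (lerD hg (ler_wpM2l _ cross)) hh) _ => //.
rewrite exprS.
set u := c * 9 ^+ d; have u0 : 0 <= u by rewrite mulr_ge0.
have -> : c * (9 * 9 ^+ d) = 9 * u by rewrite /u; ring.
have : 0 <= u * H ^+ 2 by rewrite mulr_ge0// sqr_ge0.
nra.
Qed.

End Bonami.

(** Concavity of the logarithm, through its tangent at the weighted mean. Zero values of nonzero
    weight are treated apart because [ln] returns 0 there. *)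
Lemma weighted_AMGM (R : realType) (I : finType) (w a : I -> R) :
  (forall i, 0 <= w i) -> \sum_i w i = 1 -> (forall i, 0 <= a i) ->
  \prod_i a i `^ w i <= \sum_i w i * a i.
Proof.
move=> w0 w1 a0.
have s0 : 0 <= \sum_i w i * a i by apply: sumr_ge0 => i _; rewrite mulr_ge0.
have [/existsP[i /andP[wi ai]]|] := boolP [exists i, (w i != 0) && (a i == 0)].
  by rewrite (bigD1 i) //= (eqP ai) powR0// mul0r.
rewrite negb_exists => /forallP h.
have {}h i : w i != 0 -> 0 < a i.
  by move=> wi; have := h i; rewrite wi /= lt0r a0 andbT.
have [i wi] : exists i, w i != 0.
  apply/existsP; apply: contraT; rewrite negb_exists => /forallP h0.
  suff : \sum_i w i = 0 by rewrite w1 => /eqP; rewrite oner_eq0.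
  by rewrite big1// => j _; have := h0 j; rewrite negbK => /eqP.
set m := \sum_i _ in s0 *.
have m0 : 0 < m.
  rewrite /m (bigD1 i) //= ltr_pwDl//; first by rewrite mulr_gt0 ?h// lt0r wi w0.
  by apply: sumr_ge0 => j _; rewrite mulr_ge0.
have -> : \prod_i a i `^ w i = expR (\sum_i w i * ln (a i)).
  rewrite expR_sum; apply: eq_bigr => j _; rewrite /powR.
  by case: eqP => // aj; case: (eqVneq (w j) 0) => [->|/h]; rewrite ?mul0r ?expR0// aj ltxx.
rewrite -[leRHS]lnK ?posrE// ler_expR.
(* The weights sum to 1 and the weighted mean of [a] is [m], so the corrections cancel. Termwise
   there remains ln x <= x - 1 at x = a_j / m. *)
have -> : ln m = \sum_i w i * (ln m + (m^-1 * a i - 1)).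
  transitivity (\sum_i (w i * ln m + (m^-1 * (w i * a i) - w i))).
    rewrite big_split /= sumrB -mulr_suml w1 -mulr_sumr -/m mulVf ?gt_eqF//; ring.
  by apply: eq_bigr => j _; ring.
apply: ler_sum => j _; have [->|wj] := eqVneq (w j) 0; first by rewrite !mul0r.
rewrite ler_wpM2l// -lerBlDl -ln_div ?posrE ?h//.
rewrite [X in _ <= X - 1]mulrC.
have -> : ln (a j / m) = ln (1 + (a j / m - 1)) by congr ln; ring.
apply: le_ln1Dx.
have : 0 < a j / m by rewrite divr_gt0 ?h.
lra.
Qed.

Lemma weighted_AMGM2 (R : realType) (t a b : R) :
  0 <= t <= 1 -> 0 <= a -> 0 <= b ->
  a `^ t * b `^ (1 - t) <= t * a + (1 - t) * b.
Proof.
move=> /andP[t0 t1] a0 b0.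
have := @weighted_AMGM R bool (fun c => if c then t else 1 - t) (fun c => if c then a else b).
rewrite !big_bool /=; apply.
- by case; rewrite ?subr_ge0.
- ring.
- by case.
Qed.

(** * The norms of l_p^n in terms of 1/p *)

Section LpNorm.
Variables (R : realType) (n : nat).
Implicit Types (x y : {ffun 'I_n -> R}) (r s t : R).

(* The norm of l_p^n in terms of [r = 1/p], with [r = 0] for [p = +oo]. *)
Definition lpn r x : R :=
  if r == 0 then \big[Num.max/0]_i `|x i| else (\sum_i `|x i| `^ r^-1) `^ r.

Lemma lp_normE (p : \bar R) x : (1%:E <= p)%E -> lp_norm p x = lpn (recip p) x.
Proof.
rewrite /lpn /recip; case: p => [p||] //=; last by rewrite /inve /= eqxx.
rewrite lee_fin => p1; have p0 : p != 0 by rewrite gt_eqF// (lt_le_trans ltr01).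
by rewrite /inve (negPf p0) /= invr_eq0 (negPf p0) invrK.
Qed.

Lemma lpn_ge0 r x : 0 <= lpn r x.
Proof.
rewrite /lpn; case: ifP => _; last exact: powR_ge0.
exact: bigmax_ge_id.
Qed.

Lemma lpn0_leP x t : 0 <= t -> reflect (forall i, `|x i| <= t) (lpn 0 x <= t).
Proof.
move=> t0; rewrite /lpn eqxx; apply: (iffP idP) => [h i|h].
  exact: le_trans (le_bigmax _ _ i) h.
by apply: bigmax_le.
Qed.

Lemma lpn_leE r x t : 0 < r -> 0 <= t ->
  (lpn r x <= t) = (\sum_i `|x i| `^ r^-1 <= t `^ r^-1).
Proof.
move=> r0 t0; rewrite /lpn gt_eqF//.
have s0 : 0 <= \sum_i `|x i| `^ r^-1 by apply: sumr_ge0 => i _; apply: powR_ge0.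
have tE : t = (t `^ r^-1) `^ r by rewrite -powRrM mulVf ?gt_eqF// powRr1.
apply/idP/idP => h; last by rewrite [leRHS]tE ge0_ler_powR ?nnegrE ?powR_ge0 ?(ltW r0).
rewrite -[leLHS]powRr1// -[X in _ `^ X](mulfV (lt0r_neq0 r0)) powRrM.
by rewrite ge0_ler_powR ?nnegrE ?powR_ge0// invr_ge0 ltW.
Qed.

Lemma lpn_sum r x : 0 < r -> \sum_i `|x i| `^ r^-1 = lpn r x `^ r^-1.
Proof.
move=> r0; rewrite /lpn gt_eqF// -powRrM mulfV ?gt_eqF// powRr1//.
by apply: sumr_ge0 => i _; apply: powR_ge0.
Qed.

Lemma le_lpn r x i : 0 <= r -> `|x i| <= lpn r x.
Proof.
rewrite le_eqVlt => /orP[/eqP<-|r0]; first by rewrite /lpn eqxx; apply: le_bigmax.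
have rV0 : 0 < r^-1 by rewrite invr_gt0.
rewrite -[leLHS]powRr1// -[leRHS]powRr1 ?lpn_ge0//.
rewrite -(mulVf (lt0r_neq0 r0)) !powRrM ge0_ler_powR ?nnegrE ?powR_ge0 ?(ltW r0)//.
rewrite -lpn_sum// (bigD1 i)//= lerDl; apply: sumr_ge0 => j _; exact: powR_ge0.
Qed.

Lemma lpn_homo r x y : 0 <= r -> (forall i, `|x i| <= `|y i|) -> lpn r x <= lpn r y.
Proof.
rewrite le_eqVlt => /orP[/eqP<-|r0] h.
  apply/lpn0_leP; rewrite ?lpn_ge0// => i; exact: le_trans (h i) (le_lpn _ _ _).
rewrite lpn_leE ?lpn_ge0// -lpn_sum//; apply: ler_sum => i _.
by rewrite ge0_ler_powR ?nnegrE// invr_ge0 ltW.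
Qed.

Lemma lpnZ r c x : 0 <= r -> lpn r [ffun i => c * x i] = `|c| * lpn r x.
Proof.
rewrite le_eqVlt => /orP[/eqP<-|r0].
  apply/eqP; rewrite eq_le; apply/andP; split.
    apply/lpn0_leP; rewrite ?mulr_ge0 ?lpn_ge0// => i.
    by rewrite ffunE normrM ler_wpM2l// le_lpn.
  have [->|c0] := eqVneq c 0; first by rewrite normr0 mul0r lpn_ge0.
  rewrite -ler_pdivlMl ?normr_gt0//; apply/lpn0_leP.
    by rewrite mulr_ge0 ?invr_ge0// lpn_ge0.
  move=> i; rewrite ler_pdivlMl ?normr_gt0// -normrM.
  by have := @le_lpn 0 [ffun i => c * x i] i (lexx _); rewrite ffunE.
rewrite /lpn gt_eqF//; under eq_bigr do rewrite ffunE normrM powRM//.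
rewrite -mulr_sumr powRM ?powR_ge0//; last by apply: sumr_ge0 => i _; apply: powR_ge0.
by rewrite -powRrM mulVf ?gt_eqF// powRr1.
Qed.

Lemma lpn_eq0 r x : 0 <= r -> lpn r x = 0 -> forall i, x i = 0.
Proof.
move=> r0 h i; apply/eqP; rewrite -normr_eq0 eq_le normr_ge0 andbT -h.
exact: le_lpn.
Qed.

(** The surplus power [s^-1 - r^-1] of each coordinate is bounded by the same power of the whole
    norm. *)
Lemma lpn_le r s x : 0 <= s <= r -> lpn s x <= lpn r x.
Proof.
move=> /andP[s0 sr]; have r0 := le_trans s0 sr.
move: s0; rewrite le_eqVlt => /orP[/eqP<-|s0].
  by apply/lpn0_leP; rewrite ?lpn_ge0// => i; apply: le_lpn.
have rp : 0 < r by apply: lt_le_trans sr.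
rewrite lpn_leE ?lpn_ge0//.
have -> : s^-1 = r^-1 + (s^-1 - r^-1) by ring.
have d0 : 0 <= s^-1 - r^-1 by rewrite subr_ge0 lef_pV2.
have [M0|M0] := eqVneq (lpn r x) 0.
  rewrite big1 ?powR_ge0// => i _; rewrite (lpn_eq0 _ M0) ?ltW// normr0 powR0//.
  by rewrite addrC subrK invr_eq0 gt_eqF.
rewrite powRD; last by rewrite M0 implybT.
rewrite -{1}lpn_sum// mulr_suml; apply: ler_sum => i _.
have [x0|x0] := eqVneq `|x i| 0.
  by rewrite x0 powR0 ?mulr_ge0 ?powR_ge0// addrC subrK invr_eq0 gt_eqF.
rewrite powRD ?x0 ?implybT// ler_wpM2l ?powR_ge0// ge0_ler_powR ?nnegrE ?lpn_ge0//.
exact: le_lpn.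
Qed.

Lemma lpn_ge r s x : (0 < n)%N -> 0 <= s <= r -> lpn r x <= n%:R `^ (r - s) * lpn s x.
Proof.
move=> n0 /andP[s0 sr]; have r0 := le_trans s0 sr.
have nn0 : 0 < n%:R :> R by rewrite ltr0n.
have [<-|sr'] := eqVneq s r; first by rewrite subrr powRr0 mul1r.
have rp : 0 < r by apply: le_lt_trans s0 _; rewrite lt_neqAle sr' sr.
rewrite lpn_leE// ?mulr_ge0 ?powR_ge0 ?lpn_ge0// powRM ?powR_ge0 ?lpn_ge0//.
rewrite -powRrM mulrBl mulfV ?gt_eqF//.
move: s0; rewrite le_eqVlt => /orP[/eqP s0|s0].
  rewrite -s0 mul0r subr0 powRr1 ?(ltW nn0)//.
  have -> : n%:R * lpn 0 x `^ r^-1 = \sum_(i < n) lpn 0 x `^ r^-1.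
    by rewrite sumr_const card_ord mulr_natl.
  by apply: ler_sum => i _; rewrite ge0_ler_powR ?nnegrE ?lpn_ge0 ?invr_ge0// le_lpn.
(* Hölder's inequality: with weights [t] and [1 - t] the arithmetic-geometric mean inequality
   compares the normalised powers [s^-1] of the coordinates, which sum to 1, with the uniform
   density [n%:R^-1]. *)
set t := s / r.
have t01 : 0 <= t <= 1 by rewrite divr_ge0 ?(ltW s0)//= ler_pdivrMr// mul1r.
have [M0|M0] := eqVneq (lpn s x) 0.
  rewrite big1 ?mulr_ge0 ?powR_ge0// => i _.
  by rewrite (lpn_eq0 _ M0) ?ltW// normr0 powR0// invr_eq0 gt_eqF.
have Mp : 0 < lpn s x by rewrite lt0r M0 lpn_ge0.
have sV : s * s^-1 = 1 by rewrite mulfV ?gt_eqF.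
have key i : `|x i| `^ r^-1 <= lpn s x `^ r^-1 * (n%:R `^ (1 - t) *
   (t * (`|x i| `^ s^-1 / lpn s x `^ s^-1) + (1 - t) * n%:R^-1)).
  have h := @weighted_AMGM2 R t (`|x i| `^ s^-1 / lpn s x `^ s^-1) n%:R^-1 t01.
  have e0 : 0 <= `|x i| `^ s^-1 / lpn s x `^ s^-1 by rewrite divr_ge0 ?powR_ge0.
  have {h} := h e0 (ltW _); rewrite invr_gt0 => /(_ nn0) h.
  apply: le_trans (ler_wpM2l (powR_ge0 _ _) (ler_wpM2l (powR_ge0 _ _) h)).
  have st : s^-1 * t = r^-1 by rewrite /t; field; rewrite !gt_eqF.
  have -> : (`|x i| `^ s^-1 / lpn s x `^ s^-1) `^ t = `|x i| `^ r^-1 / lpn s x `^ r^-1.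
    rewrite powRM ?powR_ge0 ?invr_ge0 ?powR_ge0// -!powRN -!powRrM mulNr st.
    by [].
  have nn : n%:R `^ (1 - t) * n%:R^-1 `^ (1 - t) = 1 :> R.
    by rewrite -powRM ?invr_ge0 ?(ltW nn0)// mulfV ?gt_eqF// powR1.
  have Mr : lpn s x `^ r^-1 != 0 by rewrite gt_eqF ?powR_gt0.
  rewrite le_eqVlt; apply/orP; left; apply/eqP.
  rewrite [n%:R `^ _ * _]mulrCA nn mulr1 mulrCA mulfV// mulr1.
  by [].
apply: le_trans; first by apply: ler_sum => i _; exact: key.
rewrite -mulr_sumr mulrC ler_wpM2r ?powR_ge0//.
rewrite -mulr_sumr big_split /= -mulr_sumr -mulr_suml lpn_sum// mulfV; last first.
  by rewrite powR_eq0 negb_and M0.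
rewrite sumr_const card_ord mulr1.
rewrite -[X in t + X]mulr_natr -mulrA mulVf ?gt_eqF// mulr1.
by rewrite [t + _]addrC subrK mulr1.
Qed.

Lemma lpn_compare r s x : (0 < n)%N -> 0 <= r -> 0 <= s ->
  lpn r x <= n%:R `^ Num.max (r - s) 0 * lpn s x.
Proof.
move=> n0 r0 s0; have [sr|/ltW rs] := leP s r.
  by rewrite max_l ?subr_ge0// lpn_ge ?s0.
by rewrite max_r ?subr_le0// powRr0 mul1r lpn_le ?r0.
Qed.

Lemma lpn_delta r x i : 0 <= r -> (forall j, j != i -> x j = 0) -> lpn r x = `|x i|.
Proof.
rewrite le_eqVlt => /orP[/eqP<-|r0] h.
  apply/eqP; rewrite eq_le le_lpn// andbT; apply/lpn0_leP => // j.
  by have [->//|/h->] := eqVneq j i; rewrite normr0.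
rewrite /lpn gt_eqF// (bigD1 i)//= big1 ?addr0.
  by rewrite -powRrM mulVf ?gt_eqF// powRr1.
by move=> j /h ->; rewrite normr0 powR0// invr_eq0 gt_eqF.
Qed.

(** The power 1/r of the weight [m i ^ r] is [m i] itself, so a subprobability defines a diagonal
    contraction from l_oo to l_p. [hardy_littlewood] uses it to load the marginals of an array onto
    the factors. *)
Lemma lpn_weight r (m : 'I_n -> R) x : 0 <= r -> (forall i, 0 <= m i) ->
  \sum_i m i <= 1 -> lpn r [ffun i => m i `^ r * x i] <= lpn 0 x.
Proof.
rewrite le_eqVlt => /orP[/eqP<-|r0] m0 m1.
  by apply: lpn_homo => // i; rewrite ffunE powRr0 mul1r.
rewrite lpn_leE ?lpn_ge0//.
apply: (@le_trans _ _ (\sum_i m i * lpn 0 x `^ r^-1)); last first.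
  by rewrite -mulr_suml ler_piMl ?powR_ge0.
apply: ler_sum => i _; rewrite ffunE normrM powRM// ger0_norm ?powR_ge0//.
rewrite -powRrM mulfV ?gt_eqF// powRr1// ler_wpM2l// ge0_ler_powR ?nnegrE ?lpn_ge0//.
  by rewrite invr_ge0 ltW.
exact: le_lpn.
Qed.

End LpNorm.

Section Recip.
Variable R : realType.
Implicit Types p q : \bar R.

Lemma recip_le p q : (1%:E <= p)%E -> (p <= q)%E -> 0 <= recip q <= recip p.
Proof.
case: p => [p||] //; case: q => [q||] //; rewrite /recip /inve ?lee_fin /= ?lexx//.
  move=> p1 pq; have p0 : 0 < p by apply: lt_le_trans p1.
  have q0 : 0 < q by apply: lt_le_trans pq.
  by rewrite !gt_eqF//= invr_ge0 ltW//= lef_pV2.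
move=> p1 _; have p0 : 0 < p by apply: lt_le_trans p1.
by rewrite gt_eqF//= invr_ge0 ltW.
Qed.

Lemma recip_le1 p : (1%:E <= p)%E -> 0 <= recip p <= 1.
Proof.
move=> p1; have /andP[h1 h2] := recip_le (lexx 1%:E) p1.
by rewrite h1 (le_trans h2)// /recip /inve oner_eq0 /= invr1.
Qed.

Lemma recip2 : recip (2%:E : \bar R) = 2^-1.
Proof. by rewrite /recip /inve pnatr_eq0. Qed.

End Recip.

(** * The projective norm *)

Lemma big_ord_split (V : nmodType) (m m' : nat) (T : Type) (F : T -> V)
    (f : 'I_m -> T) (g : 'I_m' -> T) :
  \sum_(i < m + m') F (match fintype.split i with inl j => f j | inr j => g j end) =
  \sum_i F (f i) + \sum_i F (g i).
Proof.
rewrite big_split_ord; congr (_ + _); apply: eq_bigr => i _.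
  by rewrite (unsplitK (inl i)).
by rewrite (unsplitK (inr i)).
Qed.

Section ProjectiveNorm.
Variables (R : realType) (k n : nat).
Local Notation vec := {ffun 'I_n -> R}.
Local Notation arr := {ffun {ffun 'I_k -> 'I_n} -> R}.
Implicit Types (nu : 'I_k -> vec -> R) (A : arr).

Definition decomp nu A (s : R) : Prop :=
  exists (m : nat) (x : 'I_m -> 'I_k -> vec),
    A = \sum_(l < m) elementary_tensor (x l) /\
    s = \sum_(l < m) \prod_(j < k) nu j (x l j).

(** Arbitrary functions [nu j] stand in for the norms of the factors, so that one comparison
    argument serves all pairs of exponents. *)
Definition pn nu A : R := inf [set s | decomp nu A s]%classic.

Lemma decomp0 nu : decomp nu 0 0.
Proof. by exists 0%N, (fun _ _ => 0); rewrite !big_ord0. Qed.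

Lemma decomp_add nu A A' s s' :
  decomp nu A s -> decomp nu A' s' -> decomp nu (A + A') (s + s').
Proof.
move=> [m [x [-> ->]]] [m' [x' [-> ->]]].
exists (m + m')%N, (fun i => match fintype.split i with inl j => x j | inr j => x' j end).
split; first by rewrite (big_ord_split (fun y => elementary_tensor y)).
by rewrite (big_ord_split (fun y => \prod_(j < k) nu j (y j))).
Qed.

Lemma decomp_sum nu (I : Type) (r : seq I) (P : pred I) (F : I -> arr) (s : I -> R) :
  (forall i, P i -> decomp nu (F i) (s i)) ->
  decomp nu (\sum_(i <- r | P i) F i) (\sum_(i <- r | P i) s i).
Proof.
move=> h; elim/big_rec2: _ => [|i A t Pi]; first exact: decomp0.
by apply: decomp_add; apply: h.
Qed.

Lemma decomp_elem nu x : decomp nu (elementary_tensor x) (\prod_(j < k) nu j (x j)).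
Proof. by exists 1%N, (fun=> x); rewrite !big_ord1. Qed.

Definition evec (i : 'I_n) : vec := [ffun j => (j == i)%:R].

Lemma elementary_evec (j0 : 'I_k) (I : {ffun 'I_k -> 'I_n}) (c : R) :
  elementary_tensor (fun j => [ffun i => (if j == j0 then c else 1) * evec (I j) i]) =
  [ffun J => (J == I)%:R * c].
Proof.
apply/ffunP => J; rewrite !ffunE.
under eq_bigr do rewrite !ffunE.
rewrite big_split /= (bigD1 j0)//= eqxx big1 ?mulr1; last by move=> j /negPf->.
rewrite mulrC; congr (_ * _); have [->|neJ] := eqVneq J I.
  by rewrite big1// => j _; rewrite eqxx.
have [j Jj] : exists j, J j != I j.
  apply/existsP; apply: contraNT neJ; rewrite negb_exists => /forallP h.
  by apply/eqP/ffunP => j; have := h j; rewrite negbK => /eqP.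
by rewrite (bigD1 j)//= (negPf Jj) mul0r.
Qed.

Lemma array_basis (j0 : 'I_k) A :
  A = \sum_I elementary_tensor
        (fun j => [ffun i => (if j == j0 then A I else 1) * evec (I j) i]).
Proof.
apply/ffunP => J; rewrite sum_ffunE (bigD1 J)//= elementary_evec ffunE eqxx mul1r.
rewrite big1 ?addr0// => I IJ; rewrite elementary_evec ffunE eq_sym (negPf IJ).
by rewrite mul0r.
Qed.

Lemma elementaryZ (j0 : 'I_k) (c : R) (x : 'I_k -> vec) :
  elementary_tensor (fun j => [ffun i => (if j == j0 then c else 1) * x j i]) =
  [ffun I => c * elementary_tensor x I].
Proof.
apply/ffunP => J; rewrite !ffunE; under eq_bigr do rewrite ffunE.
by rewrite big_split /= (bigD1 j0)//= eqxx big1 ?mulr1// => j /negPf->.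
Qed.

Section Pos.
Variable nu : 'I_k -> vec -> R.
Hypothesis nu0 : forall j x, 0 <= nu j x.

Lemma decomp_ge0 A s : decomp nu A s -> 0 <= s.
Proof.
by move=> [m [x [_ ->]]]; apply: sumr_ge0 => l _; apply: prodr_ge0.
Qed.

Lemma decomp_nonempty (k0 : (0 < k)%N) A : exists s, decomp nu A s.
Proof.
rewrite (array_basis (Ordinal k0) A); eexists; apply: decomp_sum => I _.
exact: decomp_elem.
Qed.

Lemma pn_le A s : decomp nu A s -> pn nu A <= s.
Proof.
move=> h; apply: ge_inf => //; exists 0 => t; exact: decomp_ge0.
Qed.

Lemma pn_le_prod x : pn nu (elementary_tensor x) <= \prod_(j < k) nu j (x j).
Proof. exact/pn_le/decomp_elem. Qed.

Hypothesis k0 : (0 < k)%N.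

Lemma pn_lt A t : pn nu A < t -> exists2 s, decomp nu A s & s < t.
Proof.
move=> h.
have hi : has_inf [set s | decomp nu A s]%classic.
  split; first by have [s hs] := decomp_nonempty k0 A; exists s.
  by exists 0 => s; apply: decomp_ge0.
have d0 : 0 < t - pn nu A by rewrite subr_gt0.
have [s hs st] := inf_adherent d0 hi; exists s => //.
by move: st; rewrite -/(pn nu A) addrC subrK.
Qed.

Lemma pn_ge0 A : 0 <= pn nu A.
Proof.
apply: lb_le_inf; last by move=> s; apply: decomp_ge0.
by have [s hs] := decomp_nonempty k0 A; exists s.
Qed.

Lemma pn0 : pn nu 0 = 0.
Proof. by apply/eqP; rewrite eq_le pn_ge0 pn_le//; apply: decomp0. Qed.

Lemma pn_add A A' : pn nu (A + A') <= pn nu A + pn nu A'.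
Proof.
apply/ler_addgt0Pr => e e0.
have e2 : 0 < e / 2 by rewrite divr_gt0.
have [s hs st] : exists2 s, decomp nu A s & s < pn nu A + e / 2.
  by apply: pn_lt; rewrite ltrDl.
have [s' hs' st'] : exists2 s, decomp nu A' s & s < pn nu A' + e / 2.
  by apply: pn_lt; rewrite ltrDl.
apply: le_trans (pn_le (decomp_add hs hs')) _; lra.
Qed.

Lemma pn_sum (I : Type) (r : seq I) (P : pred I) (F : I -> arr) :
  pn nu (\sum_(i <- r | P i) F i) <= \sum_(i <- r | P i) pn nu (F i).
Proof.
elim/big_rec2: _ => [|i A t Pi h]; first by rewrite pn0.
by apply: le_trans (pn_add _ _) _; rewrite lerD2l.
Qed.

End Pos.

(** An additive map that preserves elementary tensors carries decompositions to decompositions, so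
    it need only be controlled on elementary tensors. *)
Lemma pn_map nu nu' (Phi : arr -> arr) (c : R) : (0 < k)%N ->
  (forall j x, 0 <= nu j x) -> (forall j x, 0 <= nu' j x) ->
  Phi 0 = 0 -> {morph Phi : A B / A + B} -> 0 <= c ->
  (forall x, exists2 y, Phi (elementary_tensor x) = elementary_tensor y &
     \prod_(j < k) nu' j (y j) <= c * \prod_(j < k) nu j (x j)) ->
  forall A, pn nu' (Phi A) <= c * pn nu A.
Proof.
move=> k0 nu0 nu'0 P0 PD c0 h A; apply/ler_addgt0Pr => e e0.
(* Dividing by [c + 1] instead of [c] covers [c = 0]. *)
have d0 : 0 < e / (c + 1) by rewrite divr_gt0// ltr_wpDl.
have [s [m [x [-> ->]]] st] : exists2 s, decomp nu A s & s < pn nu A + e / (c + 1).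
  by apply: pn_lt => //; rewrite ltrDl.
rewrite (big_morph Phi PD P0).
apply: le_trans (pn_sum _ _ _ _ _) _ => //.
apply: (@le_trans _ _ (\sum_(l < m) c * \prod_(j < k) nu j (x l j))).
  apply: ler_sum => l _; have [y -> hy] := h (x l).
  exact: le_trans (pn_le_prod _ _) hy.
rewrite -mulr_sumr; apply: le_trans (ler_wpM2l c0 (ltW st)) _.
rewrite mulrDr lerD2l mulrCA ger_pMr// ler_pdivrMr ?ltr_wpDl// mul1r.
by rewrite lerDl.
Qed.

Lemma pn_compare nu nu' (c : 'I_k -> R) : (0 < k)%N ->
  (forall j x, 0 <= nu j x) -> (forall j x, 0 <= nu' j x) -> (forall j, 0 <= c j) ->
  (forall j x, nu' j x <= c j * nu j x) ->
  forall A, pn nu' A <= (\prod_j c j) * pn nu A.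
Proof.
move=> k0 nu0 nu'0 c0 h; apply: (@pn_map nu nu' id) => //.
  exact: prodr_ge0.
move=> x; exists x => //; rewrite -big_split /=.
by apply: ler_prod => j _; rewrite nu'0 h.
Qed.

Definition wmul (w : 'I_k -> 'I_n -> R) A : arr :=
  [ffun I : {ffun 'I_k -> 'I_n} => (\prod_j w j (I j)) * A I].

Lemma pn_wmul nu nu' (w : 'I_k -> 'I_n -> R) (c : 'I_k -> R) : (0 < k)%N ->
  (forall j x, 0 <= nu j x) -> (forall j x, 0 <= nu' j x) -> (forall j, 0 <= c j) ->
  (forall j (x : vec), nu' j [ffun i => w j i * x i] <= c j * nu j x) ->
  forall A, pn nu' (wmul w A) <= (\prod_j c j) * pn nu A.
Proof.
move=> k0 nu0 nu'0 c0 h; apply: pn_map => //.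
- by apply/ffunP => I; rewrite !ffunE mulr0.
- by move=> A B; apply/ffunP => I; rewrite !ffunE mulrDr.
- exact: prodr_ge0.
move=> x; exists (fun j => [ffun i => w j i * x j i]).
  apply/ffunP => I; rewrite !ffunE -big_split /=.
  by apply: eq_bigr => j _; rewrite ffunE.
rewrite -big_split /=; apply: ler_prod => j _; by rewrite nu'0 h.
Qed.

Lemma pnZ nu c A : (0 < k)%N ->
  (forall j x, 0 <= nu j x) -> (forall j c (x : vec), nu j [ffun i => c * x i] = `|c| * nu j x) ->
  pn nu [ffun I => c * A I] <= `|c| * pn nu A.
Proof.
move=> k0 nu0 nuZ; pose j0 := Ordinal k0.
have := @pn_map nu nu (fun A => [ffun I => c * A I]) `|c| k0 nu0 nu0; apply => //.
- by apply/ffunP => I; rewrite !ffunE mulr0.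
- by move=> B B'; apply/ffunP => I; rewrite !ffunE mulrDr.
move=> x; exists (fun j => [ffun i => (if j == j0 then c else 1) * x j i]).
  by rewrite elementaryZ.
under eq_bigr do rewrite nuZ.
rewrite big_split /= (bigD1 j0) // eqxx big1; last first.
  by move=> j /negPf->; rewrite normr1.
by rewrite /= mulr1.
Qed.

(** The easy half of the duality between the projective norm and multilinear forms: expand along a
    nearly optimal decomposition. *)
Lemma pn_functional nu (psi : {ffun 'I_k -> 'I_n} -> R) (c : R) : (0 < k)%N ->
  (forall j x, 0 <= nu j x) -> 0 <= c ->
  (forall x, `|\sum_I psi I * elementary_tensor x I| <= c * \prod_(j < k) nu j (x j)) ->
  forall A, `|\sum_I psi I * A I| <= c * pn nu A.
Proof.
move=> k0 nu0 c0 h A; apply/ler_addgt0Pr => e e0.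
have d0 : 0 < e / (c + 1) by rewrite divr_gt0// ltr_wpDl.
have [s [m [x [-> ->]]] st] : exists2 s, decomp nu A s & s < pn nu A + e / (c + 1).
  by apply: pn_lt => //; rewrite ltrDl.
under eq_bigr do rewrite sum_ffunE mulr_sumr.
rewrite exchange_big /=; apply: le_trans (ler_norm_sum _ _ _) _.
apply: (@le_trans _ _ (\sum_(l < m) c * \prod_(j < k) nu j (x l j))).
  by apply: ler_sum => l _; apply: h.
rewrite -mulr_sumr; apply: le_trans (ler_wpM2l c0 (ltW st)) _.
rewrite mulrDr lerD2l mulrCA ger_pMr// ler_pdivrMr ?ltr_wpDl// mul1r.
by rewrite lerDl.
Qed.

Lemma le_pn nu A I : (0 < k)%N -> (forall j (x : vec) i, `|x i| <= nu j x) ->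
  `|A I| <= pn nu A.
Proof.
move=> k0 nu1; have nu0 j x : 0 <= nu j x by apply: le_trans (normr_ge0 (x (I j))) (nu1 j x (I j)).
have := @pn_functional nu (fun J => (J == I)%:R) 1 k0 nu0 ler01 _ A.
rewrite mul1r (bigD1 I)//= eqxx mul1r big1 ?addr0; last first.
  by move=> J /negPf->; rewrite mul0r.
apply=> x; rewrite mul1r (bigD1 I)//= eqxx mul1r big1 ?addr0; last first.
  by move=> J /negPf->; rewrite mul0r.
rewrite ffunE normr_prod; apply: ler_prod => j _; by rewrite normr_ge0 nu1.
Qed.

End ProjectiveNorm.

Lemma projective_normE (R : realType) (k : nat) (p : nat -> \bar R) (n : nat) A :
  (forall j : 'I_k, (1%:E <= p j.+1)%E) ->
  @projective_norm R k p n A = pn (fun j : 'I_k => lpn (recip (p j.+1))) A.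
Proof.
move=> p1; congr inf; apply/seteqP; split=> s [m [x [-> ->]]]; exists m, x; split=> //.
  by apply: eq_bigr => l _; apply: eq_bigr => j _; rewrite lp_normE.
by apply: eq_bigr => l _; apply: eq_bigr => j _; rewrite lp_normE.
Qed.

Section Bessel.
Variables (R : realFieldType) (B : finType).
Local Notation X := {ffun B -> bool}.
Local Notation walsh := (@walsh R B).
Variables (J : finType) (P : pred J) (S : J -> {set B}).
Hypothesis injS : {in P &, injective S}.
Local Notation c := (#|{: X}|%:R : R).

Lemma walsh_coef (a : J -> R) j : P j ->
  \sum_x walsh (S j) x * (\sum_(i | P i) a i * walsh (S i) x) = c * a j.
Proof.
move=> Pj; under eq_bigr do rewrite mulr_sumr.
rewrite exchange_big /= (bigD1 j)//= [X in _ + X]big1 ?addr0; last first.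
  move=> i /andP[Pi ij]; under eq_bigr do rewrite mulrCA.
  rewrite -mulr_sumr walsh_orthogonal; case: eqP => [e|]; last by rewrite mul0r mulr0.
  by rewrite (injS Pj Pi e) eqxx in ij.
under eq_bigr do rewrite mulrCA.
by rewrite -mulr_sumr walsh_orthogonal eqxx mul1r mulrC.
Qed.

Lemma parseval (a : J -> R) :
  \sum_x (\sum_(i | P i) a i * walsh (S i) x) ^+ 2 = c * \sum_(i | P i) a i ^+ 2.
Proof.
under eq_bigr do rewrite expr2 mulr_suml.
rewrite exchange_big /= mulr_sumr; apply: eq_bigr => j Pj.
under eq_bigr do rewrite -mulrA.
by rewrite -mulr_sumr walsh_coef// mulrCA.
Qed.

(** Expand the squared distance from [g] to its projection on the span of the family. *)
Lemma bessel (g : X -> R) :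
  \sum_(j | P j) (c^-1 * \sum_x walsh (S j) x * g x) ^+ 2 <= c^-1 * \sum_x g x ^+ 2.
Proof.
have c0 : 0 < c by rewrite ltr0n; apply/card_gt0P; exists [ffun=> false].
pose a j := c^-1 * \sum_x walsh (S j) x * g x.
have : 0 <= \sum_x (g x - \sum_(j | P j) a j * walsh (S j) x) ^+ 2.
  by apply: sumr_ge0 => x _; apply: sqr_ge0.
have -> : \sum_x (g x - \sum_(j | P j) a j * walsh (S j) x) ^+ 2 =
   \sum_x g x ^+ 2 - 2 * \sum_x g x * (\sum_(j | P j) a j * walsh (S j) x)
   + \sum_x (\sum_(j | P j) a j * walsh (S j) x) ^+ 2.
  rewrite mulr_sumr -sumrB -big_split /=; apply: eq_bigr => x _.
  ring.
rewrite parseval.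
have -> : \sum_x g x * (\sum_(j | P j) a j * walsh (S j) x) =
   c * \sum_(j | P j) a j ^+ 2.
  under eq_bigr do rewrite mulr_sumr.
  rewrite exchange_big /= mulr_sumr; apply: eq_bigr => j Pj.
  have aE : \sum_x walsh (S j) x * g x = c * a j.
    by rewrite /a mulrA mulfV ?gt_eqF// mul1r.
  under eq_bigr => x _ do rewrite mulrCA [g x * _]mulrC.
  by rewrite -mulr_sumr aE mulrCA expr2.
move=> h; rewrite -/(a _) ler_pdivlMl//; rewrite -/a; lra.
Qed.

End Bessel.

Lemma lpn_evec (R : realType) (n : nat) (r : R) (i : 'I_n) : 0 <= r -> lpn r (evec R i) = 1.
Proof.
move=> r0; rewrite (@lpn_delta _ _ _ _ i)// ?ffunE ?eqxx ?normr1// => j /negPf ji.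
by rewrite ffunE ji.
Qed.

(** * Arrays with square-summable slices *)

Section MixedNorm.
Variables (R : realType) (k n : nat).
Hypothesis k0 : (0 < k)%N.
Local Notation vec := {ffun 'I_n -> R}.
Local Notation idx := {ffun 'I_k -> 'I_n}.
Local Notation arr := {ffun idx -> R}.
Local Notation bits := ('I_k * 'I_n)%type.
Local Notation X := {ffun bits -> bool}.
Local Notation pinf := (@pn R k n (fun _ => lpn 0)).

(** This bound is far from sharp; it serves to make the supremum in [mixed_norm_bound] finite. *)
Lemma pinf_crude (A : arr) : pinf A <= \sum_I `|A I|.
Proof.
rewrite {1}(array_basis (Ordinal k0) A); apply: le_trans (pn_sum _ _ _ _ _) _ => //.
  by move=> *; apply: lpn_ge0.
apply: ler_sum => I _; apply: le_trans (pn_le_prod _ _) _.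
  by move=> *; apply: lpn_ge0.
under eq_bigr do rewrite lpnZ// lpn_evec// mulr1.
by rewrite (bigD1 (Ordinal k0))// eqxx big1 /= ?mulr1// => j /negPf->; rewrite normr1.
Qed.

Variable j0 : 'I_k.

(** One sign for each entry of each factor except [j0], which is left free to carry a vector of
    coefficients. Once [I j0] is fixed, the set determines [I]. *)
Definition bitset (I : idx) : {set bits} := [set (j, I j) | j in [set j | j != j0]].

Lemma bitset_inj (i : 'I_n) : {in [pred I : idx | I j0 == i] &, injective bitset}.
Proof.
move=> I I' /eqP Ii /eqP I'i e; apply/ffunP => j.
have [->|jj0] := eqVneq j j0; first by rewrite Ii I'i.
have : (j, I j) \in bitset I by apply/imsetP; exists j; rewrite ?inE.
by rewrite e => /imsetP[j' _ [-> ->]].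
Qed.

Lemma bitset_card (I : idx) : (#|bitset I| <= k)%N.
Proof.
by apply: leq_trans (leq_imset_card _ _) _; rewrite -[leqRHS]card_ord max_card.
Qed.

Lemma walsh_bitset (I : idx) (x : X) :
  walsh R (bitset I) x = \prod_(j | j != j0) (-1) ^+ x (j, I j).
Proof.
rewrite /walsh /bitset big_imset /=; last by move=> j j' _ _ [].
by apply: eq_bigl => j; rewrite inE.
Qed.

Lemma elementary_walsh (x : X) (b : vec) :
  elementary_tensor (fun j => if j == j0 then b else [ffun i => (-1) ^+ x (j, i)]) =
  [ffun I : idx => walsh R (bitset I) x * b (I j0)].
Proof.
apply/ffunP => I; rewrite !ffunE (bigD1 j0)//= eqxx mulrC walsh_bitset; congr (_ * _).
by apply: eq_bigr => j /negPf->; rewrite ffunE.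
Qed.

Lemma pinf_walsh (x : X) (b : vec) :
  pinf [ffun I : idx => walsh R (bitset I) x * b (I j0)] <= lpn 0 b.
Proof.
rewrite -elementary_walsh; apply: le_trans (pn_le_prod _ _) _.
  by move=> *; apply: lpn_ge0.
rewrite (bigD1 j0)//= eqxx ler_piMr ?lpn_ge0//; apply: prodr_ile1 => j /negPf->.
rewrite lpn_ge0 /=; apply/lpn0_leP => // i.
by rewrite ffunE normrX normrN1 expr1n.
Qed.

Definition unit_columns (A : arr) := forall i, \sum_(I : idx | I j0 == i) A I ^+ 2 <= 1.

Lemma unit_columns_le1 (A : arr) I : unit_columns A -> `|A I| <= 1.
Proof.
move=> /(_ (I j0)); rewrite (bigD1 I)//= => h.
rewrite -(@ler_pXn2r _ 2)// ?nnegrE// expr1n real_normK ?num_real//.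
by apply: le_trans h; rewrite lerDl sumr_ge0// => J _; rewrite sqr_ge0.
Qed.

(** Chosen so that [tau ^- 2 * 9 ^+ k] is 1/4: above height [tau] one has Y^2 <= tau^(-2) Y^4, and
    the fourth-moment bound [9 ^+ k] leaves mean square at most 1/4. *)
Local Notation tau := (2 * 3 ^+ k : R).

(* Expanding [A] in the Rademacher functions of all coordinates but [j0] and
   cutting the coefficients at height [tau] splits off an average of tensors of
   norm at most [tau]; by Bonami's fourth-moment bound and Bessel's inequality
   the columns of the remainder have norm at most [1/2]. *)
Lemma unit_columns_split (A : arr) : unit_columns A ->
  exists A' : arr, unit_columns A' /\ pinf A <= tau + 2^-1 * pinf A'.
Proof.
move=> uA.
pose c := #|{: X}|%:R : R.
have c0 : 0 < c by rewrite ltr0n; apply/card_gt0P; exists [ffun=> false].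
have tau0 : 0 < tau by rewrite mulr_gt0// exprn_gt0.
pose Y x i := \sum_(I : idx | I j0 == i) A I * walsh R (bitset I) x.
pose b x i := if `|Y x i| <= tau then Y x i else 0.
pose g x i := if `|Y x i| <= tau then 0 else Y x i.
have Ybg x i : Y x i = b x i + g x i by rewrite /b /g; case: ifP; rewrite ?addr0 ?add0r.
pose D := \sum_x [ffun I : idx => walsh R (bitset I) x * [ffun i => c^-1 * b x i] (I j0)].
pose A' := [ffun I : idx => 2 * (c^-1 * \sum_x walsh R (bitset I) x * g x (I j0))].
have AE : A = D + [ffun I => 2^-1 * A' I].
  apply/ffunP => I; rewrite !ffunE sum_ffunE.
  have -> : \sum_x [ffun I : idx => walsh R (bitset I) x *
       [ffun i => c^-1 * b x i] (I j0)] I = c^-1 * \sum_x walsh R (bitset I) x * b x (I j0).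
    by rewrite mulr_sumr; apply: eq_bigr => x _; rewrite !ffunE mulrCA.
  rewrite mulrA mulVf ?pnatr_eq0// mul1r -mulrDr -big_split /=.
  under eq_bigr do rewrite -mulrDr -Ybg.
  by rewrite (walsh_coef (@bitset_inj (I j0)) A)//= mulrA mulVf ?gt_eqF// mul1r.
exists A'; split.
  move=> i.
  under eq_bigr => I /eqP Ii do rewrite ffunE Ii exprMn.
  rewrite -mulr_sumr.
  have h1 := bessel (@bitset_inj i) (g ^~ i).
  have h2 : \sum_x g x i ^+ 2 <= c * 4^-1.
    have g4 x : g x i ^+ 2 <= tau ^- 2 * Y x i ^+ 4.
      rewrite ler_pdivlMl ?exprn_gt0// /g; case: (leP `|Y x i| tau) => [_|lt].
        by rewrite expr0n mulr0 exprn_even_ge0.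
      rewrite -[Y x i ^+ 4]/(Y x i ^+ (2 + 2)) exprD ler_wpM2r ?sqr_ge0//.
      by rewrite -[leRHS]real_normK ?num_real// lerXn2r ?nnegrE// ltW.
    apply: (le_trans (ler_sum _ (fun x _ => g4 x))); rewrite -mulr_sumr.
    have h4 := @bonami R bits (enum [set: bits]) k idx [pred I : idx | I j0 == i] A bitset
       (@bitset_inj i) _ (fun I _ => bitset_card I).
    have subB : {in [pred I : idx | I j0 == i], forall I, {subset bitset I <= enum [set: bits]}}.
      by move=> I _ y _; rewrite mem_enum inE.
    have {}h4 := h4 subB.
    have t20 : 0 <= tau ^- 2 by rewrite invr_ge0 exprn_ge0// ltW.
    apply: le_trans (ler_wpM2l t20 h4) _; rewrite -/c.
    rewrite mulrCA -mulrA ler_wpM2l ?(ltW c0)//.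
    have -> : tau ^- 2 = 4^-1 * (9 ^+ k)^-1.
      by rewrite exprMn invfM -exprM mulnC exprM; congr (_^-1 * (_ ^+ _)^-1); ring.
    have n0 : 9 ^+ k != 0 :> R by rewrite expf_neq0// pnatr_eq0.
    rewrite mulrCA -mulrA mulKf// -[leRHS]mulr1 ler_wpM2l ?invr_ge0//.
    by rewrite exprn_ile1 ?uA// sumr_ge0// => I _; rewrite sqr_ge0.
  apply: le_trans (ler_wpM2l _ h1) _; first by rewrite exprn_ge0.
  apply: le_trans (ler_wpM2l _ (ler_wpM2l _ h2)) _.
  - by rewrite exprn_ge0.
  - by rewrite invr_ge0 ltW.
  rewrite -/c [c^-1 * _]mulrA mulVf ?gt_eqF// mul1r; lra.
have nu0 (j : 'I_k) (x : vec) : 0 <= lpn 0 x by apply: lpn_ge0.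
rewrite {1}AE; apply: le_trans (pn_add nu0 k0 _ _) _; apply: lerD; last first.
  apply: le_trans (pnZ _ _ k0 nu0 _) _; first by move=> *; apply: lpnZ.
  by rewrite ger0_norm.
apply: le_trans (pn_sum nu0 k0 _ _ _) _.
apply: (@le_trans _ _ (\sum_(x : X) c^-1 * tau)); last first.
  by rewrite sumr_const -mulrnAl -[c^-1 *+ _]mulr_natr -/c mulVf ?gt_eqF// mul1r.
apply: ler_sum => x _; apply: le_trans (pinf_walsh _ _) _.
apply/lpn0_leP; first by rewrite mulr_ge0 ?invr_ge0 ?ltW.
move=> i; rewrite ffunE normrM ger0_norm ?invr_ge0 ?(ltW c0)// ler_wpM2l ?invr_ge0 ?(ltW c0)//.
by rewrite /b; case: ifP => // _; rewrite normr0 ltW.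
Qed.

(** The infinite iteration of the splitting becomes an inequality for the supremum s over all
    admissible arrays: s <= tau + s / 2. *)
Lemma mixed_norm_bound (A : arr) : unit_columns A -> pinf A <= 2 * tau.
Proof.
move=> uA; pose E := [set pinf B | B in unit_columns]%classic.
have hE : has_sup E.
  split; first by exists (pinf A), A.
  exists (\sum_(I : idx) 1) => _ [B uB <-]; apply: le_trans (pinf_crude _) _.
  by apply: ler_sum => I _; apply: unit_columns_le1.
have hs : sup E <= tau + 2^-1 * sup E.
  apply: ge_sup => [|_ [B uB <-]]; first by case: hE.
  have [B' [uB' h]] := unit_columns_split uB; apply: le_trans h _.
  rewrite lerD2l ler_wpM2l ?invr_ge0//; apply: sup_upper_bound => //; by exists B'.
have : pinf A <= sup E by apply: sup_upper_bound => //; exists A.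
by lra.
Qed.

End MixedNorm.

(** * Estimates for the inradius *)

Lemma powR_prod (R : realType) (I : Type) (s : seq I) (P : pred I) (x : R) (e : I -> R) :
  0 < x -> \prod_(i <- s | P i) x `^ e i = x `^ (\sum_(i <- s | P i) e i).
Proof.
move=> x0; apply/esym/(big_morph (fun t => x `^ t)); last exact: powRr0.
by move=> s' t; rewrite powRD// (gt_eqF x0) implybT.
Qed.

Lemma sum_sqrt_le (R : realType) (I : finType) (a : I -> R) : (forall i, 0 <= a i) ->
  \sum_i Num.sqrt (a i) <= Num.sqrt #|I|%:R * Num.sqrt (\sum_i a i).
Proof.
move=> a0; rewrite -sqrtrM// -[leLHS]ger0_norm ?sumr_ge0// -sqrtr_sqr ler_wsqrtr//.
have := sum_CauchySchwarz (fun _ => 1) (fun i => Num.sqrt (a i)).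
under eq_bigr do rewrite mul1r.
move=> /le_trans; apply; rewrite expr1n sumr_const -[_ *+ _]mulr_natl mulr1.
by rewrite ler_wpM2l//; apply: ler_sum => i _; rewrite sqr_sqrtr.
Qed.

Section Inradius.
Variables (R : realType) (k n : nat).
Hypotheses (k0 : (0 < k)%N) (n0 : (0 < n)%N).
Local Notation vec := {ffun 'I_n -> R}.
Local Notation idx := {ffun 'I_k -> 'I_n}.
Local Notation arr := {ffun idx -> R}.
Local Notation pnr r := (@pn R k n (fun j => lpn (r j))).
Local Notation pinf := (pnr (fun=> 0)).
Local Notation K := (4 * 3 ^+ k : R).
Local Notation norm2 A := (Num.sqrt (\sum_I A I ^+ 2)).

Let lp0 (r : 'I_k -> R) j (x : vec) : 0 <= lpn (r j) x.
Proof. exact: lpn_ge0. Qed.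

Lemma pnr_homogeneous (r : 'I_k -> R) (t : R) : (forall j, 0 <= r j) ->
  (forall A : arr, \sum_I A I ^+ 2 <= 1 -> pnr r A <= t) ->
  forall A : arr, pnr r A <= t * norm2 A.
Proof.
move=> r0 h A; set s := norm2 A.
have q0 : 0 <= \sum_I A I ^+ 2 by apply: sumr_ge0 => I _; apply: sqr_ge0.
have [s0|s0] := eqVneq s 0.
  have -> : A = 0.
    apply/ffunP => I; rewrite ffunE; apply/eqP; rewrite -sqrf_eq0 eq_le sqr_ge0 andbT.
    have : \sum_I A I ^+ 2 <= 0 by rewrite -sqrtr_eq0 -/s s0.
    apply: le_trans; rewrite (bigD1 I)//= lerDl sumr_ge0// => J _; exact: sqr_ge0.
  by rewrite pn0 // s0 mulr0.
have sp : 0 < s by rewrite lt0r s0 sqrtr_ge0.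
have -> : A = [ffun I => s * [ffun J => s^-1 * A J] I].
  by apply/ffunP => I; rewrite !ffunE mulVKf.
apply: le_trans (pnZ _ _ k0 (lp0 r) _) _; first by move=> *; apply: lpnZ.
rewrite gtr0_norm// mulrC ler_wpM2r ?(ltW sp)// h//.
under eq_bigr do rewrite ffunE exprMn.
by rewrite -mulr_sumr exprVn mulrC ler_pdivrMr ?exprn_gt0// mul1r sqr_sqrtr.
Qed.

(* Distributing the squared norm of [A] over its
   coordinate marginals [m] reduces it, by the arithmetic-geometric mean
   inequality, to the mixed norms handled by [mixed_norm_bound]. *)
Lemma hardy_littlewood (r : 'I_k -> R) (A : arr) :
  (forall j, 0 <= r j) -> \sum_j r j = 2^-1 -> pnr r A <= K * norm2 A.
Proof.
move=> r0 r1; apply: pnr_homogeneous => // {}A A1.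
pose m j i := \sum_(I : idx | I j == i) A I ^+ 2.
have m0 j i : 0 <= m j i by apply: sumr_ge0 => I _; apply: sqr_ge0.
have m1 j : \sum_i m j i <= 1.
  apply: le_trans A1; rewrite le_eqVlt; apply/orP; left; apply/eqP.
  by rewrite [RHS](partition_big (fun I : idx => I j) predT).
have Am I j : A I ^+ 2 <= m j (I j).
  by rewrite /m (bigD1 I)//= lerDl sumr_ge0// => J _; rewrite sqr_ge0.
have Amp I j : A I != 0 -> 0 < m j (I j).
  by move=> AI; apply: lt_le_trans (Am I j); rewrite lt0r sqrf_eq0 AI sqr_ge0.
(* By [lpn_weight] these weights act as contractions from l_oo, so it is enough to bound the
   sup-norm projective norm of [A'], the array divided by them. *)
pose w j i := m j i `^ r j.
have w0 j i : 0 <= w j i by apply: powR_ge0.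
pose A' : arr := [ffun I : idx => A I / \prod_j w j (I j)].
have AE : A = wmul w A'.
  apply/ffunP => I; rewrite !ffunE.
  have [->|AI] := eqVneq (A I) 0; first by rewrite mul0r mulr0.
  rewrite mulrC divfK// gt_eqF// prodr_gt0// => j _.
  by rewrite powR_gt0// Amp.
rewrite {1}AE.
have h1 : pnr r (wmul w A') <= (\prod_(j < k) 1) * pinf A'.
  apply: (@pn_wmul R k n (fun=> lpn 0) (fun j => lpn (r j)) w (fun=> 1)) => //.
  - by move=> *; apply: lpn_ge0.
  - by move=> j x; rewrite mul1r lpn_weight.
apply: le_trans h1 _; rewrite big1// mul1r.
(* [B j] has unit columns in direction [j]. The modulus of [A'] is the geometric mean of the [B j]
   with weights [2 * r j]; these sum to 1 precisely because the [r j] sum to 1/2. *)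
pose B j (I : idx) := `|A I| / Num.sqrt (m j (I j)).
have B0 j I : 0 <= B j I by rewrite divr_ge0// sqrtr_ge0.
pose G I := \sum_j (2 * r j) * B j I.
have G0 I : 0 <= G I by apply: sumr_ge0 => j _; rewrite !mulr_ge0.
have AG I : `|A' I| <= G I.
  have [AI|AI] := eqVneq (A I) 0; first by rewrite ffunE AI mul0r normr0.
  have := @weighted_AMGM R 'I_k (fun j => 2 * r j) (fun j => B j I).
  rewrite -mulr_sumr r1 mulfV ?pnatr_eq0// => h.
  have {}h := h (fun j => mulr_ge0 (ler0n _ 2) (r0 j)) erefl (fun j => B0 j I).
  apply: le_trans h; rewrite ffunE normrM normfV.
  have -> : `|\prod_j w j (I j)| = \prod_j w j (I j) by rewrite ger0_norm ?prodr_ge0.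
  have -> : `|A I| = \prod_j `|A I| `^ (2 * r j).
    by rewrite powR_prod ?normr_gt0// -mulr_sumr r1 mulfV ?pnatr_eq0// powRr1.
  rewrite -prodf_div le_eqVlt; apply/orP; left; apply/eqP; apply: eq_bigr => j _.
  rewrite /B powRM ?invr_ge0 ?sqrtr_ge0//; congr (_ * _).
  rewrite -powR12_sqrt// /w -!powRN -powRrM; congr (_ `^ _).
  by rewrite mulrA mulNr mulVf ?pnatr_eq0// mulN1r.
(* As [G] dominates the modulus of [A'], the quotient [A' / G] is at most 1 in modulus. Multiplying
   by it keeps the columns of [B j] short and makes [A'] a convex combination of the [C j]. Where
   [G] vanishes, so does [A']. *)
pose C j : arr := [ffun I : idx => B j I * (A' I / G I)].
have CE j I : C j I = B j I * (A' I / G I) by apply: ffunE.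
have A'E : A' = \sum_j [ffun I => (2 * r j) * C j I].
  apply/ffunP => I; rewrite sum_ffunE.
  have -> : \sum_j [ffun I => (2 * r j) * C j I] I = \sum_j (2 * r j * B j I) * (A' I / G I).
    by apply: eq_bigr => j _; rewrite [LHS]ffunE CE; apply: mulrA.
  rewrite -mulr_suml -/(G I); have [GI|GI] := eqVneq (G I) 0.
    by rewrite GI mul0r; apply/eqP; rewrite -normr_le0 -GI.
  by rewrite mulrC divfK.
have uC j : unit_columns j (C j).
  move=> i; apply: (@le_trans _ _ (\sum_(I : idx | I j == i) A I ^+ 2 / m j i)).
    apply: ler_sum => I /eqP Ii; rewrite CE exprMn.
    have -> : A I ^+ 2 / m j i = B j I ^+ 2.
      by rewrite /B exprMn real_normK ?num_real// exprVn sqr_sqrtr ?Ii// m0.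
    rewrite ler_piMr ?sqr_ge0//.
    rewrite -real_normK ?num_real// exprn_ile1// normrM normfV (ger0_norm (G0 I)).
    have [->|GI] := eqVneq (G I) 0; first by rewrite invr0 mulr0.
    by rewrite ler_pdivrMr ?lt0r ?GI ?G0// mul1r.
  rewrite -mulr_suml -/(m j i); have [->|mi] := eqVneq (m j i) 0; first by rewrite mul0r.
  by rewrite mulfV.
rewrite {1}A'E.
have z0 (j : 'I_k) (x : vec) : 0 <= lpn 0 x by apply: lpn_ge0.
apply: le_trans (pn_sum z0 k0 _ _ _) _.
apply: (@le_trans _ _ (\sum_j (2 * r j) * K)); last first.
  by rewrite -mulr_suml -mulr_sumr r1 mulfV ?pnatr_eq0// mul1r.
apply: ler_sum => j _; apply: le_trans (pnZ _ _ k0 z0 _) _.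
  by move=> *; apply: lpnZ.
have rj0 : 0 <= 2 * r j by rewrite mulr_ge0.
rewrite ger0_norm// ler_wpM2l//; apply: le_trans (mixed_norm_bound k0 (uC j)) _.
by rewrite mulrA -natrM.
Qed.

(** In a slice the factor [j0] is supported on one coordinate, where all l_p norms agree, so its
    exponent may be traded for [r' j0 = 0]. The bound [f] is left abstract to serve both Euclidean
    norms and cubes. *)
Lemma pnr_slice (r r' : 'I_k -> R) (j0 : 'I_k) (A : arr) (f : arr -> R) :
  (forall j, 0 <= r j) -> r' j0 = 0 -> (forall j, j != j0 -> r' j = r j) ->
  (forall A, pnr r' A <= f A) ->
  pnr r A <= \sum_i f [ffun I : idx => (I j0 == i)%:R * A I].
Proof.
move=> r0 r'0 r'E h; pose sl i : arr := [ffun I : idx => (I j0 == i)%:R * A I].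
have r'0' j : 0 <= r' j by have [->|/r'E->//] := eqVneq j j0; rewrite r'0.
have -> : A = \sum_i sl i.
  apply/ffunP => I; rewrite sum_ffunE (bigD1 (I j0))//= big1 ?addr0.
    by rewrite ffunE eqxx mul1r.
  by move=> i /negPf ne; rewrite ffunE eq_sym ne mul0r.
apply: le_trans (pn_sum (lp0 r) k0 _ _ _) _; apply: ler_sum => i _.
have -> : [ffun I : idx => (I j0 == i)%:R * (\sum_i0 sl i0) I] = sl i.
  apply/ffunP => I; rewrite !ffunE sum_ffunE; congr (_ * _).
  rewrite (bigD1 (I j0))//= big1 ?addr0; first by rewrite ffunE eqxx mul1r.
  by move=> i' /negPf ne; rewrite ffunE eq_sym ne mul0r.
apply: le_trans (h (sl i)).
pose w j i' := if j == j0 then (i' == i)%:R else 1 : R.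
have {1}-> : sl i = wmul w (sl i).
  apply/ffunP => I; rewrite !ffunE (bigD1 j0)//= big1 ?mulr1; last first.
    by move=> j /negPf jj; rewrite /w jj.
  by rewrite /w eqxx; case: (I j0 == i); rewrite ?mul1r ?mul0r.
apply: le_trans (@pn_wmul R k n (fun j => lpn (r' j)) (fun j => lpn (r j)) w (fun=> 1)
  k0 (lp0 r') (lp0 r) _ _ _) _; last by rewrite big1// mul1r.
  by [].
move=> j x; rewrite mul1r /w; have [->|jj] := eqVneq j j0; last first.
  rewrite (r'E _ jj); apply: lpn_homo => [|i']; first exact: r0.
  by rewrite ffunE mul1r.
rewrite r'0 (@lpn_delta _ _ _ _ i)//.
  by rewrite ffunE eqxx mul1r le_lpn.
by move=> i' /negPf ne; rewrite ffunE ne mul0r.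
Qed.

Lemma pnr_slice_norm2 (r r' : 'I_k -> R) (j0 : 'I_k) (t : R) : 0 <= t ->
  (forall j, 0 <= r j) -> r' j0 = 0 -> (forall j, j != j0 -> r' j = r j) ->
  (forall A : arr, pnr r' A <= t * norm2 A) ->
  forall A : arr, pnr r A <= Num.sqrt n%:R * t * norm2 A.
Proof.
move=> t0 r0 r'0 r'E h A; apply: le_trans (pnr_slice A r0 r'0 r'E h) _.
rewrite -mulr_sumr [Num.sqrt _ * _]mulrC -mulrA ler_wpM2l//.
apply: le_trans (sum_sqrt_le _) _.
  by move=> i; apply: sumr_ge0 => I _; apply: sqr_ge0.
rewrite card_ord ler_wpM2l ?sqrtr_ge0// ler_wsqrtr//.
rewrite exchange_big /=; apply: ler_sum => I _.
rewrite (bigD1 (I j0))//= big1 ?addr0; first by rewrite ffunE eqxx mul1r.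
by move=> i /negPf ne; rewrite ffunE eq_sym ne mul0r expr0n.
Qed.

Lemma pnr_compare (r s : 'I_k -> R) (A : arr) :
  (forall j, 0 <= r j) -> (forall j, 0 <= s j) ->
  pnr r A <= n%:R `^ (\sum_j Num.max (r j - s j) 0) * pnr s A.
Proof.
move=> r0 s0; rewrite -powR_prod ?ltr0n//.
apply: (@pn_compare R k n _ _ (fun j => n%:R `^ Num.max (r j - s j) 0) k0 (lp0 s) (lp0 r)).
  by move=> j; apply: powR_ge0.
by move=> j x; apply: lpn_compare.
Qed.

Lemma pnr_le (r s : 'I_k -> R) (A : arr) :
  (forall j, 0 <= r j <= s j) -> pnr r A <= pnr s A.
Proof.
move=> rs; have r0 j : 0 <= r j by case/andP: (rs j).
have s0 j : 0 <= s j by case/andP: (rs j) => h1 h2; apply: le_trans h2.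
apply: le_trans (pnr_compare A r0 s0) _; rewrite big1 ?powRr0 ?mul1r//.
by move=> j _; rewrite max_r// subr_le0; case/andP: (rs j).
Qed.

(** [hardy_littlewood] wants exponents of sum 1/2. A smaller sum is completed by raising one
    exponent, which increases the norm; a larger sum [S] is scaled down to 1/2, and comparing the
    factors costs exactly [n ^ (S - 1/2)]. *)
Lemma inradius_tail (r : 'I_k -> R) (A : arr) (a : nat) : (a < k)%N ->
  (forall j, 0 <= r j) -> (forall j : 'I_k, (j < a)%N -> r j = 0) ->
  pnr r A <= K * n%:R `^ (Num.max (\sum_j r j) 2^-1 - 2^-1) * norm2 A.
Proof.
move=> ak r0 rz; set S := \sum_j r j.
have [Sle|Sgt] := leP S 2^-1.
  pose jl : 'I_k := Ordinal ak.
  pose s j := r j + if j == jl then 2^-1 - S else 0.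
  have d0 : 0 <= 2^-1 - S by rewrite subr_ge0.
  rewrite subrr powRr0 mulr1.
  have rs j : 0 <= r j <= s j.
    by apply/andP; split=> //; rewrite /s lerDl; case: (j == jl).
  have s0 j : 0 <= s j by case/andP: (rs j) => h1 h2; apply: le_trans h2.
  apply: le_trans (pnr_le A rs) _; apply: hardy_littlewood => //.
  by rewrite big_split /= -big_mkcond big_pred1_eq addrC subrK.
have Sp : 0 < S by apply: lt_trans Sgt; rewrite invr_gt0.
pose s j := r j / (2 * S).
have s0 j : 0 <= s j by rewrite divr_ge0// mulr_ge0// ltW.
apply: le_trans (pnr_compare A r0 s0) _.
have -> : \sum_j Num.max (r j - s j) 0 = S - 2^-1.
  transitivity (\sum_j (r j - s j)).
    apply: eq_bigr => j _; rewrite max_l// subr_ge0 ler_pdivrMr ?mulr_gt0//.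
    rewrite ler_peMr// ; lra.
  rewrite sumrB -mulr_suml -/S; field; exact: lt0r_neq0.
rewrite mulrC [K * _]mulrC -mulrA mulrC ler_wpM2l ?powR_ge0//.
apply: hardy_littlewood => //.
rewrite -mulr_suml -/S; field; exact: lt0r_neq0.
Qed.

Lemma inradius_bound (r : 'I_k -> R) (a : nat) : (a < k)%N -> (forall j, 0 <= r j) ->
  forall A : arr, pnr r A <=
  K * n%:R `^ (a%:R / 2 + Num.max (\sum_(j < k | (a <= j)%N) r j) 2^-1 - 2^-1) * norm2 A.
Proof.
move=> ak r0; set S := \sum_(j < k | _) _.
(* [rr b] replaces the first [b] exponents by 0. From [rr a], where [inradius_tail] applies, each
   slicing restores one exponent at the price of the root of [n], until [rr 0], which is [r]. *)
pose rr b (j : 'I_k) := if (b <= j)%N then r j else 0.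
have rr0 b j : 0 <= rr b j by rewrite /rr; case: ifP.
have K0 : 0 <= K by rewrite mulr_ge0// exprn_ge0.
have nn0 : 0 < n%:R :> R by rewrite ltr0n.
set e := Num.max S 2^-1 - 2^-1.
suff H b : (b <= a)%N -> forall A : arr, pnr (rr (a - b)%N) A <=
    K * n%:R `^ (b%:R / 2 + e) * norm2 A.
  move=> A; have := H a (leqnn a) A; rewrite subnn /e addrA; apply: le_trans.
  by apply: pnr_le => j; rewrite r0 /rr lexx.
elim: b => [|b IH] ba A.
  rewrite subn0 mul0r add0r; apply: le_trans (inradius_tail A ak (rr0 a) _) _.
    by move=> j ja; rewrite /rr leqNgt ja.
  by rewrite /rr -big_mkcond.
have ab : (a - b.+1 < k)%N by apply: leq_ltn_trans ak; apply: leq_subr.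
have := @pnr_slice_norm2 (rr (a - b.+1)%N) (rr (a - b)%N) (Ordinal ab)
  (K * n%:R `^ (b%:R / 2 + e)) _ (rr0 _).
have abE : (a - b)%N = (a - b.+1).+1 by rewrite -subSn// subSS.
move=> h; have {}h := h (mulr_ge0 K0 (powR_ge0 _ _)).
have {}h := h _ _ (IH (ltnW ba)).
apply: le_trans (h _ _ A) _.
- by rewrite /rr abE /= ltnn.
- move=> j jne; rewrite /rr abE; case: (ltngtP (a - b.+1)%N j) => // je.
  by case/eqP: jne; apply: val_inj.
rewrite le_eqVlt; apply/orP; left; apply/eqP; congr (_ * _).
rewrite mulrCA; congr (_ * _); rewrite -powR12_sqrt ?(ltW nn0)// -powRD ?(gt_eqF nn0) ?implybT//.
by congr (_ `^ _); rewrite -natr1; ring.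
Qed.

End Inradius.

(** * Cubes inside the unit ball *)

Section Counting.
Variables (R : comNzRingType) (k n : nat).
Local Notation idx := {ffun 'I_k -> 'I_n}.

Lemma sum_pred1 (j0 : 'I_k) (i : 'I_n) :
  \sum_(I : idx | I j0 == i) 1 = n%:R ^+ k.-1 :> R.
Proof.
transitivity (\sum_(I : idx) \prod_j (if j == j0 then (I j == i)%:R else 1 : R)).
  rewrite big_mkcond; apply: eq_bigr => I _; rewrite (bigD1 j0)//= eqxx.
  rewrite big1 ?mulr1; last by move=> j /negPf->.
  by case: (I j0 == i).
rewrite -(bigA_distr_bigA (fun j i' => if j == j0 then (i' == i)%:R else 1 : R)).
rewrite (bigD1 j0)//= eqxx (bigD1 i)//= eqxx big1 ?addr0 ?mul1r; last by move=> ? /negPf->.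
under eq_bigr => j /negPf-> do rewrite sumr_const card_ord.
by rewrite prodr_const cardC1 card_ord.
Qed.

Lemma sum_pred2 (j0 j1 : 'I_k) (i0 i1 : 'I_n) : j1 != j0 ->
  \sum_(I : idx | I j1 == i1) (I j0 == i0)%:R = n%:R ^+ k.-2 :> R.
Proof.
move=> j10.
transitivity (\sum_(I : idx) \prod_j (if j == j0 then (I j == i0)%:R else
   if j == j1 then (I j == i1)%:R else 1 : R)).
  rewrite big_mkcond; apply: eq_bigr => I _; rewrite (bigD1 j0)//= eqxx.
  rewrite (bigD1 j1)//= (negPf j10) eqxx big1 ?mulr1; last by move=> j /andP[/negPf-> /negPf->].
  by case: (I j1 == i1); rewrite ?mulr0 ?mulr1.
rewrite -(bigA_distr_bigA (fun j i' => if j == j0 then (i' == i0)%:R else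
  if j == j1 then (i' == i1)%:R else 1 : R)).
rewrite (bigD1 j0)//= eqxx (bigD1 i0)//= eqxx big1 ?addr0 ?mul1r; last by move=> ? /negPf->.
rewrite (bigD1 j1)//= (negPf j10) eqxx (bigD1 i1)//= eqxx big1 ?addr0 ?mul1r; last first.
  by move=> ? /negPf->.
under eq_bigr => j /andP[/negPf-> /negPf->] do rewrite sumr_const card_ord.
have cE : #|[pred j | (j != j0) && (j != j1)]|.+2 = k.
  rewrite -[RHS](card_ord k) -(cardC (mem [:: j0; j1])) (card_uniqP _) /=; last first.
    by rewrite inE andbT eq_sym.
  rewrite add2n; congr _.+2; apply: eq_card => j.
  by rewrite !inE /in_mem /= negb_or orbF.
by rewrite prodr_const -[in RHS]cE.
Qed.

End Counting.

Section Cubes.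
Variables (R : realType) (k n : nat).
Hypotheses (k0 : (0 < k)%N) (n0 : (0 < n)%N).
Local Notation vec := {ffun 'I_n -> R}.
Local Notation idx := {ffun 'I_k -> 'I_n}.
Local Notation arr := {ffun idx -> R}.
Local Notation pnr r := (@pn R k n (fun j => lpn (r j))).
Local Notation pinf := (pnr (fun=> 0)).
Local Notation K := (4 * 3 ^+ k : R).

Lemma mixed_norm_bound_scaled (j0 : 'I_k) (A : arr) (e : nat) :
  (forall i, \sum_(I : idx | I j0 == i) A I ^+ 2 <= n%:R ^+ e) ->
  pinf A <= K * n%:R `^ (e%:R / 2).
Proof.
move=> h; set M := n%:R `^ _.
have nn0 : 0 < n%:R :> R by rewrite ltr0n.
have M0 : 0 < M by apply: powR_gt0.
have M2 : M ^+ 2 = n%:R ^+ e.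
  by rewrite -powR_mulrn ?(ltW M0)// -powRrM divfK ?pnatr_eq0// powR_mulrn// ltW.
have -> : A = [ffun I => M * [ffun J => M^-1 * A J] I].
  by apply/ffunP => I; rewrite !ffunE mulVKf// gt_eqF.
have z0 (j : 'I_k) (x : vec) : 0 <= lpn 0 x by apply: lpn_ge0.
apply: le_trans (pnZ _ _ k0 z0 _) _; first by move=> *; apply: lpnZ.
rewrite gtr0_norm// mulrC ler_wpM2r ?(ltW M0)//.
apply: le_trans (@mixed_norm_bound _ _ _ k0 j0 _ _) _; last by rewrite mulrA -natrM.
move=> i; under eq_bigr do rewrite ffunE exprMn.
by rewrite -mulr_sumr exprVn mulrC ler_pdivrMr ?exprn_gt0// mul1r M2.
Qed.

(** A slice of a point of the cube has n^(k-1) entries, hence Euclidean norm at most n^((k-1)/2);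
    passing from the sup norms to the true norms of the factors costs [n ^ S], where S is the sum of
    the exponents. *)
Lemma cube_bound (r : 'I_k -> R) (A : arr) : (forall j, 0 <= r j) ->
  (forall I, `|A I| <= 1) ->
  pnr r A <= K * n%:R `^ (\sum_j r j + k.-1%:R / 2).
Proof.
move=> r0 A1; have nn0 : 0 < n%:R :> R by rewrite ltr0n.
apply: le_trans (pnr_compare k0 n0 A r0 (fun=> lexx 0)) _.
under eq_bigr do rewrite subr0 max_l//.
rewrite powRD ?(gt_eqF nn0) ?implybT// mulrCA ler_wpM2l ?powR_ge0//.
apply: (@mixed_norm_bound_scaled (Ordinal k0)) => i.
rewrite -(sum_pred1 R (Ordinal k0) i); apply: ler_sum => I _.
by rewrite -real_normK ?num_real// exprn_ile1.
Qed.

(* Sharper than [cube_bound] when [r j0 > 1/2]. *)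
Lemma cube_bound_l1 (r : 'I_k -> R) (j0 : 'I_k) (A : arr) : (1 < k)%N -> (forall j, 0 <= r j) ->
  (forall I, `|A I| <= 1) ->
  pnr r A <= K * n%:R `^ (\sum_(j | j != j0) r j + k%:R / 2).
Proof.
move=> k1 r0 A1; have nn0 : 0 < n%:R :> R by rewrite ltr0n.
(* Slice along [j0], then apply the mixed norm in a second direction [j1]: a column of a slice has
   only n^(k-2) nonzero entries. The n slices together cost n * n^((k-2)/2) = n^(k/2). *)
have [j1 j10] : exists j1 : 'I_k, j1 != j0.
  apply/existsP; apply: contraT; rewrite negb_exists => /forallP h.
  suff : (k <= 1)%N by rewrite leqNgt k1.
  rewrite -(card_ord k) -(card1 j0); apply/subset_leq_card/fintype.subsetP => j _.
  by have := h j; rewrite negbK inE.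
pose r' j := if j == j0 then 0 else r j.
have r'0 j : 0 <= r' j by rewrite /r'; case: ifP.
pose f (B : arr) := n%:R `^ (\sum_(j | j != j0) r j) * pinf B.
have hf (B : arr) : pnr r' B <= f B.
  apply: le_trans (pnr_compare k0 n0 B r'0 (fun=> lexx 0)) _.
  under eq_bigr do rewrite subr0 max_l//.
  rewrite /f (bigD1 j0)//= {1}/r' eqxx add0r.
  rewrite le_eqVlt; apply/orP; left; apply/eqP; congr (_ `^ _ * _).
  by apply: eq_bigr => j /negPf jj; rewrite /r' jj.
apply: le_trans (@pnr_slice _ _ _ k0 r r' j0 A f r0 _ _ hf) _.
- by rewrite /r' eqxx.
- by move=> j /negPf jj; rewrite /r' jj.
apply: (@le_trans _ _ (\sum_(i < n)
    n%:R `^ (\sum_(j | j != j0) r j) * (K * n%:R `^ (k.-2%:R / 2)))).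
  apply: ler_sum => i _; apply: ler_wpM2l; first exact: powR_ge0.
  apply: (@mixed_norm_bound_scaled j1) => i1.
  rewrite -(sum_pred2 R i i1 j10); apply: ler_sum => I _; rewrite ffunE.
  case: (I j0 == i); last by rewrite mul0r expr0n.
  by rewrite mul1r -real_normK ?num_real// exprn_ile1.
rewrite sumr_const card_ord le_eqVlt; apply/orP; left; apply/eqP.
rewrite -[LHS]mulr_natr mulrCA -[LHS]mulrA; congr (_ * _).
rewrite -[X in _ * X](powRr1 (ltW nn0)) -!powRD ?(gt_eqF nn0) ?implybT//.
congr (_ `^ _); rewrite -addrA; congr (_ + _).
by case: k k1 => [|[|m]]//= _; rewrite -[in RHS]addn2 natrD; field.
Qed.

End Cubes.

(** * Functionals bounding the inradius *)

Section Holder.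
Variables (R : realType) (k n : nat).
Hypotheses (k0 : (0 < k)%N) (n0 : (0 < n)%N).
Local Notation vec := {ffun 'I_n -> R}.

(** Arithmetic-geometric means with the weights [r j / S'] and [e], which add up to 1. If the sum of
    the exponents is below 1, the missing weight goes to the uniform density [n%:R^-1]; if it
    exceeds 1, the exponents are scaled down, which is allowed since all coordinates are at most 1
    in modulus. *)
Lemma holder_normalized (r : 'I_k -> R) (y : 'I_k -> vec) : (forall j, 0 <= r j) ->
  (forall j, lpn (r j) (y j) = 1) ->
  \sum_i \prod_j `|y j i| <= n%:R `^ Num.max (1 - \sum_j r j) 0.
Proof.
move=> r0 y1; set S := \sum_j r j; have nn0 : 0 < n%:R :> R by rewrite ltr0n.
have S0 : 0 <= S by apply: sumr_ge0.
pose S' := Num.max S 1; have S'1 : 1 <= S' by rewrite le_max lexx orbT.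
have S'0 : 0 < S' by apply: lt_le_trans S'1.
pose e := Num.max (1 - S) 0.
have eE : S / S' + e = 1.
  rewrite /S' /e; have [S1|S1] := leP S 1.
    by rewrite max_l ?subr_ge0// divr1 addrC subrK.
  by rewrite max_r ?subr_le0 ?ltW// addr0 divff// gt_eqF// (lt_trans ltr01).
pose b j i := if r j == 0 then 1 else `|y j i| `^ (r j)^-1.
have b0 j i : 0 <= b j i by rewrite /b; case: ifP => // _; apply: powR_ge0.
have y1' j i : `|y j i| <= 1 by rewrite -(y1 j) le_lpn.
have yb j i : `|y j i| <= b j i `^ (r j / S').
  rewrite /b; case: eqP => [->|/eqP rj]; first by rewrite mul0r powRr0.
  rewrite -powRrM mulrA mulVf// mul1r.
  have [->|yn] := eqVneq `|y j i| 0; first by rewrite powR_ge0.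
  rewrite -[leLHS]powRr1//; apply: ger_powR; first by rewrite lt0r yn normr_ge0 y1'.
  by rewrite invf_le1.
have sb j : \sum_i r j * b j i <= r j.
  rewrite -mulr_sumr /b; have [->|rj] := eqVneq (r j) 0; first by rewrite mul0r.
  by rewrite lpn_sum ?lt0r ?rj ?r0// y1 powR1 mulr1.
have key i : \prod_j `|y j i| <= n%:R `^ e * (\sum_j (r j / S') * b j i + e * n%:R^-1).
  rewrite -ler_pdivrMl ?powR_gt0//.
  have := @weighted_AMGM R ('I_k + 'I_1)%type
    (fun c => match c with inl j => r j / S' | inr _ => e end)
    (fun c => match c with inl j => b j i | inr _ => n%:R^-1 end).
  rewrite !big_sumType /= !big_ord1 -mulr_suml => h.
  apply: le_trans (h _ eE _).
  - rewrite mulrC -powR_inv1 ?(ltW nn0)//.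
    rewrite -powRrM mulN1r powRN ler_wpM2r ?invr_ge0 ?powR_ge0//.
    by apply: ler_prod => j _; rewrite normr_ge0 yb.
  - move=> [j|_]; first by rewrite divr_ge0// ltW.
    by rewrite le_max lexx orbT.
  - by move=> [j|_]//; rewrite invr_ge0 ltW.
apply: le_trans (ler_sum _ (fun i _ => key i)) _.
rewrite -mulr_sumr ler_piMr ?powR_ge0// big_split /= sumr_const card_ord.
rewrite -[X in _ + X]mulr_natr -mulrA mulVf ?gt_eqF// mulr1 -[leRHS]eE lerD2r.
rewrite exchange_big /= mulr_suml; apply: ler_sum => j _.
under eq_bigr do rewrite mulrAC.
by rewrite -mulr_suml ler_wpM2r ?invr_ge0 ?(ltW S'0).
Qed.

Lemma holder (r : 'I_k -> R) (x : 'I_k -> vec) : (forall j, 0 <= r j) ->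
  \sum_i \prod_j `|x j i| <=
  n%:R `^ Num.max (1 - \sum_j r j) 0 * \prod_j lpn (r j) (x j).
Proof.
move=> r0; set c := _ `^ _.
have [/existsP[j /eqP xj]|] := boolP [exists j, lpn (r j) (x j) == 0].
  rewrite big1 ?mulr_ge0 ?powR_ge0 ?prodr_ge0// => [j' _|i _]; first exact: lpn_ge0.
  by rewrite (bigD1 j)//= (lpn_eq0 (r0 j) xj) normr0 mul0r.
rewrite negb_exists => /forallP xn.
have xp j : 0 < lpn (r j) (x j) by rewrite lt0r xn lpn_ge0.
pose y j : vec := [ffun i => (lpn (r j) (x j))^-1 * x j i].
have y1 j : lpn (r j) (y j) = 1.
  by rewrite lpnZ// ger0_norm ?invr_ge0 ?lpn_ge0// mulVf.
have := holder_normalized r0 y1; rewrite -/c.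
rewrite -ler_pdivrMr ?prodr_gt0//; apply: le_trans.
rewrite mulr_suml; apply: ler_sum => i _; rewrite -prodf_div; apply: ler_prod => j _.
rewrite divr_ge0 ?lpn_ge0//= ffunE normrM ger0_norm ?invr_ge0 ?lpn_ge0//.
by rewrite mulrC.
Qed.

End Holder.

Section InradiusUpper.
Variables (R : realType) (k n : nat).
Hypotheses (k0 : (0 < k)%N) (n0 : (0 < n)%N).
Local Notation vec := {ffun 'I_n -> R}.
Local Notation idx := {ffun 'I_k -> 'I_n}.
Local Notation arr := {ffun idx -> R}.
Local Notation pnr r := (@pn R k n (fun j => lpn (r j))).

Lemma inradius_le1 (r : 'I_k -> R) (s : R) : (forall j, 0 <= r j) ->
  (forall u : arr, \sum_I u I ^+ 2 <= 1 -> pnr r [ffun I => s * u I] <= 1) -> s <= 1.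
Proof.
move=> r0 h; pose I0 : idx := [ffun=> Ordinal n0].
pose u : arr := [ffun I => (I == I0)%:R].
have u1 : \sum_I u I ^+ 2 <= 1.
  rewrite (bigD1 I0)//= ffunE eqxx big1 ?addr0 ?expr1n// => I /negPf ne.
  by rewrite ffunE ne expr0n.
have := @le_pn R k n (fun j => lpn (r j)) [ffun I => s * u I] I0 k0 _.
rewrite !ffunE eqxx mulr1 => H; apply: le_trans (ler_norm _) (le_trans (H _) (h _ u1)).
by move=> j x i; apply: le_lpn.
Qed.

Lemma inradius_diag (r : 'I_k -> R) (s : R) : (forall j, 0 <= r j) -> 0 <= s ->
  (forall u : arr, \sum_I u I ^+ 2 <= 1 -> pnr r [ffun I => s * u I] <= 1) ->
  s <= n%:R `^ (Num.max (1 - \sum_j r j) 0 - 2^-1).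
Proof.
move=> r0 s0 h; have nn0 : 0 < n%:R :> R by rewrite ltr0n.
pose dg (i : 'I_n) : idx := [ffun=> i].
have dginj : injective dg by move=> i i' /ffunP/(_ (Ordinal k0)); rewrite !ffunE.
pose psi (I : idx) : R := \sum_i (I == dg i)%:R.
have psiE (F : idx -> R) : \sum_I psi I * F I = \sum_i F (dg i).
  under eq_bigr do rewrite mulr_suml.
  rewrite exchange_big /=; apply: eq_bigr => i _.
  by rewrite (bigD1 (dg i))//= eqxx mul1r big1 ?addr0// => I /negPf->; rewrite mul0r.
have psi1 i : psi (dg i) = 1.
  rewrite /psi (bigD1 i)//= eqxx big1 ?addr0// => i' ne.
  by rewrite (inj_eq dginj) eq_sym (negPf ne).
have psi2 : \sum_I psi I * psi I = n%:R.
  by rewrite psiE; under eq_bigr do rewrite psi1; rewrite sumr_const card_ord.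
pose q := Num.sqrt n%:R : R.
have q0 : 0 < q by rewrite sqrtr_gt0.
have q2 : q * q = n%:R by rewrite -expr2 sqr_sqrtr// ltW.
(* The normalised diagonal: [psi] takes the value [s * q] at [s * u], with [q] the root of [n]. This
   is where the exponent -1/2 comes from. *)
pose u : arr := [ffun I => q^-1 * psi I].
have u1 : \sum_I u I ^+ 2 <= 1.
  under eq_bigr do rewrite ffunE exprMn [psi _ ^+ 2]expr2.
  by rewrite -mulr_sumr psi2 exprVn expr2 q2 mulVf ?gt_eqF.
have e0 := powR_ge0 n%:R (Num.max (1 - \sum_j r j) 0).
have := @pn_functional R k n (fun j => lpn (r j)) psi _ k0 (fun j x => lpn_ge0 _ _) e0 _
  [ffun I => s * u I].
have -> : \sum_I psi I * [ffun I0 => s * u I0] I = s * q.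
  under eq_bigr do rewrite ffunE [u _]ffunE mulrCA [psi _ * _]mulrCA mulrA.
  by rewrite -mulr_sumr psi2 -mulrA -q2 mulKf ?gt_eqF.
rewrite ger0_norm ?mulr_ge0 ?(ltW q0)// => H.
rewrite powRB ?(gt_eqF nn0) ?implybT// powR12_sqrt ?(ltW nn0)// ler_pdivlMr//.
apply: le_trans (H _) _.
  move=> x; rewrite psiE; apply: le_trans (ler_norm_sum _ _ _) _.
  apply: le_trans (holder n0 x r0); apply: ler_sum => i _; rewrite ffunE normr_prod.
  by rewrite le_eqVlt; apply/orP; left; apply/eqP; apply: eq_bigr => j _; rewrite ffunE.
by rewrite ler_piMr// h.
Qed.

End InradiusUpper.

(** * Covering the unit ball by cubes *)

Section Tangent.
Variables (R : realType) (q : R).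
Hypothesis q12 : 1 <= q <= 2.

(** Bernoulli's inequality for the exponent [q - 1], which lies in [0, 1]. Keeping the factor [u]
    outside makes the error quadratic in [u - 1]. *)
Lemma powR_bernoulli (u : R) : 0 <= u -> u `^ q <= u * (1 + (q - 1) * (u - 1)).
Proof.
move=> u0; case/andP: q12 => q1 q2.
have -> : u `^ q = u * u `^ (q - 1) by rewrite mulr_powRB1// (lt_le_trans ltr01).
rewrite ler_wpM2l//.
have := @weighted_AMGM2 R (q - 1) u 1 _ u0 ler01.
rewrite powR1 mulr1 mulr1 => h; apply: le_trans (h _) _; first by apply/andP; lra.
lra.
Qed.

(** For |t| <= 1 the error is quadratic and t^2 <= |t|^q because q <= 2. For larger |t| the crude
    bound by (2 |t|)^q is enough, whence the constant 4 = 2^2. *)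
Lemma powR_tangent1 (t : R) : `|1 + t| `^ q <= 1 + q * t + 4 * `|t| `^ q.
Proof.
case/andP: q12 => q1 q2.
have q0 : 0 < q by lra.
have [tl|tu] := ltP t (- 1).
  have -> : `|1 + t| = - t - 1 by rewrite ltr0_norm; lra.
  have tE : `|t| = - t by rewrite ltr0_norm; lra.
  have h1 : (- t - 1) `^ q <= `|t| `^ q.
    by rewrite ge0_ler_powR ?nnegrE ?(ltW q0)//; lra.
  have h2 : `|t| <= `|t| `^ q by apply: le1r_powR => //; lra.
  have : - (q * t) <= 2 * `|t| by rewrite -mulrN -tE ler_wpM2r.
  have := normr_ge0 t.
  lra.
have u0 : 0 <= 1 + t by lra.
rewrite ger0_norm//.
have [t1|t1] := leP `|t| 1.
  have h := powR_bernoulli u0.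
  have h2 : t ^+ 2 <= `|t| `^ q.
    have [->|tn] := eqVneq t 0; first by rewrite expr0n powR_ge0.
    rewrite -real_normK ?num_real// -powR_mulrn//.
    by apply: ger_powR => //; rewrite normr_gt0 tn.
  have e : (1 + t) * (1 + (q - 1) * (1 + t - 1)) = 1 + q * t + (q - 1) * t ^+ 2 by ring.
  have h3 : (q - 1) * t ^+ 2 <= 1 * `|t| `^ q.
    by apply: ler_pM => //; rewrite ?sqr_ge0//; lra.
  have := powR_ge0 `|t| q; rewrite e in h; lra.
have tp : 1 < t by move: t1; case: (ger0P t) => //; lra.
rewrite gtr0_norm; last lra.
have h1 : (1 + t) `^ q <= (2 * t) `^ q by rewrite ge0_ler_powR ?nnegrE ?(ltW q0)//; lra.
have h2 : (2 * t) `^ q = 2 `^ q * t `^ q by rewrite powRM//; lra.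
have h3 : 2 `^ q <= 4 :> R.
  have -> : 4 = 2 `^ 2 :> R by rewrite powR_mulrn//; ring.
  by apply: ler_powR => //; lra.
have h4 : 2 `^ q * t `^ q <= 4 * t `^ q by rewrite ler_wpM2r ?powR_ge0.
have : 0 <= q * t by rewrite mulr_ge0; lra.
lra.
Qed.

(** The derivative of |a|^q divided by q, that is, the duality map of l_q. The sign makes it 0 at 0
    even for q = 1. *)
Definition duality (a : R) : R := Num.sg a * `|a| `^ (q - 1).

Lemma powR_tangent (a b : R) :
  `|a + b| `^ q <= `|a| `^ q + q * duality a * b + 4 * `|b| `^ q.
Proof.
case/andP: q12 => q1 q2; have q0 : 0 < q by lra.
have [->|an] := eqVneq a 0.
  rewrite /duality sgr0 add0r normr0 powR0 ?gt_eqF// mul0r mulr0 mul0r !add0r.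
  rewrite ler_peMl ?powR_ge0//; lra.
have ap : 0 < `|a| by rewrite normr_gt0.
have -> : a + b = a * (1 + b / a) by rewrite mulrDr mulr1 mulrCA divff// mulr1.
rewrite normrM powRM//; have h := powR_tangent1 (b / a).
apply: le_trans (ler_wpM2l (powR_ge0 _ _) h) _.
rewrite le_eqVlt; apply/orP; left; apply/eqP.
have e1 : `|a| `^ q * `|b / a| `^ q = `|b| `^ q.
  by rewrite -powRM// -normrM mulrCA divff// mulr1.
have e2 : `|a| `^ q / a = duality a.
  rewrite /duality -(mulr_powRB1 (ltW ap) q0) mulrAC; congr (_ * _).
  by rewrite {2}[a]numEsg invfM mulrCA divff ?normr_eq0// mulr1 invr_sg.
have -> : `|a| `^ q * (1 + q * (b / a) + 4 * `|b / a| `^ q) =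
  `|a| `^ q + q * (`|a| `^ q / a) * b + 4 * (`|a| `^ q * `|b / a| `^ q) by ring.
by rewrite e1 e2.
Qed.

Lemma dualityE (a : R) : duality a * a = `|a| `^ q.
Proof.
case/andP: q12 => q1 q2; have q0 : 0 < q by lra.
by rewrite /duality mulrAC -normrEsg mulr_powRB1.
Qed.

(** Young's inequality, written with 1 - 1/q for the reciprocal of the dual exponent so that q = 1
    is included. *)
Lemma duality_young (a b : R) :
  duality a * b <= (1 - q^-1) * `|a| `^ q + q^-1 * `|b| `^ q.
Proof.
case/andP: q12 => q1 q2; have q0 : 0 < q by lra.
have t01 : 0 <= q^-1 <= 1 by rewrite invr_ge0 ltW//= invf_le1.
have := @weighted_AMGM2 R q^-1 (`|b| `^ q) (`|a| `^ q) t01 (powR_ge0 _ _) (powR_ge0 _ _).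
rewrite [X in _ <= X]addrC; apply: le_trans.
rewrite -!powRrM mulfV ?gt_eqF// powRr1// mulrBr mulr1 mulfV ?gt_eqF//.
rewrite (le_trans (ler_norm _))// /duality normrM normrM mulrC ler_wpM2l//.
rewrite [`|_ `^ _|]ger0_norm ?powR_ge0// ler_piMl ?powR_ge0// normr_sg.
by case: (a == 0).
Qed.

Lemma powRD_le (a b : R) : `|a - b| `^ q <= 4 * (`|a| `^ q + `|b| `^ q).
Proof.
case/andP: q12 => q1 q2; have q0 : 0 < q by lra.
wlog ab : a b / `|b| <= `|a|.
  move=> h; have [/h//|/ltW/h] := leP `|b| `|a|.
  by rewrite distrC [X in _ -> _ <= _ * X]addrC.
apply: (@le_trans _ _ ((2 * `|a|) `^ q)).
  rewrite ge0_ler_powR ?nnegrE ?mulr_ge0 ?(ltW q0)//.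
  apply: le_trans (ler_normB _ _) _; lra.
rewrite powRM//; apply: ler_pM; rewrite ?powR_ge0//.
  have -> : 4 = 2 `^ 2 :> R by rewrite powR_mulrn//; ring.
  by apply: ler_powR => //; lra.
by rewrite lerDl powR_ge0.
Qed.

End Tangent.

(** * Integer grids and their cardinality *)

Section IntegerGrid.
Variable R : realType.

(** Sign and magnitude, so that the l_1 norm of an integer vector is a sum of natural numbers. Zero
    has two codes, which only enlarges the grids. *)
Definition ival (z : bool * nat) : R := (-1) ^+ z.1 * z.2%:R.

Lemma normr_ival z : `|ival z| = z.2%:R.
Proof. by rewrite /ival normrM normrX normrN1 expr1n mul1r normr_nat. Qed.

Lemma ival_floor (t : R) :
  exists2 z, ival z <= t <= ival z + 1 & z.2%:R <= `|t| + 1.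
Proof.
have [t0|t0] := leP 0 t.
  have /andP[h1 h2] := truncn_itv t0; exists (false, Num.truncn t); rewrite /ival /= ?expr0 ?mul1r.
    by rewrite h1 natr1 ltW.
  by rewrite ger0_norm//; lra.
have t1 : 0 <= - t by lra.
have /andP[h1 h2] := truncn_itv t1; exists (true, (Num.truncn (- t)).+1).
  by rewrite /ival /= expr1 mulN1r -natr1; rewrite -natr1 in h2; lra.
by rewrite /= ltr0_norm// -natr1; lra.
Qed.

(** The sign of [c] decides between rounding up and rounding down: [c] will be a coefficient of a
    linear form whose value must not decrease. *)
Lemma ival_round (t c : R) :
  exists2 z, c * t <= c * ival z & z.2%:R <= `|t| + 1.
Proof.
have [c0|c0] := leP 0 c.
  have [[b m] /andP[h1 h2] h3] := ival_floor (- t); exists (~~ b, m) => /=.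
    apply: ler_wpM2l => //; move: h1; rewrite /ival /=.
    by case: b {h2 h3}; rewrite /= ?expr0 ?expr1; lra.
  by rewrite normrN in h3.
have [z /andP[h1 h2] h3] := ival_floor t; exists z => //.
by rewrite ler_wnM2l// ltW.
Qed.

Definition grid (I : finType) (M : nat) : {set {ffun I -> bool * 'I_M.+1}} :=
  [set z : {ffun I -> bool * 'I_M.+1} | (\sum_i (z i).2 <= M)%N].

Definition gval (I : finType) (M : nat) (z : {ffun I -> bool * 'I_M.+1}) : {ffun I -> R} :=
  [ffun i => ival ((z i).1, val (z i).2)].

Lemma geometric_le2 (m : nat) : \sum_(t < m) 2^-1 ^+ t <= 2 :> R.
Proof.
have -> : \sum_(t < m) 2^-1 ^+ t = 2 - 2 * 2^-1 ^+ m :> R.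
  elim: m => [|m IH]; first by rewrite big_ord0 expr0; ring.
  by rewrite big_ord_recr /= IH exprS; field.
by rewrite gerBl mulr_ge0// exprn_ge0// invr_ge0.
Qed.

(** Give a point the weight 2^(-l), l its l_1 norm. Points of the grid weigh at least 2^(-M), while
    the total weight factors over the coordinates, each contributing at most 4: a geometric sum for
    each of two signs. *)
Lemma card_grid (I : finType) (M : nat) :
  #|grid I M|%:R <= 4 ^+ #|I| * 2 ^+ M :> R.
Proof.
have h2 : 0 < 2^-1 ^+ M :> R by rewrite exprn_gt0// invr_gt0.
rewrite -[2 ^+ M]invrK -exprVn ler_pdivlMr// mulr_natl -sumr_const.
apply: (@le_trans _ _ (\sum_(z in grid I M) \prod_i 2^-1 ^+ (z i).2)).
  apply: ler_sum => z; rewrite inE => hz; rewrite prodrXr.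
  by apply: ler_wiXn2l => //; rewrite ?invr_ge0// invf_le1// ler1n.
apply: (@le_trans _ _ (\sum_(z : {ffun I -> bool * 'I_M.+1}) \prod_i 2^-1 ^+ (z i).2)).
  rewrite [leRHS](bigID (mem (grid I M))) /= lerDl.
  by apply: sumr_ge0 => z _; apply: prodr_ge0 => i _; rewrite exprn_ge0// invr_ge0.
rewrite -(bigA_distr_bigA (fun (_ : I) (t : bool * 'I_M.+1) => 2^-1 ^+ t.2 : R)).
rewrite prodr_const; apply: lerXn2r; rewrite ?nnegrE//.
  by apply: sumr_ge0 => z _; rewrite exprn_ge0// invr_ge0.
rewrite -(pair_bigA _ (fun (_ : bool) (t : 'I_M.+1) => 2^-1 ^+ t : R)) /=.
rewrite big_bool /=; have := geometric_le2 M.+1; lra.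
Qed.

Lemma grid_bounded (I : finType) (M : nat) (m : I -> bool * nat) :
  \sum_i (m i).2%:R <= M%:R :> R ->
  exists2 z : {ffun I -> bool * 'I_M.+1}, z \in grid I M & gval z = [ffun i => ival (m i)].
Proof.
rewrite -natr_sum ler_nat => hm.
have mM i : ((m i).2 < M.+1)%N.
  by rewrite ltnS; apply: leq_trans hm; rewrite (bigD1 i)//= leq_addr.
exists [ffun i => ((m i).1, Ordinal (mM i))].
  by rewrite inE; under eq_bigr do rewrite ffunE.
by apply/ffunP => i; rewrite !ffunE /=; case: (m i).
Qed.

End IntegerGrid.

(** In units of the side of the cubes, the powers |X_i|^q sum to at most N. A floor has magnitude at
    most |X_i| + 1 <= |X_i|^q + 2, so the floors have l_1 norm at most 3N, and 4^N 2^(3N) = 32^N. *)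
Lemma lq_cover (R : realType) (q : R) (I : finType) (s : R) :
  1 <= q -> (0 < #|I|)%N -> 0 < s ->
  exists2 F : seq {ffun I -> R}, (size F)%:R <= (32 : R) ^+ #|I| &
    forall X : {ffun I -> R}, \sum_i `|X i| `^ q <= s `^ q ->
      exists2 c, c \in F & forall i, c i <= X i <= c i + s * #|I|%:R `^ (- q^-1).
Proof.
move=> q1 I0 s0; set N := #|I|; have NN : 0 < N%:R :> R by rewrite ltr0n.
have q0 : 0 < q by apply: lt_le_trans q1.
set h := s * _; have h0 : 0 < h by rewrite mulr_gt0// powR_gt0.
pose M := (3 * N)%N.
exists [seq [ffun i => h * gval R z i] | z <- enum (grid I M)].
  rewrite size_map -cardE; apply: le_trans (card_grid R I M) _.
  by rewrite /M exprM -exprMn; apply: lerXn2r; rewrite ?nnegrE//; lra.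
move=> X hX.
have /boolp.choice[m hm] : forall i, exists z,
   ival R z <= h^-1 * X i <= ival R z + 1 /\ z.2%:R <= `|h^-1 * X i| + 1.
  by move=> i; have [z h1 h2] := ival_floor (h^-1 * X i); exists z.
have sE : \sum_i `|h^-1 * X i| `^ q <= N%:R.
  under eq_bigr do rewrite normrM powRM//.
  rewrite -mulr_sumr gtr0_norm ?invr_gt0// -powR_inv1 ?(ltW h0)// powRAC powR_inv1 ?powR_ge0//.
  rewrite ler_pdivrMl ?powR_gt0//; apply: le_trans hX _.
  rewrite /h powRM ?powR_ge0 ?(ltW s0)// -powRrM mulNr mulVf ?gt_eqF// powR_inv1 ?(ltW NN)//.
  by rewrite -mulrA mulVf ?gt_eqF// mulr1.
have mM : \sum_i (m i).2%:R <= M%:R :> R.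
  apply: (@le_trans _ _ (\sum_(i : I) (`|h^-1 * X i| `^ q + 2))).
    apply: ler_sum => i _; have [_ h2] := hm i; apply: le_trans h2 _.
    set t := `|_|; have [t1|t1] := leP t 1.
      by have := powR_ge0 t q; lra.
    have := le1r_powR (ltW t1) q1; lra.
  rewrite big_split /= sumr_const -/N /M natrM -[2 *+ N]mulr_natr; lra.

have [z zM zE] := grid_bounded mM.
exists [ffun i => h * gval R z i]; first by apply: map_f; rewrite mem_enum.
move=> i; rewrite ffunE zE ffunE; have [/andP[h1 h2] _] := hm i.
rewrite ler_pdivlMl// in h1; rewrite ler_pdivrMl// mulrDr mulr1 in h2.
by rewrite h1 h2.
Qed.

(** * Rounding the factors of elementary tensors *)

Section Rounding.
Variables (R : realType) (k n L : nat) (r : 'I_k -> R).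
Hypotheses (k0 : (0 < k)%N) (n0 : (0 < n)%N).
Hypothesis r01 : forall j, 0 <= r j <= 1.
Hypothesis hL : forall j, 2 * 2 `^ (r j)^-1 <= L%:R.
Local Notation vec := {ffun 'I_n -> R}.
Local Notation idx := {ffun 'I_k -> 'I_n}.
Local Notation arr := {ffun idx -> R}.
Local Notation pnr := (@pn R k n (fun j => lpn (r j))).
Local Notation M := (L * n)%N.
Local Notation gridvec := {ffun 'I_n -> bool * 'I_M.+1}.

Let r0 j : 0 <= r j.
Proof. by case/andP: (r01 j). Qed.

Let nn0 : 0 < n%:R :> R.
Proof. by rewrite ltr0n. Qed.

(** The mesh [n ^ (- r j)] is the size of the coordinates of a flat unit vector, so a unit vector
    becomes an integer vector of l_1 norm of order [n]. *)
Definition scaled_grid (j : 'I_k) (z : gridvec) : vec :=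
  [ffun i => n%:R `^ (- r j) * gval R z i].

Definition grid_tensors : {set {ffun 'I_k -> gridvec}} :=
  [set w : {ffun 'I_k -> gridvec} |
     [forall j, (w j \in grid 'I_n M) && (lpn (r j) (scaled_grid j (w j)) <= 4)]].

Definition grid_tensor (w : {ffun 'I_k -> gridvec}) : arr :=
  elementary_tensor (fun j => scaled_grid j (w j)).

Lemma card_grid_tensors :
  #|grid_tensors|%:R <= (4 * 2 ^+ L) ^+ (n * k) :> R.
Proof.
apply: (@le_trans _ _ (#|grid 'I_n M| ^ k)%N%:R).
  rewrite ler_nat -[X in (_ <= _ ^ X)%N](card_ord k) -card_ffun_on.
  apply/subset_leq_card/fintype.subsetP => w; rewrite inE => /forallP h.
  by apply/ffun_onP => j; case/andP: (h j).
rewrite natrX exprM; apply: lerXn2r; rewrite ?nnegrE ?exprn_ge0 ?mulr_ge0 ?exprn_ge0//.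
by apply: le_trans (card_grid R _ _) _; rewrite card_ord exprMn exprM.
Qed.

Lemma zero_grid_tensor : [ffun=> [ffun=> (false, ord0)]] \in grid_tensors.
Proof.
have z0 (j : 'I_k) : scaled_grid j [ffun=> (false, ord0)] = [ffun=> 0].
  by apply/ffunP => i; rewrite !ffunE /ival /= mulr0 mulr0.
rewrite inE; apply/forallP => j; rewrite ffunE inE; apply/andP; split.
  by rewrite big1// => i _; rewrite ffunE.
have := @lpnZ R n (r j) 0 [ffun=> 0] (r0 j); rewrite normr0 mul0r z0 => h.
rewrite [X in lpn _ X](_ : _ = [ffun i => 0 * [ffun=> 0] i]) ?h//.
by apply/ffunP => i; rewrite !ffunE mul0r.
Qed.

(** After scaling, the powers 1/r_j of the coordinates sum to at most [n], and rounding moves each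
    by at most 1. This controls the norm of the rounded vector and, since integers do not exceed
    their powers of exponent 1/r_j >= 1, also its l_1 norm. *)
Lemma round_vector (j : 'I_k) (x : vec) (c : 'I_n -> R) : lpn (r j) x <= 1 ->
  exists2 z : gridvec, (z \in grid 'I_n M) && (lpn (r j) (scaled_grid j z) <= 4) &
    \sum_i c i * x i <= \sum_i c i * scaled_grid j z i.
Proof.
move=> x1; pose t i := n%:R `^ r j * x i.
have /boolp.choice[m hm] : forall i, exists z,
   c i * t i <= c i * ival R z /\ z.2%:R <= `|t i| + 1.
  by move=> i; have [z h1 h2] := ival_round (t i) (c i); exists z.
have nt i : `|t i| = n%:R `^ r j * `|x i| by rewrite normrM ger0_norm ?powR_ge0.
(* For [r j = 0] the norm is a maximum and [(r j)^-1] is 0 by convention; the rounded magnitudes are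
   then at most 2. *)
have hm0 : r j = 0 -> forall i, (m i).2%:R <= 2 :> R.
  move=> rj i; have [_ h] := hm i; apply: le_trans h _; rewrite nt rj powRr0 mul1r.
  have := le_lpn x i (r0 j); lra.
have hmS : 0 < r j -> \sum_i (m i).2%:R `^ (r j)^-1 <= 2 * 2 `^ (r j)^-1 * n%:R.
  move=> rj; have rV0 : 0 <= (r j)^-1 by rewrite invr_ge0.
  apply: (@le_trans _ _ (\sum_i 2 `^ (r j)^-1 * (n%:R * `|x i| `^ (r j)^-1 + 1))).
    apply: ler_sum => i _; have [_ h] := hm i.
    have -> : n%:R * `|x i| `^ (r j)^-1 = `|t i| `^ (r j)^-1.
      by rewrite nt powRM ?powR_ge0// -powRrM mulfV ?gt_eqF// powRr1// ltW.
    have := normr_ge0 (t i); move: h; set y := `|t i| => h y0.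
    apply: (@le_trans _ _ ((2 * Num.max y 1) `^ (r j)^-1)).
      rewrite ge0_ler_powR ?nnegrE ?mulr_ge0 ?le_max ?y0//.
      apply: le_trans h _; case: (leP y 1) => hy; lra.
    rewrite powRM ?le_max ?y0// ler_wpM2l ?powR_ge0//.
    by case: (leP y 1) => hy; rewrite ?powR1 ?lerDl ?lerDr// powR_ge0.
  rewrite -mulr_sumr big_split /= sumr_const card_ord -mulr_sumr lpn_sum//.
  have -> : 2 * 2 `^ (r j)^-1 * n%:R = 2 `^ (r j)^-1 * (n%:R + n%:R) by ring.
  rewrite ler_wpM2l ?powR_ge0// lerD2r ler_piMr ?(ltW nn0)//.
  apply: (@le_trans _ _ (1 `^ (r j)^-1)); last by rewrite powR1.
  by apply: ge0_ler_powR; rewrite ?nnegrE ?lpn_ge0.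
have mM : \sum_i (m i).2%:R <= M%:R :> R.
  rewrite natrM; apply: (@le_trans _ _ (2 * 2 `^ (r j)^-1 * n%:R)); last by rewrite ler_wpM2r.
  have [rj|rj] := eqVneq (r j) 0.
    rewrite rj invr0 powRr0 mulr1; apply: (@le_trans _ _ (\sum_(i < n) 2)).
      by apply: ler_sum => i _; apply: hm0.
    by rewrite sumr_const card_ord mulr_natr.
  have rp : 0 < r j by rewrite lt0r rj r0.
  apply: le_trans (hmS rp); apply: ler_sum => i _.
  case: ((m i).2) => [|l]; first by rewrite powR_ge0.
  by apply: le1r_powR; rewrite ?ler1n// invf_ge1//; case/andP: (r01 j).
have [z zM zE] := grid_bounded mM; exists z.
  rewrite zM /=; have [rj|rj] := eqVneq (r j) 0.
    rewrite rj; apply/lpn0_leP => // i; rewrite ffunE zE ffunE rj oppr0 powRr0 mul1r.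
    rewrite normr_ival; apply: le_trans (hm0 rj i) _; lra.
  have rp : 0 < r j by rewrite lt0r rj r0.
  rewrite lpn_leE//.
  have -> : \sum_i `|scaled_grid j z i| `^ (r j)^-1 = n%:R^-1 * \sum_i (m i).2%:R `^ (r j)^-1.
    rewrite mulr_sumr; apply: eq_bigr => i _; rewrite ffunE zE ffunE normrM normr_ival.
    rewrite powRM// ger0_norm ?powR_ge0// -powRrM mulNr mulfV ?gt_eqF//.
    by rewrite powR_inv1 ?(ltW nn0).
  rewrite ler_pdivrMl// mulrC; apply: le_trans (hmS rp) _.
  (* The origin of the bound 4: one factor 2 is absorbed because 2 <= 2^(1/r_j). *)
  have -> : 4 = 2 * 2 :> R by ring.
  rewrite powRM// ler_wpM2r ?(ltW nn0)// ler_wpM2r ?powR_ge0//.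
  by apply: le1r_powR; rewrite ?ler1n// invf_ge1//; case/andP: (r01 j).
apply: ler_sum => i _; rewrite ffunE zE ffunE.
have [h _] := hm i; rewrite mulrCA -ler_pdivrMl ?powR_gt0//.
by rewrite -powRN opprK mulrCA.
Qed.

(* A multilinear form is affine in each coordinate of each factor, so its
   maximum over the unit balls is dominated by its values on rounded vectors. *)
Lemma dominate_elementary (psi : idx -> R) (x : 'I_k -> vec) :
  (forall j, lpn (r j) (x j) <= 1) ->
  exists2 w, w \in grid_tensors &
    \sum_I psi I * elementary_tensor x I <= \sum_I psi I * grid_tensor w I.
Proof.
move=> x1.
suff H b : (b <= k)%N -> exists2 w, w \in grid_tensors &
    \sum_I psi I * elementary_tensor x I <=
    \sum_I psi I * elementary_tensor
      (fun j => if (j < b)%N then scaled_grid j (w j) else x j) I.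
  have [w wW h] := H k (leqnn k); exists w => //; apply: le_trans h _.
  rewrite le_eqVlt; apply/orP; left; apply/eqP; apply: eq_bigr => I _.
  by congr (_ * elementary_tensor _ I); apply/funext => j; rewrite ltn_ord.
elim: b => [|b IH] bk.
  by exists [ffun=> [ffun=> (false, ord0)]] => //; apply: zero_grid_tensor.
have [w wW h] := IH (ltnW bk).
pose jb : 'I_k := Ordinal bk.
pose v (j : 'I_k) := if (j < b)%N then scaled_grid j (w j) else x j.
(* The coefficients of the form in the factor [jb] when all other factors are frozen: the earlier
   ones already rounded, the later ones not yet. *)
pose c i := \sum_(I : idx | I jb == i) psi I * \prod_(j | j != jb) v j (I j).
have lin (u : 'I_k -> vec) : (forall j, j != jb -> u j = v j) ->
   \sum_I psi I * elementary_tensor u I = \sum_i c i * u jb i.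
  move=> uv; rewrite (partition_big (fun I : idx => I jb) predT)//=.
  apply: eq_bigr => i _; rewrite mulr_suml; apply: eq_bigr => I /eqP Ii.
  rewrite ffunE (bigD1 jb)//= Ii mulrCA mulrC; congr (_ * _ * _).
  by apply: eq_bigr => j jj; rewrite uv.
have [z zG hz] := round_vector c (x1 jb).
pose w' : {ffun 'I_k -> gridvec} := [ffun j => if j == jb then z else w j].
exists w'.
  rewrite inE; apply/forallP => j; rewrite ffunE; case: eqVneq => [->|_]; first exact: zG.
  by move: wW; rewrite inE => /forallP/(_ j).
apply: le_trans h _.
rewrite (lin (fun j => if (j < b)%N then scaled_grid j (w j) else x j))//.
rewrite (lin (fun j => if (j < b.+1)%N then scaled_grid j (w' j) else x j)); last first.
  move=> j jj; rewrite /v ffunE (negPf jj) ltnS leq_eqVlt.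
  by have -> : (j == b :> nat) = false by apply: contraNF jj => /eqP e; apply/eqP/val_inj.
by rewrite /= ltnn ltnSn ffunE eqxx.
Qed.

(** The maximum over the rounded tensors bounds the form on normalised elementary tensors, hence by
    [pn_functional] on the whole unit ball. *)
Lemma dominate (psi : idx -> R) (A : arr) : pnr A <= 1 ->
  exists2 w, w \in grid_tensors & \sum_I psi I * A I <= \sum_I psi I * grid_tensor w I.
Proof.
move=> A1; pose F w := \sum_I psi I * grid_tensor w I.
case: (@arg_maxP _ R _ _ (mem grid_tensors) F zero_grid_tensor) => w wW wmax.
exists w => //.
have upper (x : 'I_k -> vec) : (forall j, lpn (r j) (x j) <= 1) ->
    \sum_I psi I * elementary_tensor x I <= F w.
  by move=> x1; have [w' w'W h] := dominate_elementary psi x1; apply: le_trans h (wmax _ w'W).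
have lp00 (j : 'I_k) : lpn (r j) ([ffun=> 0] : vec) = 0.
  transitivity (lpn (r j) ([ffun i => 0 * ([ffun=> 0] : vec) i] : vec)).
    by congr lpn; apply/ffunP => i; rewrite !ffunE mul0r.
  by rewrite lpnZ// normr0 mul0r.
have Fw0 : 0 <= F w.
  have := upper (fun=> [ffun=> 0]); rewrite big1; last first.
    by move=> I _; rewrite ffunE (bigD1 (Ordinal k0))//= ffunE mul0r mulr0.
  by apply=> j; rewrite lp00.
have upper' (x : 'I_k -> vec) :
    \sum_I psi I * elementary_tensor x I <= F w * \prod_j lpn (r j) (x j).
  have [/existsP[j /eqP xj]|] := boolP [exists j, lpn (r j) (x j) == 0].
    rewrite big1 ?mulr_ge0 ?prodr_ge0// => [j' _|I _]; first exact: lpn_ge0.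
    by rewrite ffunE (bigD1 j)//= (lpn_eq0 (r0 j) xj) mul0r mulr0.
  rewrite negb_exists => /forallP xn.
  have xp j : 0 < lpn (r j) (x j) by rewrite lt0r xn lpn_ge0.
  pose y j : vec := [ffun i => (lpn (r j) (x j))^-1 * x j i].
  have := upper y _; rewrite -ler_pdivrMr ?prodr_gt0// => h; apply: le_trans (h _); last first.
    by move=> j; rewrite lpnZ// ger0_norm ?invr_ge0 ?lpn_ge0// mulVf.
  rewrite mulr_suml; apply: ler_sum => I _; rewrite -mulrA !ffunE -prodf_div.
  rewrite le_eqVlt; apply/orP; left; apply/eqP; congr (_ * _); apply: eq_bigr => j _.
  by rewrite ffunE mulrC.
have := @pn_functional R k n (fun j => lpn (r j)) psi (F w) k0 (fun j x => lpn_ge0 _ _) Fw0 _ A.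
move=> h; apply: le_trans (ler_norm _) (le_trans (h _) _); last by rewrite ler_piMr.
move=> x; rewrite ler_norml upper' andbT lerNl.
(* Changing the sign of one factor negates the tensor and keeps all norms, which gives the other
   half of the absolute value. *)
pose x' j : vec := [ffun i => (if j == Ordinal k0 then -1 else 1) * x j i].
have pE : \prod_j lpn (r j) (x' j) = \prod_j lpn (r j) (x j).
  by apply: eq_bigr => j _; rewrite lpnZ//; case: ifP; rewrite ?normrN normr1 mul1r.
rewrite -[X in _ <= _ * X]pE; apply: le_trans (upper' x').
rewrite elementaryZ -sumrN le_eqVlt; apply/orP; left; apply/eqP.
by apply: eq_bigr => I _; rewrite [in RHS]ffunE mulN1r mulrN.
Qed.

End Rounding.

Lemma prod_powR (R : realType) (I : Type) (s : seq I) (P : pred I) (a : I -> R) (q : R) :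
  (forall i, 0 <= a i) -> (\prod_(i <- s | P i) a i) `^ q = \prod_(i <- s | P i) a i `^ q.
Proof.
move=> a0; elim: s => [|i s IH]; first by rewrite !big_nil powR1.
by rewrite !big_cons; case: (P i); rewrite // powRM ?prodr_ge0// IH.
Qed.

(** * Approximation by averages in l_q *)

Section Greedy.
Variables (R : realType) (k n L : nat) (r : 'I_k -> R) (q : R).
Hypotheses (k0 : (0 < k)%N) (n0 : (0 < n)%N) (q12 : 1 <= q <= 2).
Hypothesis r01 : forall j, 0 <= r j <= 1.
Hypothesis hL : forall j, 2 * 2 `^ (r j)^-1 <= L%:R.
Local Notation vec := {ffun 'I_n -> R}.
Local Notation idx := {ffun 'I_k -> 'I_n}.
Local Notation arr := {ffun idx -> R}.
Local Notation pnr := (@pn R k n (fun j => lpn (r j))).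
Local Notation W := (grid_tensors n L r).
Local Notation T := (grid_tensor r).
Local Notation radius := (4 ^+ k * n%:R `^ (\sum_j Num.max (q^-1 - r j) 0) : R).

Let q0 : 0 < q.
Proof. by case/andP: q12 => q1 _; apply: lt_le_trans q1. Qed.

Let r0 j : 0 <= r j.
Proof. by case/andP: (r01 j). Qed.

Let radius0 : 0 < radius.
Proof. by rewrite mulr_gt0 ?exprn_gt0 ?powR_gt0 ?ltr0n. Qed.

(** The l_q norm is multiplicative on elementary tensors, and each rounded factor has norm at most 4
    before the comparison with l_q. *)
Lemma grid_tensor_lq w : w \in W -> \sum_I `|T w I| `^ q <= radius `^ q.
Proof.
rewrite inE => /forallP h.
under eq_bigr do rewrite ffunE normr_prod prod_powR//.
rewrite -(bigA_distr_bigA (fun (j : 'I_k) i => `|scaled_grid r j (w j) i| `^ q)) /=.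
have -> : radius = \prod_j (n%:R `^ Num.max (q^-1 - r j) 0 * 4).
  by rewrite big_split /= prodr_const card_ord powR_prod ?ltr0n// mulrC.
rewrite prod_powR; last by move=> j; rewrite mulr_ge0 ?powR_ge0.
apply: ler_prod => j _; rewrite sumr_ge0; last by move=> *; apply: powR_ge0.
have := @lpn_sum R n q^-1 (scaled_grid r j (w j)); rewrite invr_gt0 invrK => -> //=.
rewrite ge0_ler_powR ?nnegrE ?lpn_ge0 ?mulr_ge0 ?powR_ge0 ?(ltW q0)//.
have /andP[_ h4] := h j.
apply: le_trans (lpn_compare _ n0 _ (r0 j)) _; first by rewrite invr_ge0 ltW.
by rewrite ler_wpM2l ?powR_ge0.
Qed.

Lemma dominate_duality (a A : arr) : pnr A <= 1 ->
  exists2 w, w \in W & \sum_I duality q (a I) * A I <= \sum_I duality q (a I) * T w I.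
Proof. exact: dominate. Qed.

(** Test [A] against its own duality map: a grid tensor does at least as well, and Young's
    inequality lets the l_q norm of [A] be absorbed on the left. *)
Lemma projective_ball_lq (A : arr) : pnr A <= 1 -> \sum_I `|A I| `^ q <= radius `^ q.
Proof.
move=> A1; have [w wW h] := dominate_duality A A1.
apply: le_trans (grid_tensor_lq wW).
have h2 : \sum_I duality q (A I) * T w I <=
    (1 - q^-1) * (\sum_I `|A I| `^ q) + q^-1 * \sum_I `|T w I| `^ q.
  by rewrite !mulr_sumr -big_split /=; apply: ler_sum => I _; apply: duality_young.
have h3 : \sum_I duality q (A I) * A I = \sum_I `|A I| `^ q.
  by apply: eq_bigr => I _; apply: dualityE.
rewrite h3 in h; rewrite -(ler_pM2l (_ : 0 < q^-1)) ?invr_gt0//; lra.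
Qed.

Definition greedy_sums (m : nat) : seq arr :=
  iter m (fun F => [seq c + T w | c <- F, w <- enum W]) [:: 0].

Lemma size_greedy_sums m : size (greedy_sums m) = (#|W| ^ m)%N.
Proof.
elim: m => [//|m IH]; rewrite /greedy_sums iterS size_allpairs -/(greedy_sums m) IH -cardE.
by rewrite expnSr.
Qed.

(* Maurey's empirical method, derandomised: each new summand is chosen so that
   the first-order term in the expansion of the l_q-norm does not increase. *)
Lemma greedy_approx (A : arr) (m : nat) : pnr A <= 1 ->
  exists2 c, c \in greedy_sums m &
    \sum_I `|m%:R * A I - c I| `^ q <= m%:R * (32 * radius `^ q).
Proof.
move=> A1; elim: m => [|m [c cS hc]].
  exists 0; first by rewrite inE.
  by rewrite mul0r big1// => I _; rewrite ffunE mul0r subr0 normr0 powR0 ?gt_eqF.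
pose a : arr := [ffun I => m%:R * A I - c I].
have [w wW hw] := dominate_duality a A1.
exists (c + T w); first by apply/allpairsP; exists (c, w); rewrite cS mem_enum wW.
(* The constant 16 is the 4 of [powR_tangent] times the 4 of [powRD_le]. As both [A] and the tensor
   have l_q norm at most the radius, each step adds 32 times its power. *)
have step I : `|m.+1%:R * A I - (c + T w) I| `^ q <=
    `|a I| `^ q + q * (duality q (a I) * (A I - T w I)) + 16 * (`|A I| `^ q + `|T w I| `^ q).
  have -> : m.+1%:R * A I - (c + T w) I = a I + (A I - T w I).
    by rewrite [(c + _) _]ffunE [a I]ffunE -natr1; ring.
  apply: le_trans (powR_tangent q12 _ _) _.
  have := powRD_le q12 (A I) (T w I); rewrite mulrA; lra.
apply: le_trans (ler_sum _ (fun I _ => step I)) _.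
rewrite !big_split /= -!mulr_sumr big_split /=.
have hA := projective_ball_lq A1; have hT := grid_tensor_lq wW.
have ha : \sum_I `|a I| `^ q <= m%:R * (32 * radius `^ q).
  by under eq_bigr do rewrite ffunE.
have hd : \sum_I duality q (a I) * (A I - T w I) <= 0.
  by under eq_bigr do rewrite mulrBr; rewrite sumrB subr_le0.
have hq : q * (\sum_I duality q (a I) * (A I - T w I)) <= 0 by rewrite pmulr_rle0.
rewrite -natr1 mulrDl mul1r; lra.
Qed.

End Greedy.

Lemma projective_ball_cover (R : realType) (k : nat) (r : 'I_k -> R) (q : R) :
  (0 < k)%N -> 1 <= q <= 2 -> (forall j, 0 <= r j <= 1) ->
  exists2 C : R, 0 < C & forall n, (0 < n)%N ->
    exists2 F : seq {ffun {ffun 'I_k -> 'I_n} -> R}, (size F)%:R <= C ^+ (n ^ k) &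
      forall A, pn (fun j => lpn (r j)) A <= 1 ->
        exists2 c, c \in F & forall I, c I <= A I <= c I +
          C * n%:R `^ (\sum_j Num.max (q^-1 - r j) 0 + k.-1%:R * (q^-1 - 1) - k%:R * q^-1).
Proof.
move=> k0 q12 r01; have [q1 q2] := andP q12; have q0 : 0 < q by apply: lt_le_trans q1.
(* The sum dominates each of its terms. A term with [r j = 0] is 2, the bound needed for the sup
   norm in [round_vector]. *)
pose L := (Num.truncn (\sum_j 2 * 2 `^ (r j)^-1)).+1.
have hL j : 2 * 2 `^ (r j)^-1 <= L%:R.
  have h0 (i : 'I_k) : 0 <= 2 * 2 `^ (r i)^-1 by rewrite mulr_ge0 ?powR_ge0.
  have /andP[_ /ltW] := truncn_itv (sumr_ge0 _ (fun i _ => h0 i) : 0 <= \sum_j 2 * 2 `^ (r j)^-1).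
  by apply: le_trans; rewrite (bigD1 j)//= lerDl sumr_ge0.
pose C1 := (4 * 2 ^+ L) ^+ k * 32 : R; pose C2 := 32 * 4 ^+ k : R.
have C1_1 : 1 <= C1.
  by rewrite /C1 mulr_ege1 ?exprn_ege1 ?mulr_ege1 ?exprn_ege1// ?ler1n.
have C2_0 : 0 < C2 by rewrite mulr_gt0// exprn_gt0.
exists (C1 + C2); first by rewrite ltr_wpDl// (le_trans ler01).
move=> n n0; have nn0 : 0 < n%:R :> R by rewrite ltr0n.
set radius := 4 ^+ k * n%:R `^ (\sum_j Num.max (q^-1 - r j) 0).
have radius0 : 0 < radius by rewrite mulr_gt0 ?exprn_gt0 ?powR_gt0.
(* The largest order allowed: there are C^(nk) rounded tensors, and nk * n^(k-1) = k N keeps the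
   number of averages exponential in the dimension. *)
pose m := (n ^ k.-1)%N; have m0 : 0 < m%:R :> R by rewrite ltr0n expn_gt0 n0.
(* The l_q distance from [A] to the average: the power [q] of the error is m * 32 * radius^q for the
   sum, and dividing by [m] brings m^(-q). *)
pose s := (32 * m%:R `^ (1 - q) * radius `^ q) `^ q^-1.
have s0 : 0 < s by rewrite powR_gt0// mulr_gt0 ?powR_gt0// mulr_gt0 ?powR_gt0.
have cardI : #|{: {ffun 'I_k -> 'I_n}}| = (n ^ k)%N by rewrite card_ffun !card_ord.
have I0 : (0 < #|{: {ffun 'I_k -> 'I_n}}|)%N by rewrite cardI expn_gt0 n0.
have [E Esz hE] := lq_cover q1 I0 s0.
pose shift (c e : {ffun {ffun 'I_k -> 'I_n} -> R}) : {ffun {ffun 'I_k -> 'I_n} -> R} :=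
  [ffun I => m%:R^-1 * c I] + e.
exists [seq shift c e | c <- greedy_sums n L r m, e <- E].
  rewrite size_allpairs natrM size_greedy_sums natrX.
  apply: (@le_trans _ _ (C1 ^+ (n ^ k))); last first.
    by apply: lerXn2r; rewrite ?nnegrE ?addr_ge0 ?lerDl ?(ltW C2_0)// (le_trans ler01).
  rewrite cardI in Esz; rewrite exprMn; apply: ler_pM => //.
  have -> : ((4 * 2 ^+ L) ^+ k) ^+ (n ^ k) = ((4 * 2 ^+ L) ^+ (n * k)) ^+ m :> R.
    by rewrite -!exprM -[in RHS]mulnA [(n * _)%N]mulnC -mulnA -expnSr prednK.
  by apply: lerXn2r; rewrite ?nnegrE ?exprn_ge0 ?mulr_ge0 ?exprn_ge0 ?card_grid_tensors.
move=> A A1; have [c cS hc] := greedy_approx k0 n0 q12 r01 hL m A1.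
pose X : {ffun {ffun 'I_k -> 'I_n} -> R} := [ffun I => A I - m%:R^-1 * c I].
have hX : \sum_I `|X I| `^ q <= s `^ q.
  have -> : \sum_I `|X I| `^ q = m%:R `^ (- q) * \sum_I `|m%:R * A I - c I| `^ q.
    rewrite mulr_sumr; apply: eq_bigr => I _; rewrite ffunE.
    have -> : A I - m%:R^-1 * c I = m%:R^-1 * (m%:R * A I - c I).
      by rewrite mulrBr mulKf// gt_eqF.
    by rewrite normrM powRM// gtr0_norm ?invr_gt0// -powR_inv1 ?(ltW m0)// -powRrM mulN1r.
  rewrite /s -powRrM mulVf ?gt_eqF// powRr1; last first.
    by rewrite mulr_ge0 ?powR_ge0// mulr_ge0 ?powR_ge0.
  apply: le_trans (ler_wpM2l (powR_ge0 _ _) hc) _.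
  rewrite le_eqVlt; apply/orP; left; apply/eqP.
  rewrite powRD ?(gt_eqF m0) ?implybT// powRr1 ?(ltW m0)//; ring.
have [e eE he] := hE X hX.
exists (shift c e); first by apply/allpairsP; exists (c, e).
move=> I; have := he I; rewrite !ffunE => /andP[h1 h2].
have sN : s * #|{: {ffun 'I_k -> 'I_n}}|%:R `^ (- q^-1) <= (C1 + C2) *
    n%:R `^ (\sum_j Num.max (q^-1 - r j) 0 + k.-1%:R * (q^-1 - 1) - k%:R * q^-1).
  apply: (@le_trans _ _ (C2 *
    n%:R `^ (\sum_j Num.max (q^-1 - r j) 0 + k.-1%:R * (q^-1 - 1) - k%:R * q^-1))); last first.
    by rewrite ler_wpM2r ?powR_ge0// lerDr (le_trans ler01).
  rewrite cardI natrX -powR_mulrn ?(ltW nn0)// -powRrM.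
  rewrite /s powRM ?mulr_ge0 ?powR_ge0// powRM ?powR_ge0// -!powRrM mulfV ?gt_eqF//.
  rewrite powRr1 ?(ltW radius0)// /m natrX -powR_mulrn ?(ltW nn0)// -powRrM.
  rewrite -mulrA -mulrA; set u := 32 `^ q^-1.
  have -> : C2 * n%:R `^ (\sum_j Num.max (q^-1 - r j) 0 + k.-1%:R * (q^-1 - 1) - k%:R * q^-1) =
     32 * (n%:R `^ (k.-1%:R * ((1 - q) * q^-1)) * (radius * n%:R `^ (k%:R * - q^-1))).
    rewrite /C2 /radius !powRD ?(gt_eqF nn0) ?implybT//.
    have -> : (1 - q) * q^-1 = q^-1 - 1 by rewrite mulrBl mul1r mulfV ?gt_eqF.
    by rewrite mulrN; ring.
  rewrite ler_wpM2r//.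
    by rewrite mulr_ge0 ?powR_ge0// mulr_ge0 ?powR_ge0// ltW.
  rewrite -[leRHS]powRr1//; apply: ler_powR; first by rewrite ler1n.
  by rewrite invf_le1.
apply/andP; split; first by rewrite -lerBrDl.
by rewrite -addrA -lerBlDl (le_trans h2)// lerD2l.
Qed.

(** * Volumes and ellipsoids *)

Section IntegralAux.
Local Open Scope classical_set_scope.
Variable R : realType.
Local Notation mu := (@lebesgue_measure R).
Local Open Scope ereal_scope.

(** The integral of a nonnegative function is a supremum over simple functions below it, so it is
    monotone for arbitrary functions. Sections of arbitrary sets call for this generality. *)
Lemma le_integral_ge0 (f g : R -> \bar R) : (forall x, 0 <= f x) -> (forall x, f x <= g x) ->
  \int[mu]_x f x <= \int[mu]_x g x.
Proof.
move=> f0 fg; have g0 x : 0 <= g x by apply: le_trans (fg x).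
rewrite !ge0_integralTE//; apply: le_ereal_sup => _ [h hf <-]; exists h => // x.
exact: le_trans (hf x) (fg x).
Qed.

(** Lebesgue measure is determined by its values on half-open intervals, and there the rescaled
    pushforward under the substitution agrees with it. *)
Lemma integral_affine (f : R -> \bar R) (c t : R) : (0 < t)%R ->
  measurable_fun setT f -> (forall x, 0 <= f x) ->
  \int[mu]_y f ((y - c) / t)%R = t%:E * \int[mu]_x f x.
Proof.
move=> t0 mf f0.
pose phi (y : R) : measurableTypeR R := ((y - c) / t)%R.
have mphi : measurable_fun setT phi.
  by apply: measurable_funM => //; apply: measurable_funB.
have tV0 : (0 <= t^-1)%R by rewrite invr_ge0 ltW.
have e A : measurable A -> mu A = mscale (NngNum tV0) (pushforward mu phi) A.
  move=> mA; apply/lebesgue_measure_unique => //= _ [[a b]] _ <-.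
  rewrite /mscale /= /pushforward.
  rewrite (_ : phi @^-1` _ = `](t * a + c)%R, (t * b + c)%R]%classic); last first.
    apply/seteqP; split => x; rewrite /phi /= !in_itv /= => /andP[h1 h2]; apply/andP; split.
    - by rewrite -ltrBrDr mulrC -ltr_pdivlMr.
    - by rewrite -lerBlDr mulrC -ler_pdivrMr.
    - by rewrite ltr_pdivlMr// mulrC ltrBrDr.
    - by rewrite ler_pdivrMr// mulrC lerBlDr.
  rewrite !lebesgue_measure_itv /= !lte_fin ltrD2r ltr_pM2l//.
  case: ifP => ab; last by rewrite mule0.
  rewrite -!EFinD -EFinM; congr (_%:E); field; exact: lt0r_neq0.
rewrite -[LHS]/(\int[mu]_(y in phi @^-1` setT) (f \o phi) y) -ge0_integral_pushforward//.
have e2 : \int[mu]_x f x = \int[mscale (NngNum tV0) (pushforward mu phi)]_x f x.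
  by move=> m; apply: eq_measure_integral => A mA _; apply: e.
rewrite (e2 mphi).
rewrite ge0_integral_mscale// muleA -EFinM mulfV ?gt_eqF// mul1e.
by [].
Qed.

End IntegralAux.

Lemma tnth_behead_tuple (T : Type) (N : nat) (c : N.+1.-tuple T) (i : 'I_N) :
  tnth (behead_tuple c) i = tnth c (lift ord0 i).
Proof. by rewrite !(tnth_nth (thead c)) /= nth_behead. Qed.

(** * Volumes by iterated integration *)

Section TupleVolume.
Local Open Scope classical_set_scope.
Variable R : realType.
Local Notation mu := (@lebesgue_measure R).
Local Notation TV := (@tuple_volume R _).
Local Open Scope ereal_scope.

Lemma tuple_volume_ge0 (N : nat) (A : set (N.-tuple R)) : 0 <= TV A.
Proof.
elim: N A => [|N IH] A /=; first exact: measure_ge0.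
by apply: integral_ge0 => x _; apply: IH.
Qed.

Lemma le_tuple_volume (N : nat) (A B : set (N.-tuple R)) : A `<=` B -> TV A <= TV B.
Proof.
elim: N A B => [|N IH] A B AB.
  rewrite /= !diracE lee_fin ler_nat; case: (boolP (_ \in A)) => //.
  by rewrite inE => /AB h; rewrite mem_set.
apply: le_integral_ge0 => x; first exact: tuple_volume_ge0.
by apply: IH => t /AB.
Qed.

Lemma tuple_volume0 (N : nat) : @tuple_volume R N set0 = 0.
Proof.
elim: N => [|N IH] /=; first by rewrite diracE in_set0.
rewrite -[RHS](@integral0 _ _ _ mu setT); apply: eq_integral => x _.
by rewrite -[RHS]IH; congr (TV _); apply/seteqP; split.
Qed.

Lemma integral_indicZ (a b v : R) : (a <= b)%R -> (0 <= v)%R ->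
  \int[mu]_x (v * \1_(`[a, b]%classic : set R) x)%:E = (v * (b - a))%:E.
Proof.
move=> ab v0; under eq_integral do rewrite EFinM.
rewrite ge0_integralZl//; last first.
  by apply/measurable_EFinP; apply: measurable_indic; apply: measurable_itv.
rewrite integral_indic ?setIT//=.
rewrite lebesgue_measure_itv /= lte_fin lt_neqAle ab andbT EFinM.
by case: eqP => //= ->; rewrite subrr mule0.
Qed.

Lemma tuple_volume_box (N : nat) (a b : R) : (a <= b)%R ->
  TV [set t : N.-tuple R | all (fun y => a <= y <= b)%R t] = ((b - a) ^+ N)%:E.
Proof.
move=> ab; elim: N => [|N IH].
  by rewrite /= diracE mem_set.
rewrite exprSr -integral_indicZ ?exprn_ge0 ?subr_ge0//=; apply: eq_integral => x _.
rewrite indicE mem_setE in_itv /=; have [xab|/negPf xab] := boolP (a <= x <= b)%R.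
  by rewrite mulr1 -IH; congr (TV _); apply/seteqP; split=> t /=; rewrite xab.
by rewrite mulr0 -[RHS](tuple_volume0 N); congr (TV _); apply/seteqP; split=> t //=; rewrite xab.
Qed.

(** A union bound by induction on the dimension: the section at [x] is covered by the sections of
    those boxes whose first side contains [x], and one integrates their number. *)
Lemma tuple_volume_boxes (N : nat) (h : R) (F : seq (N.-tuple R)) : (0 <= h)%R ->
  TV [set t : N.-tuple R | exists2 c, c \in F & forall i, (tnth c i <= tnth t i <= tnth c i + h)%R]
  <= ((size F)%:R * h ^+ N)%:E.
Proof.
move=> h0; elim: N F => [|N IH] F.
  rewrite /= mulr1 diracE lee_fin ler_nat.
  by case: (boolP (_ \in _)) => //; rewrite inE => -[c]; case: F.
pose Fx x := [seq behead_tuple c | c <- F & (thead c <= x <= thead c + h)%R].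
apply: (@le_trans _ _ (\int[mu]_x \sum_(c <- F)
    (h ^+ N * \1_(`[thead c, (thead c + h)%R]%classic : set R) x)%:E)); last first.
  rewrite ge0_integral_sum//; last 2 first.
  - by move=> c; apply/measurable_EFinP; apply: measurable_funM.
  - by move=> c x _; rewrite lee_fin mulr_ge0// exprn_ge0.
  under eq_bigr do rewrite integral_indicZ ?lerDl ?exprn_ge0// addrAC subrr add0r.
  by rewrite sumEFin lee_fin big_const_seq count_predT iter_addr_0 exprSr mulr_natl.
apply: le_integral_ge0 => x; first exact: tuple_volume_ge0.
apply: (@le_trans _ _ ((size (Fx x))%:R * h ^+ N)%:E).
  apply: le_trans (IH (Fx x)); apply: le_tuple_volume => t /= [c cF ct].
  exists (behead_tuple c).
    apply/mapP; exists c => //; rewrite mem_filter cF andbT.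
    by have := ct ord0; rewrite tnth0.
  by move=> i; have := ct (lift ord0 i); rewrite tnthS tnth_behead_tuple.
rewrite sumEFin lee_fin size_map size_filter -sum1_count natr_sum mulr_suml.
rewrite big_mkcond /=; apply: ler_sum => c _; rewrite indicE.
case: ifP => hc; last by rewrite mulr_ge0// exprn_ge0.
by rewrite mul1r mem_setE in_itv /= hc mulr1.
Qed.

(** The parameter is the squared radius, possibly negative, so that the section at x has parameter s
    - x^2. *)
Definition ball_volume (N : nat) (s : R) : \bar R :=
  TV [set t : N.-tuple R | (\sum_(x <- t) x ^+ 2 <= s)%R].

Lemma le_ball_volume (N : nat) (s s' : R) : (s <= s')%R -> ball_volume N s <= ball_volume N s'.
Proof. by move=> ss; apply: le_tuple_volume => t /= /le_trans; apply. Qed.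

Lemma ball_volume_fin (N : nat) (s : R) : ball_volume N s \is a fin_num.
Proof.
rewrite ge0_fin_numE ?tuple_volume_ge0//.
apply: (@le_lt_trans _ _ ((1 + `|s| - (- (1 + `|s|))) ^+ N)%:E); last by rewrite ltry.
rewrite -tuple_volume_box; last by have := normr_ge0 s; lra.
apply: le_tuple_volume => t /= hs; apply/allP => y yt.
have y2 : (y ^+ 2 <= `|s|)%R.
  apply: le_trans (ler_norm s); apply: le_trans hs.
  by rewrite (big_rem y)//= lerDl sumr_ge0// => z _; rewrite sqr_ge0.
rewrite -ler_norml; have [y1|y1] := leP `|y|%R 1%R.
  by have := normr_ge0 s; lra.
apply: (@le_trans _ _ (`|y| ^+ 2)%R); first by rewrite expr2 ler_peMr// ltW.
by rewrite real_normK ?num_real//; have := normr_ge0 s; lra.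
Qed.

(** The volume is finite and monotone in the squared radius, hence a Borel function of it. *)
Lemma measurable_ball_volume (N : nat) (s : R) :
  measurable_fun setT (fun x : R => ball_volume N (s - x ^+ 2)%R).
Proof.
have -> : (fun x : R => ball_volume N (s - x ^+ 2)%R) =
    EFin \o ((fine \o ball_volume N) \o (fun x => s - x ^+ 2)%R).
  by apply/funext => x /=; rewrite fineK// ball_volume_fin.
apply/measurable_EFinP; apply: measurableT_comp; last first.
  by apply: measurable_funB => //; apply: measurable_funX.
apply: nondecreasing_measurable => // x y xy /=.
by apply: fine_le; rewrite ?ball_volume_fin// le_ball_volume.
Qed.

Lemma ball_volumeS (N : nat) (s : R) :
  ball_volume N.+1 s = \int[mu]_x ball_volume N (s - x ^+ 2)%R.
Proof.
apply: eq_integral => x _; congr (TV _); apply/seteqP; split => t /=.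
  by rewrite big_cons => h; rewrite lerBrDl.
by rewrite big_cons lerBrDl.
Qed.

(** Centre and matrix are indexed by natural numbers, so that removing the first coordinate is a
    mere shift of indices. *)
Definition triangular_ellipsoid (N : nat) (c : nat -> R) (T : nat -> nat -> R) (s : R) :
    set (N.-tuple R) :=
  [set t | exists2 u : nat -> R, (\sum_(j < N) u j ^+ 2 <= s)%R &
     forall i : 'I_N, (tnth t i = c i + \sum_(j < i.+1) T i j * u j)%R].

(** The first coordinate [y] determines [u 0], so the section at [y] is again triangular, with a
    moved centre and a smaller parameter. The induction hypothesis does not see the centre, and the
    substitution of [u 0] for [y] produces the first diagonal entry. *)
Lemma triangular_ellipsoid_volume (N : nat) (c : nat -> R) (T : nat -> nat -> R) (s : R) :
  (forall i, (i < N)%N -> (0 < T i i)%R) ->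
  TV (@triangular_ellipsoid N c T s) = (\prod_(i < N) T i i)%:E * ball_volume N s.
Proof.
elim: N c T s => [|N IH] c T s T0.
  rewrite big_ord0 mul1e /ball_volume; congr (TV _); apply/seteqP; split => t /=.
    by rewrite tuple0 big_nil => -[u]; rewrite big_ord0.
  rewrite tuple0 big_nil => s0; exists (fun=> 0%R); first by rewrite big_ord0.
  by case.
pose u0 y := ((y - c 0%N) / T 0%N 0%N)%R.
pose T' i j := T i.+1 j.+1.
have T00 : (0 < T 0%N 0%N)%R by apply: T0.
have P0 : (0 <= \prod_(i < N) T' i i)%R.
  by apply: prodr_ge0 => i _; apply/ltW/T0; rewrite ltnS.
have sec y : [set t : N.-tuple R | @triangular_ellipsoid N.+1 c T s [tuple of y :: t]] =
    @triangular_ellipsoid N (fun i => c i.+1 + T i.+1 0%N * u0 y)%R T' (s - u0 y ^+ 2).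
  apply/seteqP; split => t [u us ut].
    have uE : u 0%N = u0 y.
      have := ut ord0; rewrite tnth0 /= big_ord1 => e; rewrite /u0 e addrC addKr mulrC mulKf//.
      by rewrite gt_eqF.
    exists (fun j => u j.+1); first by rewrite big_ord_recl uE in us; rewrite lerBrDl.
    move=> i; have := ut (lift ord0 i); rewrite tnthS => ->.
    by rewrite big_ord_recl uE addrA.
  exists (fun j => if j is j'.+1 then u j' else u0 y).
    by rewrite big_ord_recl -lerBrDl.
  move=> i; case: (unliftP ord0 i) => [j ->|->].
    by rewrite tnthS ut [in RHS]big_ord_recl /= addrA.
  by rewrite tnth0 /= big_ord1 /u0 mulrC divfK ?gt_eqF// addrC subrK.
transitivity (\int[mu]_y ((\prod_(i < N) T' i i)%:E * ball_volume N (s - u0 y ^+ 2)%R)).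
  apply: eq_integral => y _; rewrite sec -/(@tuple_volume R N _) IH// => i iN; exact: T0.
rewrite (@integral_affine R
  (fun x => (\prod_(i < N) T' i i)%:E * ball_volume N (s - x ^+ 2)%R))//; last 2 first.
- by apply: emeasurable_funM => //; apply: measurable_ball_volume.
- by move=> x; rewrite mule_ge0// tuple_volume_ge0.
rewrite ge0_integralZl//; last 2 first.
- exact: measurable_ball_volume.
- by move=> x _; apply: tuple_volume_ge0.
by rewrite ball_volumeS muleA -EFinM big_ord_recl.
Qed.

End TupleVolume.

(** * Triangular form by orthogonal reduction *)

Section QR.
Variable R : rcfType.

Lemma rowsqr_ge0 (m : nat) (a : 'rV[R]_m) : 0 <= (a *m a^T) 0 0.
Proof. by rewrite mxE sumr_ge0// => i _; rewrite mxE -expr2 sqr_ge0. Qed.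

Lemma rowsqr_eq0 (m : nat) (a : 'rV[R]_m) : (a *m a^T) 0 0 = 0 -> a = 0.
Proof.
rewrite mxE => /eqP; rewrite psumr_eq0; last by move=> i _; rewrite mxE -expr2 sqr_ge0.
move=> /allP h; apply/rowP => i; rewrite [RHS]mxE; apply/eqP.
by have := h i (mem_index_enum i); rewrite /= mxE mulf_eq0 orbb.
Qed.

(** The reflection in the hyperplane orthogonal to [v], the difference of [a] and the multiple of
    the first basis vector with the same length; it exchanges the two. *)
Lemma householder (m : nat) (a : 'rV[R]_m.+1) :
  exists2 H : 'M[R]_m.+1, H *m H^T = 1%:M &
    a *m H = Num.sqrt ((a *m a^T) 0 0) *: delta_mx 0 0.
Proof.
set al := Num.sqrt _; pose e : 'rV[R]_m.+1 := delta_mx 0 0.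
have al2 : (a *m a^T) 0 0 = al ^+ 2 by rewrite sqr_sqrtr// rowsqr_ge0.
pose v := a - al *: e.
have [v0|vn] := eqVneq v 0.
  exists 1%:M; first by rewrite trmx1 mulmx1.
  by rewrite mulmx1; apply/eqP; rewrite -subr_eq0 -/e -/v v0.
pose s := (v *m v^T) 0 0.
have s0 : s != 0 by apply: contraNneq vn => /rowsqr_eq0 ->.
pose w := v^T *m v.
have ww : w *m w = s *: w.
  rewrite /w mulmxA -[v^T *m v *m v^T]mulmxA [v *m v^T]mx11_scalar -/s.
  by rewrite mul_mx_scalar -scalemxAl.
have wT : w^T = w by rewrite /w trmx_mul trmxK.
exists (1%:M - (2 / s) *: w).
  have HT : (1%:M - (2 / s) *: w)^T = 1%:M - (2 / s) *: w.
    by rewrite linearB /= trmx1 [(_ *: w)^T]linearZ /= wT.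
  rewrite HT mulmxBl mul1mx mulmxBr mulmx1.
  rewrite -scalemxAl -scalemxAr ww !scalerA.
  have -> : 2 / s * (2 / s) * s = 2 / s + 2 / s by field.
  by rewrite scalerDl opprB addrK subrK.
have dotE (x y : 'rV[R]_m.+1) : (x *m y^T) 0 0 = \sum_i x 0 i * y 0 i.
  by rewrite mxE; apply: eq_bigr => i _; rewrite mxE.
have vE i : v 0 i = a 0 i - al * (i == 0)%:R by rewrite !mxE eqxx.
have d1 : \sum_i a 0 i * (i == 0)%:R = a 0 0.
  by rewrite (bigD1 0)//= mulr1 big1 ?addr0// => i /negPf->; rewrite mulr0.
have d2 : \sum_i (i == 0 :> 'I_m.+1)%:R * (i == 0)%:R = 1 :> R.
  by rewrite (bigD1 0)//= mulr1 big1 ?addr0// => i /negPf->; rewrite mulr0.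
have al2' : \sum_i a 0 i * a 0 i = al ^+ 2 by rewrite -dotE.
have sE : s = 2 * (al ^+ 2 - al * a 0 0).
  rewrite /s dotE.
  transitivity (\sum_i a 0 i * a 0 i - (2 * al) * \sum_i a 0 i * (i == 0)%:R
     + al ^+ 2 * \sum_i (i == 0 :> 'I_m.+1)%:R * (i == 0)%:R).
    rewrite !mulr_sumr -sumrB -big_split /=; apply: eq_bigr => i _; rewrite vE; ring.
  by rewrite d1 d2 al2'; ring.
(* Because [a] and its target have equal length, [a] lies halfway along [v], and the reflection
   subtracts exactly [v]. *)
have avT : (a *m v^T) 0 0 = s / 2.
  rewrite dotE sE.
  transitivity (\sum_i a 0 i * a 0 i - al * \sum_i a 0 i * (i == 0)%:R).
    rewrite !mulr_sumr -sumrB /=; apply: eq_bigr => i _; rewrite vE; ring.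
  by rewrite d1 al2'; field.
rewrite mulmxBr mulmx1 -scalemxAr /w mulmxA [a *m v^T]mx11_scalar avT mul_scalar_mx scalerA.
have -> : 2 / s * (s / 2) = 1 by field.
by rewrite scale1r /v opprB addrC subrK.
Qed.

(** A reflection clears the first row beyond its first entry, and induction treats the lower right
    block. That first entry is the length of a row of an invertible matrix, hence positive. *)
Lemma qr_decomposition (N : nat) (M : 'M[R]_N) : M \in unitmx ->
  exists Q : 'M[R]_N, [/\ Q *m Q^T = 1%:M, forall i j : 'I_N, (i < j)%N -> (M *m Q) i j = 0 &
    forall i, 0 < (M *m Q) i i].
Proof.
elim: N M => [|N IH] M uM; first by exists 1%:M; split=> [||[]//]; [rewrite trmx1 mulmx1|case].
have [H HH aH] := householder (row 0 M).
set al := Num.sqrt _ in aH.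
have uH : H \in unitmx by case/mulmx1_unit: HH.
have uMH : M *m H \in unitmx by rewrite unitmx_mul uM.
(* The same matrix with index type [1 + N], on which the block operations act. *)
have [M1 M1def] : exists M1 : 'M[R]_(1 + N), M1 = M *m H by exists (M *m H).
have rowE j : M1 0 j = al * (j == 0)%:R.
  have : row 0 (M *m H) 0 j = al * (j == 0)%:R by rewrite row_mul aH !mxE eqxx.
  by rewrite M1def mxE.
have l0 : lshift N (0 : 'I_1) = 0 :> 'I_(1 + N) by apply: val_inj.
have ur0 : ursubmx M1 = 0.
  by apply/rowP => j; rewrite !mxE l0 rowE /= mulr0.
have ul0 : ulsubmx M1 = al%:M.
  by apply/matrixP => i j; rewrite !ord1 !mxE l0 rowE eqxx mulr1 mulr1n.
have M1E : M1 = block_mx al%:M 0 (dlsubmx M1) (drsubmx M1).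
  by rewrite -{1}[M1]submxK ur0 ul0.
have detE : \det M1 = al * \det (drsubmx M1) by rewrite {1}M1E det_lblock det_scalar1.
have := uMH; rewrite -M1def unitmxE detE unitfE mulf_eq0 negb_or => /andP[al0 d0].
have alp : 0 < al by rewrite lt0r al0 sqrtr_ge0.
have [Q [QQ Qlow Qpos]] : exists Q : 'M[R]_N, [/\ Q *m Q^T = 1%:M,
    forall i j : 'I_N, (i < j)%N -> (drsubmx M1 *m Q) i j = 0 &
    forall i, 0 < (drsubmx M1 *m Q) i i] by apply: IH; rewrite unitmxE unitfE.
pose Q1 : 'M[R]_(1 + N) := block_mx 1%:M 0 0 Q.
have MQ0 : M1 *m Q1 = block_mx al%:M 0 (dlsubmx M1) (drsubmx M1 *m Q).
  by rewrite {1}M1E /Q1 mulmx_block !mulmx1 !mulmx0 !mul0mx !addr0 !add0r.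
have QQ0 : Q1 *m Q1^T = 1%:M.
  rewrite /Q1 tr_block_mx !trmx0 trmx1 mulmx_block !mulmx1 !mulmx0 !mul0mx !addr0 !add0r QQ.
  by rewrite -scalar_mx_block.
have low1 (i j : 'I_(1 + N)) : (i < j)%N -> (M1 *m Q1) i j = 0.
  rewrite MQ0; case: (splitP i) => [i0 e|i' e]; case: (splitP j) => [j0 e'|j' e'].
  - by rewrite e e' !ord1.
  - have -> : i = lshift N i0 by apply: val_inj.
    have -> : j = rshift 1 j' by apply: val_inj.
    by rewrite block_mxEur mxE.
  - by rewrite e e' !ord1.
  have -> : i = rshift 1 i' by apply: val_inj.
  have -> : j = rshift 1 j' by apply: val_inj.
  by rewrite block_mxEdr => ij; rewrite Qlow.
have pos1 (i : 'I_(1 + N)) : 0 < (M1 *m Q1) i i.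
  rewrite MQ0; case: (splitP i) => [i0 e|i' e].
    have -> : i = lshift N i0 by apply: val_inj.
    by rewrite block_mxEul mxE eqxx mulr1n.
  have -> : i = rshift 1 i' by apply: val_inj.
  by rewrite block_mxEdr.
have MQ : M *m (H *m Q1) = M1 *m Q1 by rewrite mulmxA M1def.
exists (H *m Q1); split.
- rewrite trmx_mul mulmxA -[H *m Q1 *m Q1^T]mulmxA.
  by rewrite [Q1 *m Q1^T]QQ0 mulmx1.
- by move=> i j; rewrite MQ; apply: low1.
- by move=> i; rewrite MQ; apply: pos1.
Qed.

End QR.

(** * Ellipsoids and their volumes *)

Section Volume.
Local Open Scope classical_set_scope.
Variables (R : realType) (I : finType).
Local Notation arr := {ffun I -> R}.
Local Notation N := #|I|.

Lemma le_volume (A B : set arr) : A `<=` B -> (volume A <= volume B)%E.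
Proof. by move=> AB; apply: le_tuple_volume => t /AB. Qed.

Lemma volume_cubes (A : set arr) (F : seq arr) (h : R) : 0 <= h ->
  (forall x, A x -> exists2 c, c \in F & forall i, c i <= x i <= c i + h) ->
  (volume A <= ((size F)%:R * h ^+ N)%:E)%E.
Proof.
move=> h0 hA; pose F' : seq (N.-tuple R) := [seq [tuple c (enum_val a) | a < N] | c : arr <- F].
have -> : size F = size F' by rewrite size_map.
apply: le_trans (tuple_volume_boxes F' h0); apply: le_tuple_volume => t /= /hA[c cF hc].
exists [tuple c (enum_val a) | a < N]; first by apply/mapP; exists c.
by move=> a; have := hc (enum_val a); rewrite ffunE enum_valK tnth_mktuple.
Qed.

Lemma volume_ge_cube (A : set arr) (s : R) : 0 <= s ->
  (forall x : arr, (forall i, `|x i| <= s) -> A x) -> (((2 * s) ^+ N)%:E <= volume A)%E.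
Proof.
move=> s0 hA; have -> : 2 * s = s - - s by ring.
rewrite -tuple_volume_box; last by lra.
apply: le_tuple_volume => t /= /allP h; apply: hA => i; rewrite ffunE ler_norml.
by apply: h; apply: mem_tnth.
Qed.

Lemma volume_ge0 (A : set arr) : (0 <= volume A)%E.
Proof. exact: tuple_volume_ge0. Qed.

(** Rows and columns are numbered by [enum_rank], the order in which [volume] integrates; triangular
    matrices refer to this order. *)
Definition affine_image (c : arr) (P : 'M[R]_N) : set arr :=
  [set c + [ffun i => \sum_j P (enum_rank i) (enum_rank j) * u j] | u in @euclidean_ball R I].

Lemma volume_triangular (c : arr) (P : 'M[R]_N) : (0 < N)%N ->
  (forall a b : 'I_N, (a < b)%N -> P a b = 0) -> (forall a, 0 < P a a) ->
  volume (affine_image c P) = ((\prod_a P a a)%:E * @ball_volume R N 1)%E.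
Proof.
move=> N0 Plow Ppos; pose ins (a : nat) : 'I_N := insubd (Ordinal N0) a.
have insE (a : 'I_N) : ins a = a by apply: val_inj; rewrite val_insubd ltn_ord.
pose T (a b : nat) := P (ins a) (ins b).
have prodE : \prod_(a < N) T a a = \prod_a P a a.
  by apply: eq_bigr => a _; rewrite /T insE.
rewrite -prodE -(@triangular_ellipsoid_volume R N (fun a => c (enum_val (ins a)))); last first.
  by move=> a aN; apply: Ppos.
have sumE (u : nat -> R) (a : 'I_N) :
    \sum_(b < a.+1) T a b * u b = \sum_(b < N) P a b * u b.
  rewrite (big_ord_widen N (fun b => T a b * u b))// big_mkcond; apply: eq_bigr => b _.
  rewrite /T !insE; case: ltnP => // ab.
  by rewrite Plow ?mul0r.
congr tuple_volume; apply/seteqP; split => t.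
  move=> [u]; rewrite /euclidean_ball /= => u1 /ffunP e.
  exists (fun b => u (enum_val (ins b))).
    rewrite (reindex (@enum_val I I)) in u1; last first.
      by exists enum_rank => a _; rewrite ?enum_valK ?enum_rankK.
    by under eq_bigr do rewrite insE.
  move=> a; have := e (enum_val a); rewrite !ffunE enum_valK => <-; rewrite insE; congr (_ + _).
  rewrite (sumE (fun b => u (enum_val (ins b)))) (reindex (@enum_val I I)) /=; last first.
    by exists enum_rank => b _; rewrite ?enum_valK ?enum_rankK.
  by apply: eq_bigr => b _; rewrite enum_valK insE.
move=> [u u1 ut]; exists [ffun i => u (enum_rank i)].
  rewrite /euclidean_ball /= (reindex (@enum_val I I)) /=; last first.
    by exists enum_rank => b _; rewrite ?enum_valK ?enum_rankK.
  by under eq_bigr do rewrite ffunE enum_valK.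
apply/ffunP => i; rewrite !ffunE ut insE enum_rankK; congr (_ + _).
rewrite sumE (reindex (@enum_val I I)) /=; last first.
  by exists enum_rank => b _; rewrite ?enum_valK ?enum_rankK.
by apply: eq_bigr => b _; rewrite ffunE enum_valK.
Qed.

(** The linear part may be multiplied on the right by an orthogonal matrix, which maps the Euclidean
    ball onto itself; [qr_decomposition] makes the product triangular. *)
Lemma ellipsoid_triangular (E : set arr) : is_ellipsoid E ->
  exists (c : arr) (P : 'M[R]_N), [/\ E = affine_image c P,
    forall a b : 'I_N, (a < b)%N -> P a b = 0 & forall a, 0 < P a a].
Proof.
move=> [L [c [bijL ->]]].
pose delta (j : I) : arr := [ffun i => (i == j)%:R].
have LE (x : arr) i : L x i = \sum_j L (delta j) i * x j.
  have {1}-> : x = \sum_j x j *: delta j.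
    apply/ffunP => i'; rewrite sum_ffunE (bigD1 i')//= big1 ?addr0.
      by rewrite !ffunE eqxx /GRing.scale /= mulr1.
    by move=> j /negPf ji; rewrite !ffunE eq_sym ji /GRing.scale /= mulr0.
  rewrite linear_sum sum_ffunE; apply: eq_bigr => j _.
  by rewrite linearZ /= ffunE /GRing.scale /= mulrC.
pose M : 'M[R]_N := \matrix_(a, b) L (delta (enum_val b)) (enum_val a).
have [g gK Kg] := bijL.
have uM : M \in unitmx.
  suff : M *m (\matrix_(a, b) g (delta (enum_val b)) (enum_val a)) = 1%:M by case/mulmx1_unit.
  apply/matrixP => a b; rewrite !mxE.
  have := LE (g (delta (enum_val b))) (enum_val a); rewrite Kg ffunE.
  rewrite (inj_eq enum_val_inj) => ->; rewrite (reindex (@enum_val I I)) /=; last first.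
    by exists enum_rank => j _; rewrite ?enum_valK ?enum_rankK.
  by apply: eq_bigr => j _; rewrite !mxE.
have [Q [QQ low pos]] := qr_decomposition uM.
pose vecmul (W : 'M[R]_N) (x : arr) : arr :=
  [ffun i => \sum_j W (enum_rank i) (enum_rank j) * x j].
have vecmulM (W W' : 'M[R]_N) (x : arr) : vecmul W (vecmul W' x) = vecmul (W *m W') x.
  apply/ffunP => i; rewrite !ffunE.
  under [LHS]eq_bigr do rewrite ffunE mulr_sumr.
  rewrite exchange_big /=; apply: eq_bigr => j _; rewrite mxE mulr_suml.
  rewrite [RHS](reindex (@enum_rank I)) /=; last first.
    by exists enum_val => b _; rewrite ?enum_valK ?enum_rankK.
  by apply: eq_bigr => l _; rewrite mulrA.
have vecmul1 x : vecmul 1%:M x = x.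
  apply/ffunP => i; rewrite ffunE (bigD1 i)//= mxE eqxx mul1r big1 ?addr0// => j ji.
  by rewrite mxE (inj_eq enum_rank_inj) eq_sym (negPf ji) mul0r.
have LM x : L x = vecmul M x.
  by apply/ffunP => i; rewrite LE ffunE; apply: eq_bigr => j _; rewrite mxE !enum_rankK.
(* Applied to [Q] and to its transpose, for the two inclusions. *)
have normE (W : 'M[R]_N) (x : arr) : W^T *m W = 1%:M ->
    \sum_i vecmul W x i ^+ 2 = \sum_i x i ^+ 2.
  move=> WW; transitivity (\sum_j x j * vecmul W^T (vecmul W x) j).
    under [RHS]eq_bigr do rewrite ffunE mulr_sumr.
    rewrite exchange_big /=; apply: eq_bigr => i _.
    rewrite expr2 {1}ffunE mulr_suml; apply: eq_bigr => j _; rewrite mxE; ring.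
  by rewrite vecmulM WW vecmul1; apply: eq_bigr => i _; rewrite expr2.
have QQ' : Q^T *m Q = 1%:M by apply: mulmx1C.
exists c, (M *m Q); split=> //; apply/seteqP; split => _ [x x1 <-].
  exists (vecmul Q^T x); first by rewrite /euclidean_ball /= normE// trmxK.
  by rewrite LM -/(vecmul _ _) vecmulM -mulmxA QQ mulmx1.
exists (vecmul Q x); first by rewrite /euclidean_ball /= normE.
by rewrite LM vecmulM.
Qed.

Definition ball_of_radius (s : R) : set arr := [set [ffun i => s * u i] | u in @euclidean_ball R I].

Lemma ball_of_radius_affine (s : R) : ball_of_radius s = affine_image 0 s%:M.
Proof.
have e (u : arr) : 0 + [ffun i => \sum_j s%:M (enum_rank i) (enum_rank j) * u j] =
    [ffun i => s * u i].
  rewrite add0r; apply/ffunP => i; rewrite !ffunE (bigD1 i)//= mxE eqxx mulr1n.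
  rewrite big1 ?addr0// => j ji.
  by rewrite mxE (inj_eq enum_rank_inj) eq_sym (negPf ji) mul0r.
by apply/seteqP; split => _ [u u1 <-]; exists u; rewrite ?e.
Qed.

Lemma volume_ball_of_radius (s : R) : (0 < N)%N -> 0 < s ->
  volume (ball_of_radius s) = ((s ^+ N)%:E * @ball_volume R N 1)%E.
Proof.
move=> N0 s0; rewrite ball_of_radius_affine volume_triangular//.
- by under eq_bigr do rewrite mxE eqxx mulr1n; rewrite prodr_const card_ord.
- by move=> a b ab; rewrite mxE -val_eqE /= ltn_eqF.
- by move=> a; rewrite mxE eqxx mulr1n.
Qed.

Lemma ball_of_radius_ellipsoid (s : R) : 0 < s -> is_ellipsoid (ball_of_radius s).
Proof.
move=> s0; exists ( *:%R s : {linear arr -> arr}), 0; split.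
  exists (fun x : arr => [ffun i => s^-1 * x i] : arr) => x; apply/ffunP => i.
    by rewrite !ffunE /GRing.scale /= mulKf// gt_eqF.
  by rewrite !ffunE /GRing.scale /= mulVKf// gt_eqF.
apply/seteqP; split => _ [u u1 <-]; exists u => //.
  by rewrite add0r; apply/ffunP => i; rewrite !ffunE.
by rewrite add0r; apply/ffunP => i; rewrite !ffunE.
Qed.

Section MaxEllipsoid.
Variables (nrm : arr -> R) (rho : R).
Hypothesis N0 : (0 < N)%N.
Hypothesis symm : forall (c : arr) (P : 'M[R]_N),
  affine_image c P `<=` unit_ball nrm ->
  ball_of_radius ((\sum_a P a a) / N%:R) `<=` unit_ball nrm.
Hypothesis rho0 : 0 < rho.
Hypothesis rho_sub : ball_of_radius rho `<=` unit_ball nrm.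
Hypothesis rho_max : forall s, 0 <= s -> ball_of_radius s `<=` unit_ball nrm -> s <= rho.

Lemma ball_of_radius_max : is_max_volume_ellipsoid (unit_ball nrm) (ball_of_radius rho).
Proof.
split=> //; first exact: ball_of_radius_ellipsoid.
move=> E elE EB; have [c [P [Ee Plow Ppos]]] := ellipsoid_triangular elE.
rewrite Ee volume_triangular// volume_ball_of_radius//.
apply: lee_wpmul2r; first exact: tuple_volume_ge0.
rewrite lee_fin; pose s := (\sum_a P a a) / N%:R.
have s0 : 0 <= s by rewrite divr_ge0// sumr_ge0// => a _; apply: ltW.
have sr : s <= rho by apply: rho_max => //; apply: (@symm c P); rewrite -Ee.
apply: le_trans (lerXn2r _ s0 (ltW rho0) sr).
have := @leif_AGM R 'I_N predT (fun a => P a a); rewrite card_ord.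
by case=> // a _; apply: ltW.
Qed.

(** The choice operator may return another maximiser than the ball, but any two maximisers have the
    same volume. *)
Lemma volume_max_ellipsoid :
  volume (max_volume_ellipsoid (unit_ball nrm)) = ((rho ^+ N)%:E * @ball_volume R N 1)%E.
Proof.
rewrite -volume_ball_of_radius//; apply/eqP; rewrite eq_le.
have [elE EB Emax] : is_max_volume_ellipsoid (unit_ball nrm) (max_volume_ellipsoid (unit_ball nrm)).
  apply: (@xgetPex _ set0 [set E | is_max_volume_ellipsoid (unit_ball nrm) E]).
  by exists (ball_of_radius rho); apply: ball_of_radius_max.
have [elr rB rmax] := ball_of_radius_max.
by rewrite rmax//= Emax.
Qed.

End MaxEllipsoid.

End Volume.

Lemma lpn_inj (R : realType) (n : nat) (r : R) (f : 'I_n -> 'I_n) (x : {ffun 'I_n -> R}) :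
  0 <= r -> injective f -> lpn r [ffun i => x (f i)] <= lpn r x.
Proof.
rewrite le_eqVlt => /orP[/eqP<-|r0] fi.
  by apply/lpn0_leP => [|i]; rewrite ?lpn_ge0// ffunE le_lpn.
rewrite lpn_leE ?lpn_ge0// -lpn_sum// [leRHS](reindex_inj fi) /=.
by apply: ler_sum => i _; rewrite ffunE.
Qed.

(** * Averaging over the symmetries of the unit ball *)

Section Symmetrization.
Local Open Scope classical_set_scope.
Variables (R : realType) (k n' : nat) (r : 'I_k -> R).
Local Notation n := n'.+1.
Hypotheses (k0 : (0 < k)%N) (r0 : forall j, 0 <= r j).
Local Notation vec := {ffun 'I_n -> R}.
Local Notation idx := {ffun 'I_k -> 'I_n}.
Local Notation arr := {ffun idx -> R}.
Local Notation pnr := (@pn R k n (fun j => lpn (r j))).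
Local Notation B := (unit_ball pnr).
Local Notation N := #|{: idx}|.
Local Notation X := {ffun ('I_k * 'I_n)%type -> bool}.

Let lp0 j (x : vec) : 0 <= lpn (r j) x.
Proof. exact: lpn_ge0. Qed.

Let lpZ j c (x : vec) : lpn (r j) [ffun i => c * x i] = `|c| * lpn (r j) x.
Proof. exact: lpnZ. Qed.

(** In contrast to [bitset] every factor contributes a sign, so distinct multi-indices have
    orthogonal Walsh functions. *)
Definition graph_set (I : idx) : {set 'I_k * 'I_n} := [set (j, I j) | j in [set: 'I_k]]%SET.

Lemma graph_set_inj : injective graph_set.
Proof.
move=> I J e; apply/ffunP => j.
have : (j, I j) \in graph_set I by apply/imsetP; exists j; rewrite ?inE.
by rewrite e => /imsetP[j' _ [-> ->]].
Qed.

Definition sign_flip (x : X) (A : arr) : arr := wmul (fun j i => (-1) ^+ x (j, i)) A.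

Lemma sign_flipE x A I : sign_flip x A I = walsh R (graph_set I) x * A I.
Proof.
rewrite ffunE /walsh big_imset /=; last by move=> j j' _ _ [].
by congr (_ * _); apply: eq_bigl => j; rewrite inE.
Qed.

Lemma pnr_sign_flip x A : pnr (sign_flip x A) <= pnr A.
Proof.
have := @pn_wmul R k n (fun j => lpn (r j)) (fun j => lpn (r j))
  (fun j i => (-1) ^+ x (j, i)) (fun=> 1) k0 lp0 lp0 (fun=> ler01) _ A.
rewrite big1// mul1r; apply=> j y; rewrite mul1r; apply: lpn_homo => // i.
by rewrite ffunE normrM normrX normrN1 expr1n mul1r.
Qed.

Lemma sign_flip_norm2 x A : \sum_I sign_flip x A I ^+ 2 = \sum_I A I ^+ 2.
Proof. by apply: eq_bigr => I _; rewrite sign_flipE exprMn walsh_sqr mul1r. Qed.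

(** Addition of multi-indices is modulo [n] in each factor; [n] is a successor so that the indices
    form a cyclic group. *)
Definition shift (a : idx) (A : arr) : arr := [ffun I : idx => A (I + a)].

Lemma pnr_shift a A : pnr (shift a A) <= pnr A.
Proof.
rewrite -[leRHS]mul1r; apply: (@pn_map R k n _ _ (shift a)) => //.
- by apply/ffunP => I; rewrite !ffunE.
- by move=> A1 A2; apply/ffunP => I; rewrite !ffunE.
move=> x; exists (fun j => [ffun i => x j (i + a j)]).
  by apply/ffunP => I; rewrite !ffunE; apply: eq_bigr => j _; rewrite !ffunE.
rewrite mul1r; apply: ler_prod => j _; rewrite lp0 /=.
by apply: lpn_inj => //; apply: addIr.
Qed.

Lemma shift_norm2 a A : \sum_I shift a A I ^+ 2 = \sum_I A I ^+ 2.
Proof.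
rewrite [RHS](reindex_inj (addIr a)) /=.
by apply: eq_bigr => I _; rewrite ffunE.
Qed.

Lemma pnr_average (J : finType) (F : J -> arr) (t : R) : 0 <= t -> (0 < #|J|)%N ->
  (forall j, pnr (F j) <= t) -> pnr (\sum_j [ffun I => #|J|%:R^-1 * F j I]) <= t.
Proof.
move=> t0 J0 h; have Jp : 0 < #|J|%:R :> R by rewrite ltr0n.
apply: le_trans (pn_sum lp0 k0 _ _ _) _.
apply: (@le_trans _ _ (\sum_(j : J) #|J|%:R^-1 * t)).
  apply: ler_sum => j _; apply: le_trans (pnZ _ _ k0 lp0 lpZ) _.
  by rewrite gtr0_norm ?invr_gt0// ler_wpM2l ?invr_ge0 ?(ltW Jp).
by rewrite sumr_const -mulrnAl -[_ *+ _]mulr_natr mulVf ?gt_eqF// mul1r.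
Qed.

(* Averaging over sign changes kills the off-diagonal entries, averaging over
   cyclic shifts of the indices then makes the diagonal constant. *)
Lemma symmetrization (c : arr) (P : 'M[R]_N) : affine_image c P `<=` B ->
  ball_of_radius ((\sum_a P a a) / N%:R) `<=` B.
Proof.
move=> hP; pose T I J := P (enum_rank I) (enum_rank J).
pose lin (u : arr) : arr := [ffun I => \sum_J T I J * u J].
have N0 : (0 < N)%N by apply/card_gt0P; exists [ffun=> ord0].
have h1 (u : arr) : \sum_I u I ^+ 2 <= 1 -> pnr (lin u) <= 1.
  (* Recentring: [lin u] is half the difference of the points of the ellipsoid belonging to [u] and
     [- u]. *)
  move=> u1; pose u' : arr := [ffun I => -1 * u I].
  have u'1 : \sum_I u' I ^+ 2 <= 1.
    by under eq_bigr do rewrite ffunE mulN1r sqrrN.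
  have e : lin u = [ffun I => 2^-1 * (c + lin u) I] + [ffun I => - 2^-1 * (c + lin u') I].
    apply/ffunP => I; rewrite !ffunE.
    have -> : \sum_J T I J * u' J = - \sum_J T I J * u J.
      by rewrite -sumrN; apply: eq_bigr => J _; rewrite ffunE mulN1r mulrN.
    by field.
  have hu : pnr (c + lin u) <= 1 by apply: hP; exists u.
  have hu' : pnr (c + lin u') <= 1 by apply: hP; exists u'.
  rewrite e; apply: le_trans (pn_add lp0 k0 _ _) _.
  apply: le_trans (lerD (pnZ _ _ k0 lp0 lpZ) (pnZ _ _ k0 lp0 lpZ)) _.
  rewrite normrN ger0_norm//; lra.
pose D (u : arr) : arr := [ffun I => T I I * u I].
have X0 : (0 < #|{: X}|)%N by apply/card_gt0P; exists [ffun=> false].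
have h2 (u : arr) : \sum_I u I ^+ 2 <= 1 -> pnr (D u) <= 1.
  move=> u1.
  have -> : D u = \sum_(x : X) [ffun I => #|{: X}|%:R^-1 * sign_flip x (lin (sign_flip x u)) I].
    apply/ffunP => I; rewrite sum_ffunE.
    transitivity (#|{: X}|%:R^-1 * \sum_J T I J * u J *
        \sum_x walsh R (graph_set I) x * walsh R (graph_set J) x).
      rewrite (bigD1 I)//= [X in _ + X]big1 ?addr0; last first.
        move=> J JI; rewrite walsh_orthogonal (inj_eq graph_set_inj) eq_sym (negPf JI).
        by rewrite mul0r mulr0.
      rewrite walsh_orthogonal eqxx mul1r [D u I]ffunE [RHS]mulrC mulfK//.
      by rewrite pnatr_eq0 -lt0n.
    rewrite mulr_sumr.
    under eq_bigr do rewrite !mulr_sumr.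
    rewrite exchange_big /=; apply: eq_bigr => x _.
    rewrite ffunE sign_flipE ffunE !mulr_sumr; apply: eq_bigr => J _.
    by rewrite sign_flipE; ring.
  apply: pnr_average => // x; apply: le_trans (pnr_sign_flip _ _) _.
  by apply: h1; rewrite sign_flip_norm2.
move=> _ [u u1 <-]; rewrite /unit_ball /=.
have -> : [ffun I => (\sum_a P a a) / N%:R * u I] =
   \sum_(a : idx) [ffun I => N%:R^-1 * shift a (D (shift (- a) u)) I].
  apply/ffunP => I; rewrite sum_ffunE ffunE.
  have -> : \sum_a P a a = \sum_a T (I + a) (I + a).
    transitivity (\sum_J T J J); last by rewrite (reindex_inj (addrI I)).
    rewrite (reindex (@enum_rank idx)) //=.
    by exists enum_val => a _; rewrite ?enum_valK ?enum_rankK.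
  rewrite mulrAC [_ * N%:R^-1]mulrC mulr_suml mulr_sumr; apply: eq_bigr => a _.
  by rewrite !ffunE addrK.
apply: pnr_average => // a; apply: le_trans (pnr_shift _ _) _.
by apply: h2; rewrite shift_norm2.
Qed.

Lemma unit_ball_bound (s : R) : ball_of_radius s `<=` B ->
  forall u : arr, \sum_I u I ^+ 2 <= 1 -> pnr [ffun I => s * u I] <= 1.
Proof. by move=> h u u1; apply: h; exists u. Qed.

(** Admissible radii are bounded by 1. Their supremum is admissible, since for each [u] with nonzero
    norm the condition on [s] is the closed one that [s] not exceed the inverse of that norm. *)
Lemma inradius_exists (s0 : R) : 0 < s0 -> ball_of_radius s0 `<=` B ->
  exists rho : R, [/\ s0 <= rho, ball_of_radius rho `<=` B &
    forall s, 0 <= s -> ball_of_radius s `<=` B -> s <= rho].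
Proof.
move=> s00 hs0; pose E := [set s : R | 0 <= s /\ ball_of_radius s `<=` B].
have s0E : E s0 by split=> //; apply: ltW.
have hE : has_sup E.
  split; first by exists s0.
  by exists 1 => s [_ hs]; apply: (inradius_le1 k0 (ltn0Sn n') r0); apply: unit_ball_bound.
exists (sup E); split; first exact: sup_upper_bound.
  move=> _ [u u1 <-]; rewrite /unit_ball /=; apply: le_trans (pnZ _ _ k0 lp0 lpZ) _.
  rewrite ger0_norm; last by apply: le_trans (ltW s00) _; apply: sup_upper_bound.
  have [u0|un] := eqVneq (pnr u) 0; first by rewrite u0 mulr0.
  have up : 0 < pnr u by rewrite lt0r un pn_ge0.
  rewrite -ler_pdivlMr// mul1r; apply: ge_sup; first by exists s0.
  move=> s [s_ge0 hs]; have [->|sn] := eqVneq s 0; first by rewrite invr_ge0 ltW.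
  have sp : 0 < s by rewrite lt0r sn.
  rewrite -[s]invrK lef_pV2 ?posrE ?invr_gt0//.
  have {1}-> : u = [ffun I => s^-1 * [ffun J => s * u J] I].
    by apply/ffunP => I; rewrite !ffunE mulKf.
  apply: le_trans (pnZ _ _ k0 lp0 lpZ) _.
  by rewrite gtr0_norm ?invr_gt0// ler_piMr ?invr_ge0// (unit_ball_bound hs).
by move=> s s_ge0 hs; apply: sup_upper_bound.
Qed.

End Symmetrization.

(** * Estimates for the volume ratio *)

Section BallVolume.
Local Open Scope classical_set_scope.
Variables (R : realType) (I : finType).
Hypothesis N0 : (0 < #|I|)%N.
Local Notation N := #|I|.
Local Notation side := (N%:R `^ (- 2^-1) : R).

Let NN : 0 < N%:R :> R.
Proof. by rewrite ltr0n. Qed.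

Let side2 : side ^+ 2 = N%:R^-1.
Proof. by rewrite -powR_mulrn ?powR_ge0// -powRrM mulNr mulVf ?pnatr_eq0// powR_inv1// ltW. Qed.

Lemma ball_volume_ge : ((side ^+ N)%:E <= @ball_volume R N 1)%E.
Proof.
have -> : @ball_volume R N 1 = volume (@ball_of_radius R I 1).
  by rewrite volume_ball_of_radius// expr1n mul1e.
apply: le_trans (volume_ge_cube (powR_ge0 N%:R (- 2^-1)) _).
  rewrite lee_fin; apply: lerXn2r; rewrite ?nnegrE ?mulr_ge0 ?powR_ge0//.
  by rewrite ler_peMl ?powR_ge0// ler1n.
move=> x hx; exists x; last by apply/ffunP => i; rewrite ffunE mul1r.
rewrite /euclidean_ball /=; apply: (@le_trans _ _ (\sum_(i : I) N%:R^-1)).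
  apply: ler_sum => i _; rewrite -side2 -real_normK ?num_real//.
  by apply: lerXn2r; rewrite ?nnegrE ?powR_ge0.
by rewrite sumr_const -[_ *+ _]mulr_natr mulVf ?gt_eqF.
Qed.

Lemma ball_volume_le : (@ball_volume R N 1 <= ((32 * side) ^+ N)%:E)%E.
Proof.
have -> : @ball_volume R N 1 = volume (@ball_of_radius R I 1).
  by rewrite volume_ball_of_radius// expr1n mul1e.
have q1 : 1 <= 2 :> R by rewrite ler1n.
have [F Fsz hF] := lq_cover q1 N0 (ltr01 : 0 < 1 :> R).
apply: le_trans (volume_cubes (F := F) (powR_ge0 N%:R (- 2^-1)) _) _.
  move=> _ [u u1 <-]; have [|c cF hc] := hF [ffun i => 1 * u i].
    rewrite powR1; apply: le_trans u1; rewrite le_eqVlt; apply/orP; left; apply/eqP.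
    by apply: eq_bigr => i _; rewrite ffunE mul1r powR_mulrn// real_normK ?num_real.
  by exists c => // i; have := hc i; rewrite mul1r.
by rewrite lee_fin exprMn ler_wpM2r// exprn_ge0 ?powR_ge0.
Qed.

End BallVolume.

Section VolumeRatio.
Local Open Scope classical_set_scope.
Variables (R : realType) (k n' : nat) (r : 'I_k -> R).
Local Notation n := n'.+1.
Hypotheses (k0 : (0 < k)%N) (r0 : forall j, 0 <= r j).
Local Notation idx := {ffun 'I_k -> 'I_n}.
Local Notation arr := {ffun idx -> R}.
Local Notation pnr := (@pn R k n (fun j => lpn (r j))).
Local Notation B := (unit_ball pnr).
Local Notation N := #|{: idx}|.
Local Notation V := (@ball_volume R N 1).

Let N0 : (0 < N)%N.
Proof. by apply/card_gt0P; exists [ffun=> ord0]. Qed.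

Let V_gt0 : 0 < fine V.
Proof.
apply: lt_le_trans (_ : N%:R `^ (- 2^-1) ^+ N <= _).
  by rewrite exprn_gt0// powR_gt0// ltr0n.
by rewrite -lee_fin fineK ?ball_volume_fin//; apply: ball_volume_ge.
Qed.

Let V_le : fine V <= (32 * N%:R `^ (- 2^-1)) ^+ N.
Proof. by rewrite -lee_fin fineK ?ball_volume_fin//; apply: ball_volume_le. Qed.

Let V_ge : (N%:R `^ (- 2^-1)) ^+ N <= fine V.
Proof. by rewrite -lee_fin fineK ?ball_volume_fin//; apply: ball_volume_ge. Qed.

Lemma unit_ball_volume_fin : volume B \is a fin_num.
Proof.
rewrite ge0_fin_numE ?volume_ge0//.
apply: le_lt_trans (volume_cubes (F := [:: [ffun=> -1]]) (h := 2) _ _) _ => //; last exact: ltry.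
move=> x hx; exists [ffun=> -1]; first by rewrite inE.
move=> I; rewrite ffunE; have : `|x I| <= 1.
  by apply: le_trans hx; apply: le_pn => // j y i; apply: le_lpn.
by rewrite ler_norml; lra.
Qed.

Section WithInradius.
Variable t : R.
Hypothesis t0 : 0 < t.
Hypothesis ht : forall A : arr, pnr A <= t * Num.sqrt (\sum_I A I ^+ 2).

Lemma inradius_ball : ball_of_radius t^-1 `<=` B.
Proof.
move=> _ [u u1 <-]; rewrite /unit_ball /=; apply: le_trans (ht _) _.
rewrite -ler_pdivlMl// mulr1 -[leRHS]ger0_norm ?invr_ge0 ?(ltW t0)// -sqrtr_sqr.
apply: ler_wsqrtr; under eq_bigr do rewrite ffunE exprMn.
by rewrite -mulr_sumr ler_piMr ?sqr_ge0.
Qed.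

Lemma vrE : exists rho : R, [/\ t^-1 <= rho, ball_of_radius rho `<=` B,
  forall s, 0 <= s -> ball_of_radius s `<=` B -> s <= rho &
  vr pnr = (fine (volume B) / (rho ^+ N * fine V)) `^ N%:R^-1].
Proof.
have tV : 0 < t^-1 by rewrite invr_gt0.
have [rho [h1 h2 h3]] := inradius_exists k0 r0 tV inradius_ball.
have rho0 : 0 < rho by apply: lt_le_trans h1.
exists rho; split=> //; rewrite /vr.
rewrite (@volume_max_ellipsoid R _ pnr rho N0 (symmetrization k0 r0) rho0 h2 h3).
by rewrite fineM ?ball_volume_fin.
Qed.

Lemma powR_rootK (x : R) : 0 <= x -> (x ^+ N) `^ N%:R^-1 = x.
Proof. by move=> x0; rewrite -powR_mulrn// -powRrM mulfV ?powRr1// pnatr_eq0 -lt0n. Qed.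

Lemma vr_ge1 : 1 <= vr pnr.
Proof.
have [rho [h1 h2 _ ->]] := vrE.
have rho0 : 0 < rho by apply: lt_le_trans h1; rewrite invr_gt0.
have d0 : 0 < rho ^+ N * fine V by rewrite mulr_gt0// exprn_gt0.
apply: (@le_trans _ _ (1 `^ N%:R^-1)); first by rewrite powR1.
apply: ge0_ler_powR; rewrite ?nnegrE ?invr_ge0//.
  by rewrite divr_ge0 ?fine_ge0 ?volume_ge0// ltW.
rewrite ler_pdivlMr// mul1r -lee_fin EFinM !fineK ?unit_ball_volume_fin ?ball_volume_fin//.
by rewrite -volume_ball_of_radius//; apply: le_volume.
Qed.

(** The Euclidean unit ball has volume at least (N^(-1/2))^N, and the inradius is at least 1/t. *)
Lemma vr_upper (b : R) : 0 <= b -> (volume B <= (b ^+ N)%:E)%E ->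
  vr pnr <= b * t * N%:R `^ 2^-1.
Proof.
move=> b0 hb; have [rho [h1 _ _ ->]] := vrE.
have rho0 : 0 < rho by apply: lt_le_trans h1; rewrite invr_gt0.
have d0 : 0 < rho ^+ N * fine V by rewrite mulr_gt0// exprn_gt0.
have x0 : 0 <= b * t * N%:R `^ 2^-1 by rewrite !mulr_ge0 ?powR_ge0// ltW.
rewrite -[leRHS]powR_rootK//; apply: ge0_ler_powR; rewrite ?nnegrE ?invr_ge0 ?exprn_ge0//.
  by rewrite divr_ge0 ?fine_ge0 ?volume_ge0// ltW.
rewrite ler_pdivrMr//.
have hb' : fine (volume B) <= b ^+ N by rewrite -lee_fin fineK ?unit_ball_volume_fin.
apply: le_trans hb' _.
have e : b = b * t * N%:R `^ 2^-1 * (t^-1 * N%:R `^ (- 2^-1)).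
  have -> : b * t * N%:R `^ 2^-1 * (t^-1 * N%:R `^ (- 2^-1)) =
     b * (t * t^-1) * (N%:R `^ 2^-1 * N%:R `^ (- 2^-1)) by ring.
  rewrite -powRD ?pnatr_eq0 -?lt0n ?N0 ?implybT// subrr powRr0 mulfV ?gt_eqF//; ring.
rewrite {1}e exprMn ler_wpM2l ?exprn_ge0// exprMn.
apply: ler_pM; rewrite ?exprn_ge0 ?invr_ge0 ?powR_ge0 ?(ltW t0)//.
by apply: lerXn2r; rewrite ?nnegrE ?invr_ge0 ?(ltW t0) ?(ltW rho0).
Qed.

Lemma vr_lower (b rho1 : R) : 0 <= b -> 0 < rho1 -> ((b ^+ N)%:E <= volume B)%E ->
  (forall s, 0 <= s -> ball_of_radius s `<=` B -> s <= rho1) ->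
  b / (32 * rho1) * N%:R `^ 2^-1 <= vr pnr.
Proof.
move=> b0 rho10 hb hr; have [rho [h1 h2 _ ->]] := vrE.
have rho0 : 0 < rho by apply: lt_le_trans h1; rewrite invr_gt0.
have rr : rho <= rho1 by apply: hr => //; apply: ltW.
have d0 : 0 < rho ^+ N * fine V by rewrite mulr_gt0// exprn_gt0.
have x0 : 0 <= b / (32 * rho1) * N%:R `^ 2^-1.
  by rewrite mulr_ge0 ?powR_ge0// divr_ge0// mulr_ge0// ltW.
rewrite -[leLHS]powR_rootK//; apply: ge0_ler_powR; rewrite ?nnegrE ?invr_ge0 ?exprn_ge0//.
  by rewrite divr_ge0 ?fine_ge0 ?volume_ge0// ltW.
rewrite ler_pdivlMr//.
have hb' : b ^+ N <= fine (volume B) by rewrite -lee_fin fineK ?unit_ball_volume_fin.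
apply: le_trans hb'.
have e : b = b / (32 * rho1) * N%:R `^ 2^-1 * (rho1 * (32 * N%:R `^ (- 2^-1))).
  have -> : b / (32 * rho1) * N%:R `^ 2^-1 * (rho1 * (32 * N%:R `^ (- 2^-1))) =
     b * (N%:R `^ 2^-1 * N%:R `^ (- 2^-1)) by field; rewrite gt_eqF.
  rewrite -powRD ?pnatr_eq0 -?lt0n ?N0 ?implybT// subrr powRr0; ring.
move: x0 e; set x := b / _ * _ => x0 e.
rewrite [X in _ <= X ^+ _]e [X in _ <= X]exprMn ler_wpM2l ?exprn_ge0//.
rewrite [X in _ <= X]exprMn.
apply: ler_pM; rewrite ?exprn_ge0 ?(ltW V_gt0) ?(ltW rho0)//.
by apply: lerXn2r; rewrite ?nnegrE ?(ltW rho10) ?(ltW rho0).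
Qed.

End WithInradius.
End VolumeRatio.

Section Asymptotics.
Variables (R : realType) (k : nat) (r : 'I_k -> R).
Hypotheses (k1 : (1 < k)%N) (r01 : forall j, 0 <= r j <= 1).
Local Notation v n := (vr (@pn R k n (fun j => lpn (r j)))).
Local Notation S := (\sum_j r j).

Let k0 : (0 < k)%N := ltnW k1.
Let r0 j : 0 <= r j.
Proof. by case/andP: (r01 j). Qed.

Definition inradius_exponent (a : nat) : R :=
  a%:R / 2 + Num.max (\sum_(j < k | (a <= j)%N) r j) 2^-1 - 2^-1.

Lemma norm_le_euclidean (a n' : nat) : (a < k)%N ->
  exists2 t, 0 < t <= 4 * 3 ^+ k * n'.+1%:R `^ inradius_exponent a &
    forall A, @pn R k n'.+1 (fun j => lpn (r j)) A <= t * Num.sqrt (\sum_I A I ^+ 2).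
Proof.
move=> ak; exists (4 * 3 ^+ k * n'.+1%:R `^ inradius_exponent a).
  by rewrite lexx andbT mulr_gt0 ?powR_gt0 ?mulr_gt0 ?exprn_gt0.
exact: inradius_bound.
Qed.

Lemma card_idx n : #|{: {ffun 'I_k -> 'I_n}}| = (n ^ k)%N.
Proof. by rewrite card_ffun !card_ord. Qed.

Lemma card_idx_sqrt n : (0 < n)%N ->
  #|{: {ffun 'I_k -> 'I_n}}|%:R `^ 2^-1 = n%:R `^ (k%:R / 2) :> R.
Proof.
by move=> n0; rewrite card_idx natrX -powR_mulrn// -powRrM.
Qed.

Lemma vr_ge1_lesssim : lesssim (fun=> 1) (fun n => v n).
Proof.
exists 1 => // -[//|n'] _; rewrite mul1r.
have [t /andP[t0 _] ht] := norm_le_euclidean n' k0.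
exact: vr_ge1 t0 ht.
Qed.

Lemma vr_upper_lesssim (q : R) (a : nat) : 1 <= q <= 2 -> (a < k)%N ->
  exists2 C : R, 0 < C & forall n, (0 < n)%N -> v n <= C * n%:R `^
    (\sum_j Num.max (q^-1 - r j) 0 + k.-1%:R * (q^-1 - 1) - k%:R * q^-1
     + inradius_exponent a + k%:R / 2).
Proof.
move=> q12 ak; have [C C0 hC] := projective_ball_cover k0 q12 r01.
set e1 := (_ - k%:R * q^-1) in hC *.
exists (C * C * (4 * 3 ^+ k)); first by rewrite !mulr_gt0 ?exprn_gt0.
case=> // n' _; have nn : 0 < n'.+1%:R :> R by rewrite ltr0n.
have [t /andP[t0 t1] ht] := norm_le_euclidean n' ak.
have [F Fsz hF] := hC n'.+1 isT.
have h0 : 0 <= C * n'.+1%:R `^ e1 by rewrite mulr_ge0 ?powR_ge0// ltW.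
have hb0 : 0 <= C * (C * n'.+1%:R `^ e1) by rewrite mulr_ge0// ltW.
have vol : (volume (unit_ball (@pn R k n'.+1 (fun j => lpn (r j)))) <=
    ((C * (C * n'.+1%:R `^ e1)) ^+ #|{: {ffun 'I_k -> 'I_n'.+1}}|)%:E)%E.
  apply: le_trans (volume_cubes h0 hF) _.
  by rewrite lee_fin [leRHS]exprMn ler_wpM2r ?exprn_ge0// card_idx.
apply: le_trans (vr_upper k0 r0 t0 ht hb0 vol) _.
rewrite card_idx_sqrt//.
apply: le_trans (ler_wpM2r (powR_ge0 _ _) (ler_wpM2l hb0 t1)) _.
rewrite !powRD ?(gt_eqF nn) ?implybT//.
by rewrite le_eqVlt; apply/orP; left; apply/eqP; ring.
Qed.

Lemma vr_lower_cube n' (b rho1 : R) : 0 < b -> 0 < rho1 ->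
  (forall A : {ffun {ffun 'I_k -> 'I_n'.+1} -> R}, (forall I, `|A I| <= 1) ->
     pn (fun j => lpn (r j)) A <= b) ->
  (forall s, 0 <= s -> (forall u : {ffun {ffun 'I_k -> 'I_n'.+1} -> R},
     \sum_I u I ^+ 2 <= 1 -> pn (fun j => lpn (r j)) [ffun I => s * u I] <= 1) -> s <= rho1) ->
  b^-1 / (32 * rho1) * n'.+1%:R `^ (k%:R / 2) <= v n'.+1.
Proof.
move=> b0 rho0 hb hrho; have [t /andP[t0 _] ht] := norm_le_euclidean n' k0.
rewrite -card_idx_sqrt//; apply: (vr_lower k0 r0 t0 ht) => //.
- by rewrite invr_ge0 ltW.
- apply: le_trans (volume_ge_cube (s := b^-1) _ _).
  + rewrite lee_fin; apply: lerXn2r; rewrite ?nnegrE ?mulr_ge0 ?invr_ge0 ?(ltW b0)//.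
    by rewrite ler_peMl ?invr_ge0 ?(ltW b0)// ler1n.
  + by rewrite invr_ge0 ltW.
  move=> x hx; rewrite /unit_ball /=.
  have -> : x = [ffun I => b^-1 * [ffun J => b * x J] I].
    by apply/ffunP => I; rewrite !ffunE mulKf// gt_eqF.
  apply: le_trans (pnZ _ _ k0 _ _) _.
  + by move=> *; apply: lpn_ge0.
  + by move=> *; apply: lpnZ.
  rewrite gtr0_norm ?invr_gt0// ler_pdivrMl// mulr1; apply: hb => I.
  by rewrite ffunE normrM gtr0_norm// -ler_pdivlMl// mulr1.
move=> s s0 hs; apply: hrho => // u u1; exact: unit_ball_bound u1.
Qed.

(** The cube of [cube_bound] against the inradius bound 1 from a coordinate functional; this yields
    case (6). *)
Lemma vr_lower_small_sum :
  exists2 c : R, 0 < c & forall n, (0 < n)%N -> c * n%:R `^ (2^-1 - S) <= v n.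
Proof.
exists (32 * (4 * 3 ^+ k))^-1; first by rewrite invr_gt0 !mulr_gt0 ?exprn_gt0.
case=> // n' _; have nn : 0 < n'.+1%:R :> R by rewrite ltr0n.
have K0 : 0 < 4 * 3 ^+ k :> R by rewrite mulr_gt0 ?exprn_gt0.
have b0 : 0 < 4 * 3 ^+ k * n'.+1%:R `^ (S + k.-1%:R / 2) by rewrite mulr_gt0 ?powR_gt0.
have := vr_lower_cube b0 ltr01 (fun A => @cube_bound R k n'.+1 k0 isT r A r0)
  (fun s _ => @inradius_le1 R k n'.+1 k0 isT r s r0).
apply: le_trans; rewrite mulr1 [(_ * _ `^ _)^-1]invfM -powRN.
have -> : 2^-1 - S = - (S + k.-1%:R / 2) + k%:R / 2.
  by have -> : k%:R = k.-1%:R + 1 :> R; [rewrite natr1 prednK|field].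
rewrite powRD ?(gt_eqF nn) ?implybT// [(32 * _)^-1]invfM.
by rewrite le_eqVlt; apply/orP; left; apply/eqP; ring.
Qed.

(** The cube of [cube_bound_l1], sliced along the first factor, against the diagonal functional;
    this yields the lower bounds of (4) and, for p_1 < 2, of (5). *)
Lemma vr_lower_diag :
  exists2 c : R, 0 < c & forall n, (0 < n)%N ->
    c * n%:R `^ (2^-1 - \sum_(j < k | j != Ordinal k0) r j - Num.max (1 - S) 0) <= v n.
Proof.
set S' := \sum_(j < k | _) _.
exists (32 * (4 * 3 ^+ k))^-1; first by rewrite invr_gt0 !mulr_gt0 ?exprn_gt0.
case=> // n' _; have nn : 0 < n'.+1%:R :> R by rewrite ltr0n.
have K0 : 0 < 4 * 3 ^+ k :> R by rewrite mulr_gt0 ?exprn_gt0.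
have b0 : 0 < 4 * 3 ^+ k * n'.+1%:R `^ (S' + k%:R / 2) by rewrite mulr_gt0 ?powR_gt0.
have := vr_lower_cube b0 (powR_gt0 (Num.max (1 - S) 0 - 2^-1) nn)
  (fun A => @cube_bound_l1 R k n'.+1 k0 isT r (Ordinal k0) A k1 r0)
  (fun s => @inradius_diag R k n'.+1 k0 isT r s r0).
apply: le_trans; rewrite [(4 * _ * _)^-1]invfM [(32 * _ `^ _)^-1]invfM -!powRN [(32 * _)^-1]invfM.
have -> : 2^-1 - S' - Num.max (1 - S) 0 =
  - (S' + k%:R / 2) + - (Num.max (1 - S) 0 - 2^-1) + k%:R / 2 by ring.
rewrite !powRD ?(gt_eqF nn) ?implybT//.
by rewrite le_eqVlt; apply/orP; left; apply/eqP; ring.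
Qed.

End Asymptotics.

(** * Choosing the sliced factors and the exponent of the covering *)

Section Exponents.
Variables (R : realType) (k : nat) (r : 'I_k -> R).
Hypotheses (k1 : (1 < k)%N) (r01 : forall j, 0 <= r j <= 1).
Hypothesis rdec : forall i j : 'I_k, (i <= j)%N -> r j <= r i.
Local Notation v n := (vr (@pn R k n (fun j => lpn (r j)))).
Local Notation S := (\sum_j r j).

Let k0 : (0 < k)%N := ltnW k1.
Let r0 j : 0 <= r j.
Proof. by case/andP: (r01 j). Qed.

Definition tail_sum (a : nat) : R := \sum_(j < k | (a <= j)%N) r j.

Lemma sum_const_tail (a : nat) (c : R) : (a <= k)%N ->
  \sum_(j < k | (a <= j)%N) c = (k%:R - a%:R) * c.
Proof.
move=> ak; transitivity (\sum_(a <= j < k) c); first by rewrite big_geq_mkord.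
by rewrite sumr_const_nat -natrB// mulr_natl.
Qed.

Lemma vr_upper2 (a : nat) (e : R) : (a < k)%N ->
  \sum_j Num.max (2^-1 - r j) 0 - k%:R / 2 + a%:R / 2 + Num.max (tail_sum a) 2^-1 <= e ->
  exists2 C : R, 0 < C & forall n, (0 < n)%N -> v n <= C * n%:R `^ e.
Proof.
move=> ak he; have q12 : ((1 <= 2 :> R) && (2 <= 2 :> R)) by apply/andP; split; lra.
have [C C0 hC] := vr_upper_lesssim k1 r01 q12 ak.
exists C => // n n0; apply: le_trans (hC n n0) _; rewrite ler_wpM2l ?(ltW C0)//.
apply: ler_powR; first by rewrite ler1n.
apply: le_trans he; rewrite /inradius_exponent -/(tail_sum a).
have -> : k%:R = k.-1%:R + 1 :> R by rewrite natr1 prednK.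
by rewrite le_eqVlt; apply/orP; left; apply/eqP; field.
Qed.

Lemma sum_max_split (a : nat) : (a <= k)%N ->
  (forall j : 'I_k, (j < a)%N -> 2^-1 <= r j) -> (forall j : 'I_k, (a <= j)%N -> r j <= 2^-1) ->
  \sum_j Num.max (2^-1 - r j) 0 = (k%:R - a%:R) / 2 - tail_sum a.
Proof.
move=> ak h1 h2; rewrite (bigID (fun j : 'I_k => (a <= j)%N)) /= [X in _ + X]big1 ?addr0.
  rewrite -sum_const_tail// -sumrB; apply: eq_bigr => j aj.
  by rewrite max_l// subr_ge0 h2.
by move=> j; rewrite -ltnNge => ja; rewrite max_r// subr_le0 h1.
Qed.

Lemma tail_sum_ge (a : nat) (j : 'I_k) : (a <= j)%N -> r j <= tail_sum a.
Proof. by move=> aj; rewrite /tail_sum (bigD1 j)//= lerDl sumr_ge0. Qed.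

Lemma tail_sum_le (a b : nat) : (a <= b)%N -> tail_sum b <= tail_sum a.
Proof.
move=> ab; rewrite /tail_sum [leRHS](bigID (fun j : 'I_k => (b <= j)%N)) /=.
rewrite [X in X + _](eq_bigl (fun j : 'I_k => (b <= j)%N)); first by rewrite lerDl sumr_ge0.
by move=> j; case: (leqP b j) => bj; rewrite ?andbF// (leq_trans ab bj).
Qed.

Lemma tail_sumE (j : 'I_k) : tail_sum j = r j + tail_sum j.+1.
Proof.
rewrite /tail_sum (bigD1 j)//=; congr (_ + _); apply: eq_bigl => i.
by rewrite ltn_neqAle andbC eq_sym.
Qed.

Lemma tail_sum_last : tail_sum k = 0.
Proof. by rewrite /tail_sum big1// => j; rewrite leqNgt ltn_ord. Qed.

Lemma tail_sum0 : tail_sum 0 = S.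
Proof. by apply: eq_bigl. Qed.

(** Slice exactly the factors with 1/p_j >= 1/2. They lie in the Euclidean ball already and add
    nothing to the covering radius, and the terms in [a] and [k] cancel. *)
Lemma vr_upper_split (a : nat) : (a < k)%N ->
  (forall j : 'I_k, (j < a)%N -> 2^-1 <= r j) -> (forall j : 'I_k, (a <= j)%N -> r j <= 2^-1) ->
  exists2 C : R, 0 < C & forall n, (0 < n)%N ->
    v n <= C * n%:R `^ (Num.max (tail_sum a) 2^-1 - tail_sum a).
Proof.
move=> ak h1 h2; apply: (vr_upper2 ak); rewrite (sum_max_split (ltnW ak) h1 h2).
by rewrite le_eqVlt; apply/orP; left; apply/eqP; field.
Qed.

(** Here q = p_k, and no factor has a larger exponent, so the l_q radius of the ball is bounded in
    [n]. With all factors but the last sliced, the powers of [n] cancel. *)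
Lemma vr_upper_le2 (j : 'I_k) : j.+1 = k :> nat -> 2^-1 <= r j ->
  exists2 C : R, 0 < C & forall n, (0 < n)%N -> v n <= C.
Proof.
move=> jk rj; have rp : 0 < r j by apply: lt_le_trans rj; rewrite invr_gt0.
have q12 : 1 <= (r j)^-1 <= 2.
  have /andP[_ rj1] := r01 j; rewrite invf_ge1// rj1 /=.
  by rewrite -[leRHS]invrK lef_pV2// posrE invr_gt0.
have [C C0 hC] := vr_upper_lesssim k1 r01 q12 (ltn_ord j).
exists C => // n n0; apply: le_trans (hC n n0) _.
rewrite invrK big1 ?add0r; last first.
  by move=> i _; rewrite max_r// subr_le0 rdec// -ltnS jk.
rewrite /inradius_exponent -/(tail_sum j) tail_sumE jk tail_sum_last addr0 max_l//.
have -> : k%:R = j%:R + 1 :> R by rewrite natr1 jk.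
have -> : k.-1 = j by rewrite -[in LHS]jk.
have -> : j%:R * (r j - 1) - (j%:R + 1) * r j + (j%:R / 2 + r j - 2^-1) +
  (j%:R + 1) / 2 = 0 by field.
by rewrite powRr0 mulr1.
Qed.

End Exponents.

Section Lesssim.
Variables (R : realType) (k : nat) (v : nat -> R).

(** The factor [k >= 1] only enlarges the right-hand side, as 2^(-k/2) <= 1 only shrinks the
    left-hand side in [lesssim_lower]. *)
Lemma lesssim_upper (e e' : R) : (0 < k)%N -> e <= e' ->
  (exists2 C : R, 0 < C & forall n, (0 < n)%N -> v n <= C * n%:R `^ e) ->
  lesssim v (fun n => k%:R * n%:R `^ e').
Proof.
move=> k0 ee [C C0 h]; exists C => // n n0; apply: le_trans (h n n0) _.
rewrite ler_wpM2l ?(ltW C0)//; apply: (@le_trans _ _ (n%:R `^ e')).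
  by apply: ler_powR; rewrite ?ler1n.
by rewrite ler_peMl ?powR_ge0// ler1n.
Qed.

Lemma lesssim_lower (e : R) :
  (exists2 c : R, 0 < c & forall n, (0 < n)%N -> c * n%:R `^ e <= v n) ->
  lesssim (fun n => 2 `^ (- (k%:R / 2)) * n%:R `^ e) v.
Proof.
move=> [c c0 h]; exists c^-1; first by rewrite invr_gt0.
move=> n n0; rewrite ler_pdivlMl//; apply: le_trans (h n n0).
rewrite mulrA mulrAC ler_piMr ?mulr_ge0 ?powR_ge0 ?(ltW c0)//.
apply: (@le_trans _ _ (2 `^ 0)); last by rewrite powRr0.
apply: ler_powR; first by rewrite ler1n.
by rewrite oppr_le0 divr_ge0.
Qed.

End Lesssim.

Theorem theorem4 (R : realType) (k : nat) (p : nat -> \bar R)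
    (hk : (3 <= k)%N)
    (hp1 : (1%:E <= p 1%N)%E)
    (hp : forall i j : nat, (1 <= i)%N -> (i <= j)%N -> (j <= k)%N ->
            (p i <= p j)%E) :
  let v : nat -> R := fun n => vr (@projective_norm R k p n) in
  let r : nat -> R := fun j => recip (p j) in
  [/\
    (* (1) *)
    (p k <= 2%:E)%E ->
      lesssim (fun _ => 1) v /\ lesssim v (fun _ => k%:R),
    (* (2) *)
    1 <= \sum_(1 <= j < k.+1) r j ->
    (p k.-1 <= 2%:E)%E -> (2%:E < p k)%E ->
      lesssim (fun _ => 1) v /\
      lesssim v (fun n => k%:R *
        n%:R `^ (Num.min (r k.-1 + r k) 1 - r k - 2^-1)),
    (* (3) *)
    1 <= \sum_(1 <= j < k.+1) r j ->
    (2%:E < p k.-1)%E ->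
      lesssim (fun _ => 1) v /\
      lesssim v (fun n => k%:R *
        n%:R `^ (Num.max (r k.-1 + r k) 2^-1 - r k.-1 - r k)),
    (* (4) *)
    1 <= \sum_(1 <= j < k.+1) r j ->
    \sum_(2 <= j < k.+1) r j <= 2^-1 ->
      lesssim (fun n => 2 `^ (- (k%:R / 2)) *
        n%:R `^ (2^-1 - \sum_(2 <= j < k.+1) r j)) v /\
      lesssim v (fun n => k%:R *
        n%:R `^ (2^-1 - \sum_(2 <= j < k.+1) r j)) &
  [/\
    (* (5) *)
    2^-1 <= \sum_(1 <= j < k.+1) r j ->
    \sum_(1 <= j < k.+1) r j <= 1 ->
      lesssim (fun n => 2 `^ (- (k%:R / 2)) *
        n%:R `^ (Num.max (r 1%N - 2^-1) 0)) v /\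
      lesssim v (fun n => k%:R *
        n%:R `^ (Num.max (r 1%N - 2^-1) 0)) &
    (* (6) *)
    \sum_(1 <= j < k.+1) r j <= 2^-1 ->
      lesssim (fun n => 2 `^ (- (k%:R / 2)) *
        n%:R `^ (2^-1 - \sum_(1 <= j < k.+1) r j)) v /\
      lesssim v (fun n => k%:R *
        n%:R `^ (2^-1 - \sum_(1 <= j < k.+1) r j))]].
Proof.
move=> v r.
have k0 : (0 < k)%N by apply: leq_trans hk.
have k1 : (1 < k)%N by apply: leq_trans hk.
have p1 (j : 'I_k) : (1%:E <= p j.+1)%E by apply: le_trans hp1 (hp _ _ _ _ _).
pose rr (j : 'I_k) := r j.+1.
have r01 j : 0 <= rr j <= 1 by apply: recip_le1.
have rr0 j : 0 <= rr j by case/andP: (r01 j).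
have rdec (i j : 'I_k) : (i <= j)%N -> rr j <= rr i.
  by move=> ij; have /andP[] := recip_le (p1 i) (hp i.+1 j.+1 isT ij (ltn_ord j)).
have vE : v = fun n => vr (@pn R k n (fun j => lpn (rr j))).
  by apply/funext => n; rewrite /v; congr vr; apply/funext => A; apply: projective_normE.
pose upper (e : R) := exists2 C : R, 0 < C & forall n, (0 < n)%N -> v n <= C * n%:R `^ e.
pose lower (e : R) := exists2 c : R, 0 < c & forall n, (0 < n)%N -> c * n%:R `^ e <= v n.
have upper2 (a : nat) (e : R) : (a < k)%N ->
    \sum_j Num.max (2^-1 - rr j) 0 - k%:R / 2 + a%:R / 2 + Num.max (tail_sum rr a) 2^-1 <= e ->
    upper e.
  by move=> ak he; rewrite /upper vE; apply: vr_upper2 he.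
have upper_split (a : nat) : (a < k)%N ->
    (forall j : 'I_k, (j < a)%N -> 2^-1 <= rr j) -> (forall j : 'I_k, (a <= j)%N -> rr j <= 2^-1) ->
    upper (Num.max (tail_sum rr a) 2^-1 - tail_sum rr a).
  by move=> ak h1 h2; rewrite /upper vE; apply: vr_upper_split.
have upper_le2 (j : 'I_k) : j.+1 = k :> nat -> 2^-1 <= rr j ->
    exists2 C : R, 0 < C & forall n, (0 < n)%N -> v n <= C.
  by move=> jk hj; rewrite vE; apply: vr_upper_le2 jk hj.
have lower_sum : lower (2^-1 - \sum_j rr j) by rewrite /lower vE; apply: vr_lower_small_sum.
have lower_diag : lower (2^-1 - tail_sum rr 1 - Num.max (1 - \sum_j rr j) 0).
  have -> : tail_sum rr 1 = \sum_(j < k | j != Ordinal k0) rr j.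
    by apply: eq_bigl => j; rewrite lt0n.
  by rewrite /lower vE; apply: vr_lower_diag.
have one : lesssim (fun=> 1) v by rewrite vE; apply: vr_ge1_lesssim.
have tailE a : \sum_(a.+1 <= j < k.+1) r j = tail_sum rr a.
  by rewrite big_add1 /= big_geq_mkord.
have SE : \sum_(1 <= j < k.+1) r j = \sum_j rr j by rewrite tailE tail_sum0.
have kl : (k.-1 < k)%N by rewrite prednK.
have km : (k.-2 < k)%N by apply: leq_ltn_trans kl; apply: leq_pred.
pose jl := Ordinal kl; pose jm := Ordinal km.
have kl1 : k.-1.+1 = k by rewrite prednK.
have k12 : (0 < k.-1)%N by rewrite -ltnS kl1.
have km1 : k.-2.+1 = k.-1 by rewrite (prednK k12).
have rl : r k = rr jl by rewrite /rr /= kl1.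
have rm : r k.-1 = rr jm by rewrite /rr /= km1.
have taill : tail_sum rr k.-1 = rr jl.
  have := @tail_sumE R k rr jl; rewrite /= kl1 tail_sum_last addr0; exact.
have tailm : tail_sum rr k.-2 = rr jm + rr jl.
  have := @tail_sumE R k rr jm; rewrite /= km1 taill; exact.
have recip_ge (j : 'I_k) : (p j.+1 <= 2%:E)%E -> 2^-1 <= rr j.
  by move=> h; have /andP[_] := recip_le (p1 j) h; rewrite recip2.
have recip_lt (j : 'I_k) : (2%:E < p j.+1)%E -> rr j <= 2^-1.
  have le12 : (1%:E <= 2%:E :> \bar R)%E by rewrite lee_fin ler1n.
  by move=> /ltW h; have /andP[_] := recip_le le12 h; rewrite recip2.
have S_tail1 : \sum_j rr j = rr (Ordinal k0) + tail_sum rr 1.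
  by rewrite -tail_sum0; apply: (@tail_sumE R k rr (Ordinal k0)).
have split1 : 2^-1 <= rr (Ordinal k0) -> forall j : 'I_k, (j < 1)%N -> 2^-1 <= rr j.
  move=> h j; rewrite ltnS leqn0 => /eqP j0.
  have -> : j = Ordinal k0 by apply: val_inj.
  exact: h.
have none (j : 'I_k) : (j < 0)%N -> 2^-1 <= rr j by [].
have le_tail1 (j : 'I_k) : (1 <= j)%N -> rr j <= tail_sum rr 1 by apply: tail_sum_ge.
have r1E : r 1%N = rr (Ordinal k0) by [].
clearbody v rr.
split.
- move=> pk; split; first exact: one.
  have h : 2^-1 <= rr jl by apply: recip_ge; rewrite /= prednK.
  have jlk : jl.+1 = k :> nat by rewrite /= prednK.
  have [C C0 hC] := upper_le2 jl jlk h.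
  exists C; first exact: C0.
  move=> n n0; apply: le_trans (hC n n0) _.
  by rewrite ler_peMr ?(ltW C0)// ler1n.
- move=> _ pm pl; split; first exact: one.
  rewrite rl rm.
  have hm : 2^-1 <= rr jm by apply: recip_ge; rewrite /= prednK// -ltnS prednK.
  have hl : rr jl <= 2^-1 by apply: recip_lt; rewrite /= prednK.
  have h1 (j : 'I_k) : (j < k.-1)%N -> 2^-1 <= rr j.
    move=> jk; apply: le_trans hm (rdec _ _ _) => /=.
    by rewrite -ltnS prednK// -ltnS prednK.
  have h2 (j : 'I_k) : (k.-1 <= j)%N -> rr j <= 2^-1.
    by move=> jk; apply: le_trans (rdec jl j _) hl.
  (* The two values of the minimum: for a sum at most 1 it is better to leave the last two factors
     unsliced, which gives r_(k-1) - 1/2; otherwise only the last one, which gives 1/2 - r_k. *)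
  have [h|h] := leP (rr jm + rr jl) 1.
    apply: (lesssim_upper k0 (lexx _)); apply: (upper2 k.-2 _ km).
    rewrite (sum_max_split (ltnW kl) h1 h2) taill tailm max_l; last by have := rr0 jl; lra.
    have -> : k%:R = k.-1%:R + 1 :> R by rewrite natr1 prednK.
    have -> : k.-1%:R = k.-2%:R + 1 :> R by rewrite natr1 prednK// -ltnS prednK.
    by lra.
  apply: (lesssim_upper k0 _ (upper_split _ kl h1 h2)).
  by rewrite taill max_r//; lra.
- move=> _ pm; split; first exact: one.
  rewrite rl rm.
  have hm : rr jm <= 2^-1 by apply: recip_lt; rewrite /= prednK// -ltnS prednK.
  (* The least [a] with this property separates exponents above and below 1/2. It is at most k - 2,
     so the tail sum is at least r_(k-1) + r_k, and max(t, 1/2) - t decreases in t. *)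
  pose P a := [forall j : 'I_k, (a <= j)%N ==> (rr j <= 2^-1)].
  have exP : exists a, P a.
    by exists k.-2; apply/forallP => j; apply/implyP => jk; apply: le_trans hm; apply: rdec.
  case: (ex_minnP exP) => a /forallP Pa amin.
  have ak : (a <= k.-2)%N.
    by apply: amin; apply/forallP => j; apply/implyP => jk; apply: le_trans hm; apply: rdec.
  have h2 (j : 'I_k) : (a <= j)%N -> rr j <= 2^-1 by apply/implyP.
  have h1 (j : 'I_k) : (j < a)%N -> 2^-1 <= rr j.
    move=> ja; rewrite leNgt; apply/negP => rj.
    have : P j.
      by apply/forallP => i; apply/implyP => ji; apply: le_trans (rdec _ _ ji) (ltW rj).
    by move=> /amin; rewrite leqNgt ja.
  have ak' : (a < k)%N by exact: leq_ltn_trans ak km.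
  apply: (lesssim_upper k0 _ (upper_split _ ak' h1 h2)).
  have := tail_sum_le r01 ak; rewrite tailm => ht.
  rewrite -addrA -opprD; have [hs|hs] := leP (tail_sum rr a) 2^-1.
    by apply: lerB => //; rewrite le_max lexx orbT.
  by rewrite subrr subr_ge0 le_max lexx.
- rewrite SE tailE => S1 T1.
  have r0h : 2^-1 <= rr (Ordinal k0) by move: S1 T1; rewrite S_tail1; clear; lra.
  have h2 (j : 'I_k) : (1 <= j)%N -> rr j <= 2^-1 by move=> /le_tail1 h; apply: le_trans h T1.
  split.
    (* When the exponents sum to at least 1, the diagonal functional has norm at most 1 and the
       correction vanishes. *)
    move: lower_diag; rewrite [Num.max _ _]max_r ?subr_le0// subr0.
    exact: lesssim_lower.
  apply: (lesssim_upper k0 _ (upper_split _ k1 (split1 r0h) h2)).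
  by rewrite max_r.
split.
- rewrite SE => S1 S2; rewrite r1E.
  have h2 (j : 'I_k) : (1 <= j)%N -> rr j <= 2^-1.
    move=> /[dup] /le_tail1 h j1; have := rdec (Ordinal k0) j (leq0n _).
    by move: h S2; rewrite S_tail1; clear; lra.
  have [r0h|/ltW r0h] := leP (rr (Ordinal k0)) 2^-1.
    have h0 (j : 'I_k) : (0 <= j)%N -> rr j <= 2^-1.
      by move=> _; apply: le_trans (rdec (Ordinal k0) j (leq0n _)) r0h.
    rewrite max_r ?subr_le0//; split.
      have [C C0 hC] := one.
      apply: lesssim_lower; exists C^-1; first by rewrite invr_gt0.
      by move=> n n0; rewrite powRr0 ler_pdivrMl// hC.
    apply: (lesssim_upper k0 _ (upper_split _ k0 none h0)).
    by rewrite tail_sum0 max_l// subrr.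
  rewrite max_l ?subr_ge0//; split.
    move: lower_diag; rewrite [Num.max _ _]max_l ?subr_ge0//.
    have -> : 2^-1 - tail_sum rr 1 - (1 - \sum_j rr j) = rr (Ordinal k0) - 2^-1.
      by rewrite S_tail1; lra.
    exact: lesssim_lower.
  (* No factor is sliced although p_1 < 2: slicing the first would give 1/2 minus the tail sum,
     which is at least r_1 - 1/2 because the total is at most 1. *)
  apply: (lesssim_upper k0 (lexx _)); apply: (upper2 0%N _ k0).
  rewrite (sum_max_split k0 (split1 r0h) h2) tail_sum0 max_l//.
  by rewrite S_tail1; lra.
rewrite SE => S2.
have h0 (j : 'I_k) : (0 <= j)%N -> rr j <= 2^-1.
  by move=> j0; apply: le_trans S2; rewrite -tail_sum0; apply: tail_sum_ge.
split; first exact: lesssim_lower lower_sum.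
apply: (lesssim_upper k0 _ (upper_split _ k0 none h0)).
by rewrite tail_sum0 max_r.
Qed.
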